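(* Let $(E,\mathcal{E})$ be a measurable space such that $\mathcal{E}$ is countably generated and let $Q\in\mathcal{T}(E,\mathcal{E})$. (i) We have $r_e(Q)=\inf_{\ell\ge1,\ \nu\in\mathcal{P}}\Delta_\nu(Q^\ell)^{1/\ell}$. (ii) Set $\mathcal{K}^*=\{T_{\nu,\alpha}:\nu\in\mathcal{P},\ \alpha\in\mathcal{H}_\nu\}$. Then $$r_e(Q)=\inf\big\{\|Q^\ell-T\|^{1/\ell}:\ell\ge1,\ T\in\mathcal{K}^*,\ Q^\ell-T\ge0\big\}=\inf\big\{r(Q^\ell-T)^{1/\ell}:\ell\ge1,\ T\in\mathcal{K}^*,\ Q^\ell-T\ge0\big\}.$$
   Context: A bounded positive kernel on $(E,\mathcal{E})$ is a function $Q:E\times\mathcal{E}\to\mathbb{R}_+$ such that $Q(\cdot,A)$ is $\mathcal{E}$-measurable for every $A\in\mathcal{E}$, $Q(x,\cdot)$ is a positive measure for every $x\in E$, and $\sup_{x}Q(x,E)<+\infty$; $\mathcal{T}(E,\mathcal{E})$ is the set of these. $\mathcal{B}$ is the Banach space of bounded measurable complex functions on $E$ with the supremum norm. Kernels are identified with the bounded operators $Qf(x)=\int_E f(y)\,Q(x,dy)$ on $\mathcal{B}$; $\|\cdot\|$ also denotes the operator norm on $\mathcal{B}$. $K_1-K_2\ge0$ means $K_1(x,A)\ge K_2(x,A)$ for all $(x,A)\in E\times\mathcal{E}$. $\mathcal{P}$ is the set of probability measures on $(E,\mathcal{E})$. For $\nu\in\mathcal{P}$: $\Delta_\nu(Q)=\limsup_{A\in\mathcal{E},\,\nu(A)\to0}\big(\sup_{x\in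 E}Q(x,A)\big)$, i.e. $\lim_{\eta\to0^+}\sup\{Q(x,A):x\in E,\ A\in\mathcal{E},\ \nu(A)\le\eta\}$; $\mathcal{H}_\nu$ is the set of nonnegative $\mathcal{E}\otimes\mathcal{E}$-measurable functions $\alpha$ on $E\times E$ such that $\lim_{m\to+\infty}\sup_{x\in E}\int_{\{y:\alpha(x,y)\ge m\}}\alpha(x,y)\,d\nu(y)=0$; and $T_{\nu,\alpha}(x,A)=\int_A\alpha(x,y)\,d\nu(y)$. $r(\cdot)$ is the spectral radius of a bounded operator on $\mathcal{B}$. The essential spectral radius $r_e(T)$ of a bounded operator $T$ on a Banach space $\mathcal{B}$ is the infimum of $r(T)$ and of the real numbers $\rho\ge0$ such that $\mathcal{B}=F_\rho\oplus H_\rho$ where $F_\rho,H_\rho$ are $T$-invariant subspaces, $H_\rho$ is closed, $r(T_{|H_\rho})<\rho$, $\dim F_\rho<+\infty$ and all eigenvalues of $T_{|F_\rho}$ have modulus $\ge\rho$. *)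

(* Defs.v *)
From HB Require Import structures.
From mathcomp Require Import all_boot all_order all_algebra.
From mathcomp Require Import all_classical all_reals all_analysis.
From mathcomp Require Import measurable_realfun kernel complex.

Set Implicit Arguments.
Unset Strict Implicit.
Unset Printing Implicit Defensive.

Import Order.TTheory GRing.Theory Num.Theory.
Import numFieldNormedType.Exports.
Import KCOMP_FINITE_KERNEL.

Local Open Scope classical_set_scope.
Local Open Scope ring_scope.
Local Open Scope complex_scope.

Lemma Re_normcK {R : realType} (z : R[i]) : (complex.Re `|z|)%:C = `|z|.
Proof. by rewrite RRe_real// normr_real. Qed.

Section spectral_theory.
Context {R : realType} {V : normedModType R[i]}.
Implicit Types (F H : set V) (S T : V -> V).

(* In a normed module over R[i] the norm is R[i]-valued; this is its value
   as an element of R. *)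
Definition rnorm (v : V) : R := complex.Re `|v|.

Definition opnorm T : R := sup [set rnorm (T v) | v in [set v | rnorm v <= 1]].

Definition linear_subspace F :=
  F 0 /\ forall (a : R[i]) u v, F u -> F v -> F (a *: u + v).

Definition stable_under T F := forall v, F v -> F (T v).

Definition linear_on H S :=
  forall (a : R[i]) u v, H u -> H v -> S (a *: u + v) = a *: S u + S v.

Definition bounded_on H S :=
  exists M : R, forall v, H v -> rnorm (S v) <= M * rnorm v.

(* z is in the resolvent set of the restriction of T to the T-invariant
   subspace H: z - T has a two-sided inverse among the bounded linear operators
   on H. *)
Definition resolvent_set_on H T : set R[i] :=
  [set z | exists S, [/\ stable_under S H, linear_on H S, bounded_on H S,
     forall v, H v -> S (z *: v - T v) = v
   & forall v, H v -> z *: S v - T (S v) = v]].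

Definition spectrum_on H T : set R[i] := ~` resolvent_set_on H T.

(* Since sup set0 = 0, the spectral radius on the zero subspace (whose
   spectrum is empty) is 0. *)
Definition spectral_radius_on H T : R :=
  sup [set complex.Re `|z| | z in spectrum_on H T].

Definition spectral_radius T : R := spectral_radius_on [set: V] T.

Definition finite_dimensional F :=
  exists n (e : 'I_n -> V),
    F `<=` [set \sum_(i < n) a i *: e i | a in [set: 'I_n -> R[i]]].

Definition direct_sum F H :=
  (forall v, exists f h, [/\ F f, H h & v = f + h]) /\ F `&` H = [set 0].

Definition quasicompact_splitting T (rho : R) F H :=
  [/\ [/\ linear_subspace F, linear_subspace H & direct_sum F H],
      [/\ stable_under T F & stable_under T H],
      [/\ closed H & spectral_radius_on H T < rho],
      finite_dimensional F
    & forall (z : R[i]) v, F v -> v != 0 -> T v = z *: v ->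
        rho <= complex.Re `|z|].

Definition ess_spectral_radius T : R :=
  inf (spectral_radius T |` [set rho | 0 <= rho /\
         exists F H, quasicompact_splitting T rho F H]).

End spectral_theory.

Section bounded_measurable.
Context {d : measure_display} {E : measurableType d} {R : realType}.

Definition bounded_measurable : set (E -> R[i]) :=
  [set f : E -> R[i] | [/\ measurable_fun [set: E] (fun x => complex.Re (f x)),
               measurable_fun [set: E] (fun x => complex.Im (f x))
             & exists M : R, forall x, `|f x| <= M%:C]].

Definition bmfun_pred : {pred E -> R[i]} := fun f => f \in bounded_measurable.

Lemma bmfunP f : reflect (bounded_measurable f) (f \in bmfun_pred).
Proof. by rewrite unfold_in; apply: (iffP idP); rewrite inE. Qed.

Lemma bmfun_submod_closed : submod_closed bmfun_pred.
Proof.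
split.
  apply/bmfunP; split; [exact: measurable_cst|exact: measurable_cst|].
  by exists 0 => x; rewrite normr0.
move=> a f g /bmfunP[mrf mif [M fM]] /bmfunP[mrg mig [N gN]]; apply/bmfunP.
split.
- rewrite (_ : (fun _ => _) = (fun x => (complex.Re a * complex.Re (f x)
      - complex.Im a * complex.Im (f x)) + complex.Re (g x))); last first.
    apply/funext => x; rewrite !fctE.
    by case: a (f x) (g x) => [? ?] [? ?] [? ?].
  by apply: measurable_funD => //; apply: measurable_funB;
    apply: measurable_funM => //; exact: measurable_cst.
- rewrite (_ : (fun _ => _) = (fun x => (complex.Re a * complex.Im (f x)
      + complex.Im a * complex.Re (f x)) + complex.Im (g x))); last first.
    apply/funext => x; rewrite !fctE.
    by case: a (f x) (g x) => [? ?] [? ?] [? ?].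
  by apply: measurable_funD => //; apply: measurable_funD;
    apply: measurable_funM => //; exact: measurable_cst.
- exists (complex.Re `|a| * M + N) => x; rewrite !fctE.
  have -> : (complex.Re `|a| * M + N)%:C = `|a| * M%:C + N%:C.
    by rewrite -(Re_normcK a) -rmorphM -rmorphD Re_normcK.
  by rewrite (le_trans (ler_normD _ _))// lerD// normrM ler_wpM2l.
Qed.

End bounded_measurable.

(* The space of bounded measurable complex functions on E, with the supremum
   norm. *)
Record bmfun d (E : measurableType d) (R : realType) := Bmfun {
  bmfun_fun :> E -> R[i] ;
  _ : bmfun_fun \in bmfun_pred }.

Section bmfun_normed.
Context {d : measure_display} {E : measurableType d} {R : realType}.
Implicit Types f g : bmfun E R.

HB.instance Definition _ := [isSub for @bmfun_fun d E R].
HB.instance Definition _ := [Choice of bmfun E R by <:].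
HB.instance Definition _ := GRing.isSubmodClosed.Build _ _ (@bmfun_pred d E R)
  bmfun_submod_closed.
HB.instance Definition _ := [SubChoice_isSubLmodule of bmfun E R by <:].

Lemma bmfun_boundedP f : bounded_measurable (f : E -> R[i]).
Proof. by apply/bmfunP; case: f. Qed.

Definition supnorm f : R :=
  sup [set complex.Re `|f x| | x in [set: E]].

Lemma supnorm_has_sup f :
  has_sup [set complex.Re `|f x| | x in [set: E]].
Proof.
split; first by exists (complex.Re `|f point|), point.
have [_ _ [M fM]] := bmfun_boundedP f.
by exists M => _ [x _ <-]; rewrite -lecR Re_normcK.
Qed.

Lemma supnorm_ub f x : `|f x| <= (supnorm f)%:C.
Proof.
rewrite -Re_normcK lecR; apply: sup_upper_bound; first exact: supnorm_has_sup.
by exists x.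
Qed.

Lemma supnorm_le f (M : R) : (forall x, `|f x| <= M%:C) -> supnorm f <= M.
Proof.
move=> fM; apply: ge_sup; first by exists (complex.Re `|f point|), point.
by move=> _ [x _ <-]; rewrite -lecR Re_normcK.
Qed.

Let norm f : R[i] := (supnorm f)%:C.

Let ler_normD f g : norm (f + g) <= norm f + norm g.
Proof.
rewrite /norm -rmorphD lecR; apply: supnorm_le => x.
by rewrite rmorphD (le_trans (ler_normD _ _))// lerD// supnorm_ub.
Qed.

Let normZ_le (a : R[i]) f : norm (a *: f) <= `|a| * norm f.
Proof.
rewrite /norm -(Re_normcK a) -rmorphM lecR; apply: supnorm_le => x.
rewrite rmorphM /= Re_normcK.
by rewrite [X in X <= _](_ : _ = `|a| * `|f x|) ?ler_wpM2l ?supnorm_ub// -normrM.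
Qed.

Let normr0_eq0 f : norm f = 0 -> f = 0.
Proof.
move=> f0; apply/val_inj/funext => x; apply/eqP.
by rewrite -normr_le0 -f0; exact: supnorm_ub.
Qed.

Let normrZ (a : R[i]) f : norm (a *: f) = `|a| * norm f.
Proof.
apply/eqP; rewrite eq_le normZ_le/=.
have [->|a0] := eqVneq a 0.
  rewrite normr0 mul0r /norm lecR -lecR.
  by apply: le_trans (supnorm_ub _ point); exact: normr_ge0.
rewrite -ler_pdivlMl ?normr_gt0// -normfV.
by rewrite -{1}(scale1r f) -(mulVf a0) -scalerA normZ_le.
Qed.

HB.instance Definition _ := @Lmodule_isNormed.Build R[i] (bmfun E R) norm
  ler_normD normrZ normr0_eq0.

End bmfun_normed.

(* R.-fker E ~> E is the type of bounded positive kernels: K x is a measure,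
   K ^~ A is measurable and K x E is uniformly bounded in x. *)
Section kernel_operator.
Context {d : measure_display} {E : measurableType d} {R : realType}.
Implicit Types (K L Q : R.-fker E ~> E).

Definition kop_fun K (f : E -> R[i]) (x : E) : R[i] :=
  (\int[K x]_y complex.Re (f y)) +i* (\int[K x]_y complex.Im (f y)).

Let kernel_bounded_integrable K x (g : E -> R) (M : R) :
  measurable_fun [set: E] g -> (forall y, `|g y| <= M) ->
  (K x).-integrable [set: E] (EFin \o g).
Proof.
move=> mg gM.
have Kfin : (K x [set: E] < +oo)%E.
  by have [r Kr] := measure_uub K; rewrite (lt_trans (Kr x))// ltry.
apply: measurable_bounded_integrable => //.
exists M; split; first exact: num_real.
by move=> t Mt y _ /=; exact: le_trans (gM y) (ltW Mt).
Qed.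

Let kernel_Rintegral_measurable K (g : E -> R) :
  measurable_fun [set: E] g ->
  measurable_fun [set: E] (fun x => \int[K x]_y g y).
Proof.
move=> mg; apply: measurableT_comp => //.
under eq_fun do rewrite integralE.
apply: emeasurable_funB.
- apply: measurable_fun_integral_kernel => //.
  + by move=> U mU; exact: measurable_kernel.
  + exact/measurable_funepos/measurable_EFinP.
- apply: measurable_fun_integral_kernel => //.
  + by move=> U mU; exact: measurable_kernel.
  + exact/measurable_funeneg/measurable_EFinP.
Qed.

Let kernel_Rintegral_bounded K (g : E -> R) (M : R) :
  measurable_fun [set: E] g -> (forall y, `|g y| <= M) ->
  exists N : R, forall x, `|\int[K x]_y g y| <= N.
Proof.
move=> mg gM; have [r Kr] := measure_uub K.
have M0 : 0 <= M by exact: le_trans (normr_ge0 _) (gM point).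
exists (M * r) => x.
have ig := kernel_bounded_integrable K x mg gM.
have Kfin : K x [set: E] \is a fin_num.
  by rewrite ge0_fin_numE// (lt_trans (Kr x))// ltry.
rewrite (le_trans (le_normr_Rintegral _ ig))//.
rewrite (@le_trans _ _ (\int[K x]_y (cst M y)))//.
  apply: le_Rintegral => //.
  - exact: (integrable_norm ig).
  - apply: (@kernel_bounded_integrable K x (cst M) M) => // y.
    by rewrite ger0_norm.
rewrite Rintegral_cst// ler_wpM2l// -lee_fin fineK//.
exact/ltW/Kr.
Qed.

Lemma kop_subproof K (f : bmfun E R) : kop_fun K f \in bmfun_pred.
Proof.
have [mr mi [M fM]] := bmfun_boundedP f.
have rM y : `|complex.Re (f y)| <= M.
  by rewrite -lecR; apply: le_trans (normc_ge_Re _) (fM y).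
have iM y : `|complex.Im (f y)| <= M.
  rewrite -lecR; apply: le_trans (fM y).
  rewrite normc_def lecR -sqrtr_sqr ler_sqrt ?addr_ge0 ?sqr_ge0//.
  by rewrite lerDr sqr_ge0.
apply/bmfunP; split; [exact: kernel_Rintegral_measurable..|].
have [N1 h1] := kernel_Rintegral_bounded K mr rM.
have [N2 h2] := kernel_Rintegral_bounded K mi iM.
exists (N1 + N2) => x; rewrite rmorphD [kop_fun K f x]complexE.
apply: le_trans (ler_normD _ _) _; apply: lerD.
- by rewrite normc_def /= expr0n /= addr0 sqrtr_sqr lecR.
- rewrite normrM (_ : `|'i%C| = 1) ?mul1r; last first.
    by rewrite normc_def /= expr0n /= add0r expr1n sqrtr1.
  by rewrite normc_def /= expr0n /= addr0 sqrtr_sqr lecR.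
Qed.

(* The operator Kf(x) = \int f(y) K(x, dy) associated with the kernel K. *)
Definition kop K : bmfun E R -> bmfun E R :=
  fun f => Bmfun (kop_subproof K f).

Definition ksnd K : E * E -> {measure set E -> \bar R} := K \o snd.

Let measurable_ksnd K U : measurable U ->
  measurable_fun [set: E * E] (ksnd K ^~ U).
Proof.
move=> mU.
exact: (measurableT_comp (measurable_kernel K _ mU) measurable_snd).
Qed.

HB.instance Definition _ K :=
  @isKernel.Build _ _ _ _ _ (ksnd K) (@measurable_ksnd K).

Let ksnd_uub K : measure_fam_uub (ksnd K).
Proof. by have [r Kr] := measure_uub K; exists r => z; exact: Kr. Qed.

HB.instance Definition _ K :=
  @Kernel_isFinite.Build _ _ _ _ _ (ksnd K) (@ksnd_uub K).

Definition kmul K L : R.-fker E ~> E := (K \; ksnd L)%E.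

Lemma kmulE K L x A : kmul K L x A = (\int[K x]_y L y A)%E.
Proof. by []. Qed.

Definition kid : R.-fker E ~> E := kdirac (@measurable_id _ E [set: E]).

Definition kpow Q n : R.-fker E ~> E := iter n (kmul Q) kid.

(* K <= L, i.e., L - K is a nonnegative kernel *)
Definition kle K L := forall x A, measurable A -> (K x A <= L x A)%E.

Implicit Type nu : probability E R.

(* The supremum is nondecreasing in eta and bounded by sup_x K(x, E), so the
   limit exists and is finite. *)
Definition Delta nu K : \bar R :=
  lim (ereal_sup [set r : \bar R | exists x A,
         [/\ measurable A, (nu A <= eta%:E)%E & r = K x A]]
       @[eta --> (0 : R)^'+]).

Definition Hclass nu : set (E * E -> R) :=
  [set alpha : E * E -> R | [/\ measurable_fun [set: E * E] alpha,
                   forall z, 0 <= alpha z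
                 & ereal_sup [set r : \bar R | exists x : E,
                     r = (\int[nu]_(y in [set y | (m <= alpha (x, y))%R])
                            (alpha (x, y))%:E)%E]
                   @[m --> (+oo : set_system R)] --> 0%E]].

Definition Tfun nu (alpha : E * E -> R) (x : E) (A : set E) : \bar R :=
  (\int[nu]_(y in A) (alpha (x, y))%:E)%E.

(* When alpha is in Hclass nu, Tfun nu alpha is a bounded kernel, so the
   quantification over bounded kernels T excludes no pair (nu, alpha). *)
Definition Kstar : set (R.-fker E ~> E) :=
  [set T : R.-fker E ~> E | exists nu alpha, Hclass nu alpha /\
     forall x A, measurable A -> T x A = Tfun nu alpha x A].

End kernel_operator.

Definition countably_generated d (E : measurableType d) :=
  exists G : set (set E), countable G /\ d.-measurable = <<s G >>.

(* Main.v *)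
From HB Require Import structures.
Require Import Defs.
From mathcomp Require Import all_boot all_order all_algebra.
From mathcomp Require Import all_classical all_reals all_analysis.
From mathcomp Require Import measurable_realfun kernel complex ring lra zify.

Set Implicit Arguments.
Unset Strict Implicit.
Unset Printing Implicit Defensive.

Import Order.TTheory GRing.Theory Num.Theory.
Import numFieldNormedType.Exports.
Import KCOMP_FINITE_KERNEL.

Local Open Scope classical_set_scope.
Local Open Scope ring_scope.
Local Open Scope complex_scope.

(** Each of the three infima is compared with [r_e(Q)] through the cycle
    r_e(Q) <= inf r(Q^l - T)^(1/l) <= inf ||Q^l - T||^(1/l)
           <= inf Delta_nu(Q^l)^(1/l) <= r_e(Q).

    First inequality: if [T] has a density in [Hclass nu] and [S = Q^l - T >= 0],
    every word [T S^a T] is a norm limit of finite-rank operators.  Indeed [T] may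
    be truncated to a kernel with bounded density; conditioning this density on the
    finite partitions [cell A n] given by a generating sequence yields finite-rank
    operators [V n] with [|T f - V n f| <= ||f|| delta_n], where [delta_n -> 0]
    pointwise and boundedly; and [|T S^a g| <= T Q^(la) |g|] sends this to uniform
    convergence.  Expanding [(S + T)^n], the words with at most one [T] have norm
    [O(n theta^n)] for some [theta] with [r(S) < theta < rho^l], and the others are
    limits of finite-rank operators.  So some power of [Q] is a small operator plus
    a finite-rank one, and the Fredholm alternative gives the splitting at [rho].

    Third inequality: if [Delta_nu(P) < c], remove from [P x] the union of the cells
    on which [P x >= m nu].  For [m] large this removes mass at most [c], and what
    remains is dominated by [m nu], with a density obtained as a limit of ratios on
    cells, hence jointly measurable.

    Last inequality: given a splitting [F + H] at [rho], write [1_A = f + h]; [Q^l h]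
    is small and [Q^l f] is controlled by its values at finitely many points [x_i],
    so [nu] can be taken as a combination of the measures [Q^l(x_i, .)]. *)

(** Two obstacles shape the argument. The spectral radius is defined through the spectrum, so the
    geometric decay of iterates must be extracted from resolvents; a compactness and squaring
    argument ([disc_decays]) does this without contour integrals. For the same reason [F] and [H]
    are the kernel and the range of a polynomial in an iterate of the operator, chosen with a
    maximal kernel, instead of coming from a Riesz projection. Next, a kernel in [Kstar] need not be
    a norm limit of finite-rank operators, because conditioning its density converges only pointwise
    in the first variable; two factors T are required, the left one turning the pointwise error into
    a single number. This is why words with one T are estimated by their norm, at the price of a
    factor n absorbed by a slightly larger rate. Strict inequalities leave the room for such losses,
    and the infima are compared up to an arbitrary e > 0. *)

Definition cmod {R : realType} (z : R[i]) : R := complex.Re `|z|.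

(** * Real-valued modulus and norm *)

Section modulus.
Context {R : realType}.
Implicit Types (z w : R[i]) (x : R).

Lemma cmodC z : (cmod z)%:C = `|z|. Proof. by rewrite /cmod Re_normcK. Qed.

Lemma cmod_ge0 z : 0 <= cmod z.
Proof. by rewrite -lecR cmodC normr_ge0. Qed.

Lemma cmodM z w : cmod (z * w) = cmod z * cmod w.
Proof. by apply: (@complexI R); rewrite rmorphM /= !cmodC normrM. Qed.

Lemma cmodD z w : cmod (z + w) <= cmod z + cmod w.
Proof. by rewrite -lecR rmorphD /= !cmodC ler_normD. Qed.

Lemma cmodN z : cmod (- z) = cmod z.
Proof. by rewrite /cmod normrN. Qed.

Lemma cmod0 : cmod (0 : R[i]) = 0.
Proof. by rewrite /cmod normr0. Qed.

Lemma cmod1 : cmod (1 : R[i]) = 1.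
Proof. by rewrite /cmod normr1. Qed.

Lemma cmodX z n : cmod (z ^+ n) = cmod z ^+ n.
Proof. by apply: (@complexI R); rewrite rmorphXn /= !cmodC normrX. Qed.

Lemma cmod_eq0 z : (cmod z == 0) = (z == 0).
Proof. by rewrite -(inj_eq (@complexI R)) /= cmodC normr_eq0. Qed.

Lemma cmod_gt0 z : (0 < cmod z) = (z != 0).
Proof. by rewrite lt_neqAle cmod_ge0 andbT eq_sym cmod_eq0. Qed.

Lemma cmodV z : cmod z^-1 = (cmod z)^-1.
Proof. by apply: (@complexI R); rewrite fmorphV /= !cmodC normfV. Qed.

Lemma cmod_real x : cmod x%:C = `|x|.
Proof. by rewrite /cmod normc_def /= expr0n /= addr0 sqrtr_sqr. Qed.

Lemma cmod_Re z : `|complex.Re z| <= cmod z.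
Proof. by rewrite -lecR cmodC normc_ge_Re. Qed.

Lemma cmod_Im z : `|complex.Im z| <= cmod z.
Proof.
rewrite /cmod normc_def /= -sqrtr_sqr ler_sqrt ?addr_ge0 ?sqr_ge0//.
by rewrite lerDr sqr_ge0.
Qed.

Lemma cmod_le_ReIm z : cmod z <= `|complex.Re z| + `|complex.Im z|.
Proof.
rewrite /cmod normc_def /= -[leRHS]ger0_norm ?addr_ge0// -sqrtr_sqr.
rewrite ler_sqrt ?sqr_ge0// sqrrD !real_normK ?num_real//.
by rewrite -addrA [X in _ <= _ + X]addrC addrA lerDl mulrn_wge0// mulr_ge0.
Qed.

Lemma real_cauchy (u : nat -> R) :
  (forall e, 0 < e -> exists N, forall m n, (N <= m)%N -> (N <= n)%N ->
     `|u m - u n| < e) ->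
  exists l, forall e, 0 < e -> exists N, forall n, (N <= n)%N -> `|u n - l| < e.
Proof.
move=> h.
have : cvgn u.
  apply/cauchy_cvgP/cauchy_ballP => e e0; have [N hN] := h e e0.
  near_simpl; exists ([set n | (N <= n)%N], [set n | (N <= n)%N]) => /=.
    by split; exists N.
  by move=> [m n] /= [Nm Nn]; exact: hN.
move=> /cvgrPdist_lt hu; exists (limn u) => e /hu [N _ hN].
by exists N => n Nn; rewrite distrC; exact: hN.
Qed.

Lemma complex_cauchy (u : nat -> R[i]) :
  (forall e, 0 < e -> exists N, forall m n, (N <= m)%N -> (N <= n)%N ->
     cmod (u m - u n) < e) ->
  exists l, forall e, 0 < e -> exists N, forall n, (N <= n)%N -> cmod (u n - l) < e.
Proof.
move=> h.
have [|a ha] := @real_cauchy (fun n => complex.Re (u n)).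
  move=> e /h [N hN]; exists N => m n Nm Nn.
  by apply: le_lt_trans (hN _ _ Nm Nn); rewrite -raddfB cmod_Re.
have [|b hb] := @real_cauchy (fun n => complex.Im (u n)).
  move=> e /h [N hN]; exists N => m n Nm Nn.
  by apply: le_lt_trans (hN _ _ Nm Nn); rewrite -raddfB cmod_Im.
exists (a +i* b) => e e0; have e2 : 0 < e / 2 by rewrite divr_gt0.
have [N1 h1] := ha _ e2; have [N2 h2] := hb _ e2.
exists (maxn N1 N2) => n; rewrite geq_max => /andP[/h1 n1 /h2 n2].
apply: le_lt_trans (cmod_le_ReIm _) _; rewrite !raddfB/=.
by rewrite (splitr e) ltrD.
Qed.

End modulus.

Section rnorm.
Context {R : realType} {V : normedModType R[i]}.
Implicit Types (u v w : V) (H F : set V) (T S : V -> V).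

Lemma rnormC v : (rnorm v)%:C = `|v|.
Proof. by rewrite /rnorm RRe_real// normr_real. Qed.

Lemma rnorm_ge0 v : 0 <= rnorm v.
Proof. by rewrite -lecR rnormC normr_ge0. Qed.

Lemma rnormD u v : rnorm (u + v) <= rnorm u + rnorm v.
Proof. by rewrite -lecR rmorphD /= !rnormC ler_normD. Qed.

Lemma rnormN v : rnorm (- v) = rnorm v.
Proof. by rewrite /rnorm normrN. Qed.

Lemma rnormB u v : rnorm (u - v) <= rnorm u + rnorm v.
Proof. by apply: le_trans (rnormD _ _) _; rewrite rnormN. Qed.

Lemma rnorm_distC u v : rnorm (u - v) = rnorm (v - u).
Proof. by rewrite -opprB rnormN. Qed.

Lemma rnormZ (a : R[i]) v : rnorm (a *: v) = cmod a * rnorm v.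
Proof. by apply: (@complexI R); rewrite rmorphM /= cmodC !rnormC normrZ. Qed.

Lemma rnorm0 : rnorm (0 : V) = 0.
Proof. by rewrite /rnorm normr0. Qed.

Lemma rnorm_eq0 v : (rnorm v == 0) = (v == 0).
Proof. by rewrite -(inj_eq (@complexI R)) /= rnormC normr_eq0. Qed.

Lemma rnorm_gt0 v : (0 < rnorm v) = (v != 0).
Proof. by rewrite lt_neqAle rnorm_ge0 andbT eq_sym rnorm_eq0. Qed.

Lemma rnorm_le_eq0 v : rnorm v <= 0 -> v = 0.
Proof.
by move=> h; apply/eqP; rewrite -rnorm_eq0 eq_le h rnorm_ge0.
Qed.

Lemma rnorm_triangle u v w : rnorm (u - w) <= rnorm (u - v) + rnorm (v - w).
Proof. by rewrite -(subrKA v) rnormD. Qed.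

Lemma rnorm_sum (I : Type) (r : seq I) (P : pred I) (f : I -> V) :
  rnorm (\sum_(i <- r | P i) f i) <= \sum_(i <- r | P i) rnorm (f i).
Proof.
elim/big_ind2 : _ => //; first by rewrite rnorm0.
by move=> x1 x2 y1 y2 h1 h2; rewrite (le_trans (rnormD _ _))// lerD.
Qed.

Lemma eq_of_small u v : (forall e : R, 0 < e -> rnorm (u - v) < e) -> u = v.
Proof.
move=> h; apply/eqP; rewrite -subr_eq0 -rnorm_eq0; apply/eqP/le_anti.
by rewrite rnorm_ge0 andbT; apply/ler_addgt0Pr => e e0; rewrite add0r ltW// h.
Qed.

Lemma closedP H : closed H <->
  forall w, (forall e : R, 0 < e -> exists2 h, H h & rnorm (w - h) < e) -> H w.
Proof.
split=> [cH w hw|h].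
  rewrite closure_id in cH; rewrite cH => B /nbhs_ballP[e /= e0 eB].
  have e0' : 0 < complex.Re e by move: e0; rewrite ltcE => /andP[].
  have [h Hh wh] := hw _ e0'; exists h; split => //; apply: eB.
  rewrite -ball_normE /ball_ /= -rnormC.
  have er : e \is Num.real by rewrite realE ltW.
  by rewrite -(RRe_real er) ltcR.
rewrite closure_id; apply/seteqP; split; first exact: subset_closure.
move=> w cw; apply: h => e e0.
have e0' : (0 : R[i]) < e%:C by rewrite ltcR.
have [h [Hh]] := cw _ (nbhsx_ballx w _ e0').
rewrite -ball_normE /ball_ /= -rnormC ltcR => wh; by exists h.
Qed.

(** [V] is an arbitrary normed module, so completeness is a separate property, phrased with [rnorm]
    because it is fed partial sums of geometric type; [bmfun_complete] supplies it for the function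
    space. *)
Definition seq_complete := forall u : nat -> V,
  (forall e : R, 0 < e -> exists N, forall m n, (N <= m)%N -> (N <= n)%N ->
     rnorm (u m - u n) < e) ->
  exists l, forall e : R, 0 < e -> exists N, forall n, (N <= n)%N ->
     rnorm (u n - l) < e.

End rnorm.
Arguments seq_complete {R} V.

Section real_aux.
Context {R : realType}.

Lemma geo_small (q c e : R) : 0 <= q < 1 -> 0 < e ->
  exists N, forall n, (N <= n)%N -> `|c * q ^+ n| < e.
Proof.
move=> /andP[q0 q1] e0.
have /cvgrPdist_lt/(_ _ e0) [N _ hN] : (fun n => c * q ^+ n) @ \oo --> (0 : R).
  rewrite -(mulr0 c); apply: cvgM; first exact: cvg_cst.
  by apply: cvg_expr; rewrite ger0_norm.
by exists N => n Nn; have := hN n Nn; rewrite /= sub0r normrN.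
Qed.

End real_aux.

(** * Subspaces, sequences and Neumann series *)

Section subspaces.
Context {R : realType} {V : normedModType R[i]}.
Implicit Types (u v w : V) (H F : set V) (T S : V -> V).

Definition ncvg (u : nat -> V) l := forall e : R, 0 < e ->
  exists N, forall n, (N <= n)%N -> rnorm (u n - l) < e.

Lemma ncvg_unique (u : nat -> V) l m : ncvg u l -> ncvg u m -> l = m.
Proof.
move=> ul um; apply: eq_of_small => e e0.
have e2 : 0 < e / 2 by rewrite divr_gt0.
have [N1 h1] := ul _ e2; have [N2 h2] := um _ e2.
have := h1 (maxn N1 N2) (leq_maxl _ _); have := h2 (maxn N1 N2) (leq_maxr _ _).
move=> x y; rewrite (splitr e).
by rewrite (le_lt_trans (rnorm_triangle _ (u (maxn N1 N2)) _))// ltrD// rnorm_distC.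
Qed.

Lemma ncvgD (u v : nat -> V) l m : ncvg u l -> ncvg v m ->
  ncvg (fun n => u n + v n) (l + m).
Proof.
move=> ul vm e e0; have e2 : 0 < e / 2 by rewrite divr_gt0.
have [N1 h1] := ul _ e2; have [N2 h2] := vm _ e2.
exists (maxn N1 N2) => n; rewrite geq_max => /andP[/h1 n1 /h2 n2].
rewrite opprD addrACA (splitr e).
by rewrite (le_lt_trans (rnormD _ _))// ltrD.
Qed.

Lemma ncvg_lip (f : V -> V) (u : nat -> V) l (M : R) :
  (forall n, rnorm (f (u n) - f l) <= M * rnorm (u n - l)) ->
  ncvg u l -> ncvg (f \o u) (f l).
Proof.
move=> h ul e e0; have M0 : 0 < `|M| + 1 by rewrite ltr_wpDl.
have [N hN] := ul _ (divr_gt0 e0 M0); exists N => n /hN.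
rewrite ltr_pdivlMr// => hn; apply: le_lt_trans (h n) _; apply: le_lt_trans hn.
rewrite mulrC ler_wpM2l ?rnorm_ge0// (le_trans (ler_norm _))// lerDl//.
Qed.

Lemma ncvgZ (u : nat -> V) (a : R[i]) l : ncvg u l -> ncvg (fun n => a *: u n) (a *: l).
Proof.
by apply: (@ncvg_lip (fun v => a *: v) _ _ (cmod a)) => n; rewrite -scalerBr rnormZ.
Qed.

Lemma ncvg_squeeze (u : nat -> V) l (q c : R) : 0 <= q < 1 ->
  (forall n, rnorm (u n - l) <= c * q ^+ n) -> ncvg u l.
Proof.
move=> q01 h e e0; have [N hN] := geo_small c q01 e0.
exists N => n /hN; apply: le_lt_trans.
by rewrite (le_trans (h n))// ler_norm.
Qed.

Lemma geo_partial (t : nat -> V) (c q : R) : 0 <= q < 1 ->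
  (forall k, rnorm (t k) <= c * q ^+ k) -> forall n d,
  rnorm (\sum_(k < n + d) t k - \sum_(k < n) t k) <= c * q ^+ n / (1 - q).
Proof.
move=> /andP[q0 q1] ht n d.
have q1' : 0 < 1 - q by rewrite subr_gt0.
have c0 : 0 <= c by have := ht 0%N; rewrite expr0 mulr1; apply: le_trans; exact: rnorm_ge0.
(* The exact geometric sum, with its factor [1 - q ^+ d], is what the induction on [d] can carry;
   the stated bound forgets that factor. *)
suff : rnorm (\sum_(k < n + d) t k - \sum_(k < n) t k) <=
    c * q ^+ n * (1 - q ^+ d) / (1 - q).
  move=> /le_trans; apply; rewrite ler_pM2r ?invr_gt0// ler_piMr//.
    by rewrite mulr_ge0// exprn_ge0.
  by rewrite lerBlDr lerDl exprn_ge0.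
elim: d => [|d ih]; first by rewrite addn0 !subrr rnorm0 mulr0 mul0r.
rewrite addnS big_ord_recr/= addrAC; apply: le_trans (rnormD _ _) _.
apply: le_trans (lerD ih (ht _)) _.
rewrite le_eqVlt; apply/orP; left; apply/eqP.
by rewrite exprD exprS; field; rewrite gt_eqF.
Qed.

Lemma geo_series (t : nat -> V) (c q : R) : seq_complete V -> 0 <= q < 1 ->
  (forall k, rnorm (t k) <= c * q ^+ k) ->
  exists l, forall n, rnorm (\sum_(k < n) t k - l) <= c / (1 - q) * q ^+ n.
Proof.
move=> cV q01 ht.
have part n m : (n <= m)%N -> rnorm (\sum_(k < m) t k - \sum_(k < n) t k) <= c / (1 - q) * q ^+ n.
  by move=> /subnKC <-; rewrite mulrAC; exact: geo_partial.
have [|l hl] := cV (fun n => \sum_(k < n) t k).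
  move=> e e0; have e2 : 0 < e / 2 by rewrite divr_gt0.
  have [N hN] := geo_small (c / (1 - q)) q01 e2; exists N => m n Nm Nn.
  rewrite (le_lt_trans (rnorm_triangle _ (\sum_(k < N) t k) _))//.
  have hh : c / (1 - q) * q ^+ N < e / 2 by apply: le_lt_trans (hN N _); rewrite ?ler_norm.
  rewrite (splitr e) ltrD//; first by rewrite (le_lt_trans (part _ _ Nm)).
  by rewrite rnorm_distC (le_lt_trans (part _ _ Nn)).
exists l => n; apply/ler_addgt0Pr => e e0; have [N hN] := hl _ e0.
rewrite (le_trans (rnorm_triangle _ (\sum_(k < maxn n N) t k) _))// lerD//.
  by rewrite rnorm_distC part// leq_maxl.
by rewrite ltW// hN// leq_maxr.
Qed.

Section lin.
Variables (H : set V) (sH : linear_subspace H).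

Lemma subsp0 : H 0. Proof. by case: sH. Qed.
Lemma subspZ (a : R[i]) v : H v -> H (a *: v).
Proof. by move=> Hv; rewrite -[_ *: _]addr0; apply: sH.2 => //; exact: subsp0. Qed.
Lemma subspD u v : H u -> H v -> H (u + v).
Proof. by move=> Hu Hv; rewrite -[u]scale1r; exact: sH.2. Qed.
Lemma subspN v : H v -> H (- v).
Proof. by move=> Hv; rewrite -scaleN1r; exact: subspZ. Qed.
Lemma subspB u v : H u -> H v -> H (u - v).
Proof. by move=> Hu Hv; apply: subspD => //; exact: subspN. Qed.
Lemma subsp_sum (I : Type) (r : seq I) (P : pred I) (f : I -> V) :
  (forall i, P i -> H (f i)) -> H (\sum_(i <- r | P i) f i).
Proof.
by move=> h; elim/big_ind : _ => //; [exact: subsp0|exact: subspD].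
Qed.

Variables (T : V -> V) (lT : linear_on H T).

Lemma lin0 : T 0 = 0.
Proof.
have := lT (- 1) subsp0 subsp0.
by rewrite scaler0 addr0 scaleN1r addNr.
Qed.
Lemma linZ (a : R[i]) v : H v -> T (a *: v) = a *: T v.
Proof.
move=> Hv; have := lT a Hv subsp0.
by rewrite addr0 lin0 addr0.
Qed.
Lemma linD u v : H u -> H v -> T (u + v) = T u + T v.
Proof. by move=> Hu Hv; rewrite -[u in LHS]scale1r lT// scale1r. Qed.
Lemma linN v : H v -> T (- v) = - T v.
Proof. by move=> Hv; rewrite -scaleN1r linZ// scaleN1r. Qed.
Lemma linB u v : H u -> H v -> T (u - v) = T u - T v.
Proof. by move=> Hu Hv; rewrite linD ?linN//; exact: subspN. Qed.
Lemma lin_sum (I : Type) (r : seq I) (P : pred I) (f : I -> V) :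
  (forall i, P i -> H (f i)) ->
  T (\sum_(i <- r | P i) f i) = \sum_(i <- r | P i) T (f i).
Proof.
move=> h; elim: r => [|i r ih]; first by rewrite !big_nil lin0.
rewrite !big_cons; case: ifPn => // Pi; rewrite linD ?ih//; first exact: h.
exact: subsp_sum.
Qed.

Hypothesis stT : stable_under T H.

Lemma iter_stable n : stable_under (iter n T) H.
Proof. by move=> v Hv; elim: n => //= n; exact: stT. Qed.

Lemma iter_linear n : linear_on H (iter n T).
Proof.
elim: n => [//|n ih] a u v Hu Hv; rewrite !iterS ih// lT//; exact: iter_stable.
Qed.

Lemma iter_bound (M : R) n : 0 <= M ->
  (forall v, H v -> rnorm (T v) <= M * rnorm v) ->
  forall v, H v -> rnorm (iter n T v) <= M ^+ n * rnorm v.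
Proof.
move=> M0 hT v Hv; elim: n => [|n ih]; first by rewrite expr0 mul1r.
rewrite iterS exprS -mulrA (le_trans (hT _ _))//; first exact: iter_stable.
by rewrite ler_wpM2l.
Qed.

End lin.

Lemma bounded_onP H T : bounded_on H T ->
  exists2 M : R, 0 < M & forall v, H v -> rnorm (T v) <= M * rnorm v.
Proof.
move=> [M hM]; exists (`|M| + 1); first by rewrite ltr_wpDl.
move=> v Hv; rewrite (le_trans (hM _ Hv))// ler_wpM2r ?rnorm_ge0//.
by rewrite (le_trans (ler_norm _))// lerDl.
Qed.

Lemma linear_subspaceT : linear_subspace [set: V].
Proof. by []. Qed.

Section neumann.
Variables (H : set V) (sH : linear_subspace H) (cH : closed H)
  (T : V -> V) (lT : linear_on H T) (stT : stable_under T H)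
  (C tau : R) (tau0 : 0 <= tau).
Hypothesis cV : seq_complete V.
Hypothesis hT : forall n v, H v -> rnorm (iter n T v) <= C * tau ^+ n * rnorm v.
Variable (z : R[i]).
Hypothesis zt : tau < cmod z.

Let z0 : 0 < cmod z. Proof. exact: le_lt_trans zt. Qed.
Let zn0 : z != 0. Proof. by rewrite -cmod_gt0. Qed.
Let q := tau / cmod z.
Let q01 : 0 <= q < 1.
Proof. by rewrite /q divr_ge0 ?cmod_ge0//= ltr_pdivrMr// mul1r. Qed.

Let t v k := z ^- k.+1 *: iter k T v.
Let s v n := \sum_(k < n) t v k.

Let t_bound v k : H v -> rnorm (t v k) <= C / cmod z * rnorm v * q ^+ k.
Proof.
move=> Hv; rewrite rnormZ cmodV cmodX.
rewrite (le_trans (ler_wpM2l _ (hT k Hv)))//; first by rewrite invr_ge0 exprn_ge0// ltW.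
rewrite le_eqVlt; apply/orP; left; apply/eqP; rewrite /q exprMn exprVn exprS.
by field; rewrite expf_neq0 ?gt_eqF.
Qed.

Let Ht v k : H v -> H (t v k).
Proof. by move=> Hv; apply: subspZ => //; exact: iter_stable. Qed.

Let Hs v n : H v -> H (s v n).
Proof. by move=> Hv; apply: subsp_sum => // i _; exact: Ht. Qed.

Let s_lin a u v n : H u -> H v -> s (a *: u + v) n = a *: s u n + s v n.
Proof.
move=> Hu Hv; rewrite /s scaler_sumr -big_split/=; apply: eq_bigr => k _.
by rewrite /t (@iter_linear H)// scalerDr !scalerA mulrC.
Qed.

Let tele v n : H v -> z *: s v n - T (s v n) = v - z ^- n *: iter n T v.
Proof.
move=> Hv; elim: n => [|n ih].
  by rewrite /s big_ord0 (lin0 sH lT) scaler0 expr0 invr1 scale1r !subrr.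
rewrite /s big_ord_recr/= -/(s v n) (linD lT) ?scalerDr; [|exact: Hs|exact: Ht].
rewrite opprD addrACA ih /t (linZ sH lT); last exact: iter_stable.
by rewrite scalerA exprS invfM mulrA divff// mul1r -iterS subrKA.
Qed.

Let s_comm v n : H v -> s (T v) n = T (s v n).
Proof.
move=> Hv; rewrite /s (lin_sum sH lT); last by move=> *; exact: Ht.
apply: eq_bigr => k _; rewrite /t (linZ sH lT); last exact: iter_stable.
by rewrite -iterSr.
Qed.

Let tele_cvg v : H v -> ncvg (fun n => v - z ^- n *: iter n T v) v.
Proof.
move=> Hv; apply: (@ncvg_squeeze _ _ q (C * rnorm v)) => // n.
rewrite addrAC subrr add0r rnormN rnormZ cmodV cmodX.
rewrite (le_trans (ler_wpM2l _ (hT n Hv)))//; first by rewrite invr_ge0 exprn_ge0// ltW.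
by rewrite /q exprMn exprVn le_eqVlt; apply/orP; left; apply/eqP; ring.
Qed.

(** The series of [z ^- k.+1 *: iter k T v] converges because the growth of the iterates is
    controlled, not merely the norm of [T]; so the result reaches every modulus above the rate
    [tau]. Closedness of [H] keeps the sum in [H]. *)
Lemma neumann : resolvent_set_on H T z.
Proof.
pose D := C / cmod z / (1 - q).
(* The implication under the existential lets [choice] return a total function, with default value 0
   off [H]. *)
have ex v : exists l, H v -> forall n, rnorm (s v n - l) <= D * rnorm v * q ^+ n.
  have [Hv|nHv] := pselect (H v); last by exists 0.
  have [l hl] := geo_series cV q01 (fun k => t_bound k Hv).
  by exists l => _ n; rewrite (le_trans (hl n))// /D -!mulrA [rnorm v * _]mulrC !mulrA mulrAC.
have [S hS] := choice ex.
have Sc v : H v -> ncvg (s v) (S v).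
  by move=> Hv; apply: (ncvg_squeeze q01); exact: hS.
have [M M0 hM] : exists2 M : R, 0 < M & forall v, H v -> rnorm (T v) <= M * rnorm v.
  apply: bounded_onP; exists (C * tau) => v Hv.
  by have := hT 1%N Hv; rewrite expr1.
have HS : stable_under S H.
  move=> v Hv; apply: (closedP H).1 => // e /(Sc v Hv)[N hN].
  by exists (s v N); [exact: Hs|rewrite rnorm_distC hN].
exists S; split => //.
- move=> a u v Hu Hv; apply: (@ncvg_unique (s (a *: u + v))).
    by apply: Sc; exact: sH.2.
  have -> : s (a *: u + v) = (fun n => a *: s u n + s v n).
    by apply/funext => n; exact: s_lin.
  by apply: ncvgD; [apply: ncvgZ|]; exact: Sc.
- exists D => v Hv; have := hS v Hv 0%N.
  by rewrite expr0 mulr1 /s big_ord0 sub0r rnormN.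
(* The partial sums are linear and commute with [T], so the left inverse identity reduces to the
   same telescoping sum as the right one. *)
- move=> v Hv; have Tv : H (T v) by exact: stT.
  apply: (@ncvg_unique (s (z *: v - T v))).
    by apply: Sc; apply: (subspB sH) => //; exact: (subspZ sH).
  have -> : s (z *: v - T v) = (fun n => v - z ^- n *: iter n T v).
    apply/funext => n; rewrite -scaleN1r addrC s_lin//; last exact: (subspZ sH).
    rewrite s_comm// -[z *: v]addr0 s_lin//; last exact: (subsp0 sH).
    rewrite [s 0 n]big1 ?addr0; last first.
      by move=> i _; rewrite /t (lin0 sH (iter_linear lT stT _)) scaler0.
    by rewrite scaleN1r addrC tele.
  exact: tele_cvg.
- move=> v Hv; apply: (@ncvg_unique (fun n => z *: s v n - T (s v n))); last first.
    have -> : (fun n => z *: s v n - T (s v n)) = (fun n => v - z ^- n *: iter n T v).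
      by apply/funext => n; exact: tele.
    exact: tele_cvg.
  apply: ncvgD; first by apply: ncvgZ; exact: Sc.
  have -> : (fun n => - T (s v n)) = (fun n => (-1) *: T (s v n)).
    by apply/funext => n; rewrite scaleN1r.
  rewrite -[- T (S v)]scaleN1r; apply: ncvgZ.
  apply: (@ncvg_lip T _ _ M); last exact: Sc.
  move=> n; rewrite -(linB sH lT); [|exact: Hs|exact: HS].
  by apply: hM; apply: subspB; [|exact: Hs|exact: HS].
Qed.

End neumann.
End subspaces.

(** * Gelfand's formula *)

Section disc.
Context {R : realType}.

Definition cdisc : set (R * R) := [set p | p.1 ^+ 2 + p.2 ^+ 2 <= 1].

Lemma compact_cdisc : compact cdisc.
Proof.
have cB : compact (`[(-1 : R), 1]%classic `*` `[(-1 : R), 1]%classic).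
  by apply: compact_setX; exact: segment_compact.
apply: subclosed_compact cB _.
- have -> : cdisc = (fun p : R * R => p.1 ^+ 2 + p.2 ^+ 2) @^-1` [set x | x <= 1] by [].
  apply: preimage_closed; last exact: closed_le.
  move=> p _; apply: (@cvgD _ R^o).
    by apply: (@cvg_comp _ _ _ (@fst R R) (fun x => x ^+ 2)); [exact: cvg_fst|exact: exprn_continuous].
  by apply: (@cvg_comp _ _ _ (@snd R R) (fun x => x ^+ 2)); [exact: cvg_snd|exact: exprn_continuous].
- have sq (x y : R) : x ^+ 2 + y ^+ 2 <= 1 -> -1 <= x <= 1.
    move=> h; rewrite -ler_norml -sqrtr_sqr -sqrtr1 ler_sqrt//.
    by rewrite (le_trans _ h)// lerDl sqr_ge0.
  move=> [x y] /= h; split; rewrite /= in_itv/=; first exact: sq h.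
  by apply: (sq y x); rewrite addrC.
Qed.

Lemma cdiscP (z : R[i]) : cmod z <= 1 -> cdisc (complex.Re z, complex.Im z).
Proof.
move=> h; rewrite /cdisc /= -lecR add_Re2_Im2 -cmodC -rmorphXn lecR.
by rewrite exprn_ile1// cmod_ge0.
Qed.

Lemma cdisc_cmod (p : R * R) : cdisc p -> cmod (p.1 +i* p.2) <= 1.
Proof.
rewrite /cdisc /= => h; rewrite -(@expr_le1 _ 2)// ?cmod_ge0//.
by rewrite -lecR rmorphXn /= cmodC -add_Re2_Im2 lecR.
Qed.

End disc.

Section gelfand.
Context {R : realType} {V : normedModType R[i]}.
Implicit Types (u v : V) (A T X : V -> V).
Variables (H : set V) (sH : linear_subspace H).

(** At a fixed [w] the lower bound on 1 - w A survives, with twice the constant, on a small ball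
    around [w]; compactness of the disc makes the constant uniform. *)
Lemma resolvent_uniform_bound A : bounded_on H A ->
  (forall w : R[i], cmod w <= 1 -> exists M : R,
     forall v, H v -> rnorm v <= M * rnorm (v - w *: A v)) ->
  exists2 M : R, 0 < M & forall w : R[i], cmod w <= 1 ->
     forall v, H v -> rnorm v <= M * rnorm (v - w *: A v).
Proof.
move=> /bounded_onP[a a0 ha] hw.
pose P (M : R) (p : R * R) := forall v, H v ->
  rnorm v <= M * rnorm (v - (p.1 +i* p.2) *: A v).
have /compact_near_coveringP := @compact_cdisc R.
(* Covering compactness is applied with the filter of large [M]: valid for large [M] near each
   point, the estimate is valid for all large [M] on the whole disc. *)
move=> /(_ R +oo P _) [|M [_ hM]]; last first.
  have M1 : M < `|M| + 1 by rewrite ltr_pwDr// ler_norm.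
  exists (`|M| + 1); first by rewrite ltr_wpDl.
  move=> w w1 v Hv; have := hM _ M1 _ (cdiscP w1) v Hv.
  by case: w {w1}.
move=> p /cdisc_cmod /hw [M0 hM0].
pose M1 := `|M0| + 1.
have M1_0 : 0 < M1 by rewrite ltr_wpDl.
have {}hM0 v : H v -> rnorm v <= M1 * rnorm (v - (p.1 +i* p.2) *: A v).
  move=> Hv; rewrite (le_trans (hM0 _ Hv))// ler_wpM2r ?rnorm_ge0//.
  by rewrite (le_trans (ler_norm _))// lerDl.
(* Moving [w] by at most [2 * e] then costs exactly half of [rnorm v], which is absorbed in the
   left-hand side. *)
pose e := (4 * a * M1)^-1.
have e0 : 0 < e by rewrite invr_gt0 !mulr_gt0.
exists (ball p e, [set M | 2 * M1 < M]).
  split => /=; first exact: nbhsx_ballx.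
  by exists (2 * M1); split; [exact: num_real|].
move=> [q M] /= [[b1 b2] M1M] v Hv.
set w := p.1 +i* p.2 in hM0; set w' := _ +i* _.
have ww : cmod (w' - w) <= 2 * e.
  apply: le_trans (cmod_le_ReIm _) _; rewrite !raddfB/= mulr2n mulrDl mul1r.
  by rewrite lerD// distrC ltW.
have h1 : rnorm (v - w *: A v) <= rnorm (v - w' *: A v) + 2 * e * (a * rnorm v).
  have -> : v - w *: A v = (v - w' *: A v) + (w' - w) *: A v.
    by rewrite scalerBl addrA subrK.
  rewrite (le_trans (rnormD _ _))// lerD2l// rnormZ ler_pM ?cmod_ge0 ?rnorm_ge0//.
  exact: ha.
have h2 := hM0 _ Hv.
have h3 : M1 * (2 * e * (a * rnorm v)) = rnorm v / 2.
  by rewrite /e; field; rewrite !gt_eqF.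
have h4 : rnorm v <= M1 * rnorm (v - w' *: A v) + rnorm v / 2.
  rewrite -h3 -mulrDr (le_trans h2)// ler_wpM2l// ltW//.
have h5 : rnorm v <= 2 * M1 * rnorm (v - w' *: A v) by lra.
by rewrite (le_trans h5)// ler_wpM2r ?rnorm_ge0// ltW.
Qed.

(** A two-sided inverse of 1 - A on [H], without a bound: the quantitative estimates come from the
    uniform lower bound on 1 - w A. *)
Definition inv1 A X := [/\ stable_under X H, linear_on H X,
  forall v, H v -> X (v - A v) = v & forall v, H v -> X v - A (X v) = v].

(** The whole circle is quantified over so that the relation passes to squares: the inverse for A^2
    at [w] involves both square roots of [w]. *)
Definition rot_close A1 A2 (e : R) := forall w : R[i], cmod w = 1 ->
  exists X Y, [/\ inv1 (fun v => w *: A1 v) X, inv1 (fun v => w *: A2 v) Y &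
    forall v, H v -> rnorm (X v - Y v) <= e * rnorm v].

Lemma inv1_sq A (w : R[i]) X Y : linear_on H A -> stable_under A H ->
  inv1 (fun v => w *: A v) X -> inv1 (fun v => (- w) *: A v) Y ->
  inv1 (fun v => w ^+ 2 *: (A \o A) v) (fun v => 2^-1 *: (X v + Y v)).
Proof.
move=> lA sA [sX lX XA AX] [sY lY YA AY].
have n2 : (2 : R[i]) != 0 by rewrite pnatr_eq0.
split.
- by move=> v Hv; apply: (subspZ sH); apply: (subspD sH); [exact: sX|exact: sY].
- move=> a u v Hu Hv; rewrite lX// lY//.
  by rewrite [in RHS]scalerA [a * _]mulrC -scalerA -scalerDr; congr (_ *: _); rewrite scalerDr addrACA.
- move=> v Hv /=.
  have HA : H (A v) by exact: sA.
  (* 1 - w^2 A^2 is factored once in each order, so that [X] and [Y] each cancel their own factor;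
     the leftovers v + w A v and v - w A v add up to 2 v. *)
  have e1 : v - w ^+ 2 *: A (A v) = (v + w *: A v) - w *: A (v + w *: A v).
    rewrite (linD lA) ?(linZ sH lA)//; last exact: (subspZ sH).
    by rewrite scalerDr scalerA opprD addrA addrK expr2.
  have e2 : v - w ^+ 2 *: A (A v) = (v - w *: A v) - (- w) *: A (v - w *: A v).
    rewrite (linB sH lA) ?(linZ sH lA)//; last exact: (subspZ sH).
    by rewrite scaleNr opprK scalerBr scalerA addrA subrK expr2.
  rewrite {1}e1 XA; last by apply: (subspD sH) => //; exact: (subspZ sH).
  rewrite e2 YA; last by apply: (subspB sH) => //; exact: (subspZ sH).
  by rewrite addrACA subrr addr0 -mulr2n -[v *+ 2]scaler_nat scalerA mulVf// scale1r.
- move=> v Hv /=.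
  have HX := sX _ Hv; have HY := sY _ Hv.
  have HAX := sA _ HX; have HAY := sA _ HY; have HA := sA _ Hv.
  rewrite (linZ sH lA); last by exact: (subspD sH).
  rewrite (linD lA)// (linZ sH lA); last by apply: (subspD sH).
  rewrite (linD lA)// scalerA [_ * 2^-1]mulrC -scalerA -scalerBr [w ^+ 2 *: (_ + _)]scalerDr.
  rewrite opprD addrACA.
  have e1 : X v - w ^+ 2 *: A (A (X v)) = v + w *: A v.
    rewrite -[v in RHS]AX// (linB sH lA)//; last exact: (subspZ sH).
    by rewrite (linZ sH lA)// scalerBr scalerA addrA subrK expr2.
  have e2 : Y v - w ^+ 2 *: A (A (Y v)) = v - w *: A v.
    rewrite -[v in RHS]AY// (linB sH lA)//; last exact: (subspZ sH).
    by rewrite (linZ sH lA)// !scaleNr !opprK scalerDr scalerA opprD addrA addrK expr2.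
  by rewrite e1 e2 addrACA subrr addr0 -mulr2n -[v *+ 2]scaler_nat scalerA mulVf// scale1r.
Qed.

(** The inverses for the squares are averages of inverses for [A1] and [A2], so the constant [e]
    does not deteriorate; this permits arbitrarily many squarings. *)
Lemma rot_close_sq A1 A2 (e : R) :
  linear_on H A1 -> stable_under A1 H -> linear_on H A2 -> stable_under A2 H ->
  rot_close A1 A2 e -> rot_close (A1 \o A1) (A2 \o A2) e.
Proof.
move=> l1 s1 l2 s2 h w w1.
have sw : cmod (sqrtc w) = 1.
  have : cmod (sqrtc w) ^+ 2 = 1 by rewrite -cmodX sqr_sqrtc.
  by move=> /eqP; rewrite sqrp_eq1 ?cmod_ge0// => /eqP.
have [X [Y [iX iY hXY]]] := h _ sw.
have [|X' [Y' [iX' iY' hXY']]] := h (- sqrtc w); first by rewrite cmodN.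
exists (fun v => 2^-1 *: (X v + X' v)), (fun v => 2^-1 *: (Y v + Y' v)); split.
- by rewrite -[w]sqr_sqrtc; exact: inv1_sq.
- by rewrite -[w]sqr_sqrtc; exact: inv1_sq.
- move=> v Hv; rewrite -scalerBr opprD addrACA rnormZ cmodV.
  have -> : cmod (2 : R[i]) = 2.
    by rewrite -[2 in LHS](rmorph_nat (real_complex R) 2) cmod_real normr_nat.
  rewrite mulrC ler_pdivrMr// (le_trans (rnormD _ _))//.
  by rewrite mulr_natr mulr2n lerD// ?hXY ?hXY'.
Qed.

Lemma rot_close_iter A1 A2 (e : R) n :
  linear_on H A1 -> stable_under A1 H -> linear_on H A2 -> stable_under A2 H ->
  rot_close A1 A2 e -> rot_close (iter (2 ^ n) A1) (iter (2 ^ n) A2) e.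
Proof.
move=> l1 s1 l2 s2 h; elim: n => [//|n ih].
have E B : iter (2 ^ n.+1) B = iter (2 ^ n) B \o iter (2 ^ n) B :> (V -> V).
  by apply/funext => v /=; rewrite -iterD addnn -mul2n expnS.
rewrite !E; apply: rot_close_sq => //;
  try exact: iter_linear; exact: iter_stable.
Qed.

(** Only the rotation 1 is used. With [A2] of norm at most 1/8, [Y] is within 1/7 of the identity,
    so [X] is within 15/56 of it; for w = v - A1 v this reads |A1 v| <= (15/56) |w|, hence |A1 v| <=
    (15/41) |v|. *)
Lemma rot_close_half A1 A2 : stable_under A1 H -> stable_under A2 H ->
  rot_close A1 A2 8^-1 ->
  (forall v, H v -> rnorm (A2 v) <= 8^-1 * rnorm v) ->
  forall v, H v -> rnorm (A1 v) <= 2^-1 * rnorm v.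
Proof.
move=> s1 s2 h h2 v Hv.
have [X [Y [[sX _ XA _] [sY _ _ AY] XY]]] := h 1 cmod1.
pose w := v - A1 v; have Hw : H w by apply: (subspB sH) => //; exact: s1.
have Xw : X w = v by have := XA _ Hv; rewrite scale1r.
have Yw : Y w - A2 (Y w) = w by have := AY _ Hw; rewrite scale1r.
have e1 : rnorm (Y w) <= rnorm w + 8^-1 * rnorm (Y w).
  rewrite -[X in rnorm X <= _](subrK (A2 (Y w))) (le_trans (rnormD _ _))//.
  by rewrite Yw lerD2l h2//; exact: sY.
have e2 : rnorm (Y w - w) <= 8^-1 * rnorm (Y w).
  by rewrite -[X in _ - X]Yw opprB addrCA subrr addr0 h2//; exact: sY.
have e3 : rnorm (v - w) <= rnorm (v - Y w) + rnorm (Y w - w).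
  exact: rnorm_triangle.
have e4 : rnorm (v - Y w) <= 8^-1 * rnorm w by rewrite -{1}Xw XY.
have e5 : v - w = A1 v by rewrite /w opprB addrCA subrr addr0.
have e6 : rnorm w <= rnorm v + rnorm (A1 v) by rewrite /w rnormB.
rewrite e5 in e3.
have := rnorm_ge0 v; lra.
Qed.

Definition decays A := exists C (theta : R), 0 <= theta < 1 /\
  forall n v, H v -> rnorm (iter n A v) <= C * theta ^+ n * rnorm v.

Lemma half_decays A N : linear_on H A -> stable_under A H -> bounded_on H A ->
  (0 < N)%N -> (forall v, H v -> rnorm (iter N A v) <= 2^-1 * rnorm v) ->
  decays A.
Proof.
move=> lA sA /bounded_onP[M0 M0_0 hM0] N0 hN.
pose M := M0 + 1.
have M1 : 1 <= M by rewrite lerDr ltW.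
have hM v : H v -> rnorm (A v) <= M * rnorm v.
  by move=> Hv; rewrite (le_trans (hM0 _ Hv))// ler_wpM2r ?rnorm_ge0// lerDl.
have NR : 1 <= N%:R :> R by rewrite ler1n.
have iN0 : 0 < N%:R^-1 :> R by rewrite invr_gt0 ltr0n.
have iN1 : N%:R^-1 <= 1 :> R by rewrite invf_le1// ltr0n.
(* An explicit substitute for the N-th root of 1/2: Bernoulli's inequality gives
   [2^-1 <= th ^+ N]. *)
pose th : R := 1 - (2 * N%:R)^-1.
have eth : th = 1 - N%:R^-1 / 2 by rewrite /th invfM mulrC.
have th0 : 0 < th by rewrite eth; lra.
have th1 : th < 1 by rewrite eth; lra.
have bern n : 1 - n%:R * (N%:R^-1 / 2) <= th ^+ n.
  elim: n => [|n ih]; first by rewrite mul0r subr0 expr0.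
  have := ler_wpM2l (ltW th0) ih; rewrite -exprS; apply: le_trans.
  rewrite eth -addn1 natrD.
  have : 0 <= n%:R :> R by [].
  by set x := n%:R; nra.
have thN : 2^-1 <= th ^+ N.
  apply: le_trans (bern N); rewrite mulrA divff ?gt_eqF ?ltr0n//.
  lra.
exists (2 * M ^+ N), th; split; first by rewrite ltW.
move=> n v Hv.
have iterM q : rnorm (iter (q * N) A v) <= 2^-1 ^+ q * rnorm v.
  elim: q => [|q ih]; first by rewrite mul0n expr0 mul1r.
  rewrite mulSn iterD exprS -mulrA (le_trans (hN _ _))//; first exact: iter_stable.
  by rewrite ler_wpM2l.
rewrite {1}(divn_eq n N) addnC iterD.
have rN : (n %% N < N)%N by rewrite ltn_mod.
apply: le_trans (iter_bound sA (n %% N) (le_trans ler01 M1) hM _) _; first exact: iter_stable.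
have h1 : M ^+ (n %% N) <= M ^+ N by rewrite ler_weXn2l// ltnW.
have h2 : rnorm (iter (n %/ N * N) A v) <= 2 * th ^+ n * rnorm v.
  rewrite (le_trans (iterM _))// ler_wpM2r ?rnorm_ge0//.
  have -> : th ^+ n = (th ^+ N) ^+ (n %/ N) * th ^+ (n %% N).
    by rewrite -exprM -exprD mulnC -divn_eq.
  have h3 : 2^-1 ^+ (n %/ N) <= (th ^+ N) ^+ (n %/ N).
    by rewrite lerXn2r// nnegrE// exprn_ge0// ltW.
  have h4 : 2^-1 <= th ^+ (n %% N).
    exact: (le_trans thN (ler_wiXn2l (ltW th0) (ltW th1) (ltnW rN))).
  have h5 : 0 <= (th ^+ N) ^+ (n %/ N) by rewrite !exprn_ge0// ltW.
  rewrite (le_trans h3)// mulrCA ler_peMr// -ler_pdivrMl// mulr1//.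
rewrite (le_trans (ler_pM _ _ h1 h2))// ?rnorm_ge0// ?exprn_ge0//.
  exact: le_trans M1.
by rewrite le_eqVlt; apply/orP; left; apply/eqP; ring.
Qed.

Lemma iter_scale A (c : R[i]) n v : linear_on H A -> stable_under A H -> H v ->
  iter n (fun v => c *: A v) v = c ^+ n *: iter n A v.
Proof.
move=> lA sA Hv; elim: n => [|n ih]; first by rewrite expr0 scale1r.
rewrite !iterS ih (linZ sH lA)//; last exact: iter_stable.
by rewrite scalerA -exprS.
Qed.

Lemma linear_on_scale A (c : R[i]) : linear_on H A -> linear_on H (fun v => c *: A v).
Proof.
by move=> lA a u v Hu Hv; rewrite lA// scalerDr !scalerA mulrC.
Qed.

Lemma stable_scale A (c : R[i]) : stable_under A H -> stable_under (fun v => c *: A v) H.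
Proof. by move=> sA v Hv; apply: (subspZ sH); exact: sA. Qed.

Lemma bounded_on_scale A (c : R[i]) : bounded_on H A -> bounded_on H (fun v => c *: A v).
Proof.
move=> [M hM]; exists (cmod c * M) => v Hv.
by rewrite rnormZ -mulrA ler_wpM2l ?cmod_ge0// hM.
Qed.

(* Continuity method along t A, t from 0 to 1.  By compactness of the disc the
   inverses of 1 - w t A and 1 - w t' A, |w| = 1, are 1/8-close when t' - t <= dl.
   This passes to the squares of t A and t' A, because
   (1 - w^2 A^2)^-1 = ((1 - w A)^-1 + (1 + w A)^-1) / 2,
   hence to the powers 2^n.  If t A decays, (t A)^(2^n) is eventually tiny, and
   then (t' A)^(2^n) has norm at most 1/2. *)
Lemma disc_decays A : linear_on H A -> stable_under A H -> bounded_on H A ->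
  (forall w : R[i], cmod w <= 1 -> exists X,
     inv1 (fun v => w *: A v) X /\ bounded_on H X) -> decays A.
Proof.
move=> lA sA bA hA; have [a a0 ha] := bounded_onP bA.
have [M M0 hM] : exists2 M : R, 0 < M & forall w : R[i], cmod w <= 1 ->
     forall v, H v -> rnorm v <= M * rnorm (v - w *: A v).
  apply: resolvent_uniform_bound => // w /hA [X [[sX _ XA _] [M hM]]].
  exists M => v Hv; rewrite -{1}(XA v Hv) hM//.
  by apply: (subspB sH) => //; apply: (subspZ sH); exact: sA.
pose At (t : R) := fun v => t%:C *: A v.
(* The resolvent identity bounds the distance of the inverses for t and t' by (t' - t) M (a M),
   which this step length makes at most 1/8. *)
pose dl : R := (8 * M ^+ 2 * a)^-1.
have dl0 : 0 < dl by rewrite invr_gt0 !mulr_gt0// exprn_gt0.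
have step t t' : 0 <= t -> t <= t' -> t' <= 1 -> t' - t <= dl ->
    decays (At t) -> decays (At t').
  move=> t0 tt' t1 ttd [C [th [th01 hC]]].
  have t'0 : 0 <= t' by apply: le_trans tt'.
  have lt x : linear_on H (At x) by exact: linear_on_scale.
  have st x : stable_under (At x) H by exact: stable_scale.
  have close : rot_close (At t') (At t) 8^-1.
    move=> w w1.
    have m x : 0 <= x -> x <= 1 -> cmod (w * x%:C) <= 1.
      by move=> x0 x1; rewrite cmodM w1 mul1r cmod_real ger0_norm.
    have scE x : (fun v => (w * x%:C) *: A v) = (fun v => w *: At x v).
      by apply/funext => v; rewrite /At scalerA.
    have [X []] := hA _ (m _ t'0 t1); rewrite scE => iX _.
    have [Y []] := hA _ (m _ t0 (le_trans tt' t1)); rewrite scE => iY _.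
    exists X, Y; split => // v Hv.
    case: iX iY => [sX _ _ AX] [sY _ _ AY].
    have HX := sX _ Hv; have HY := sY _ Hv; have HXY := subspB sH HX HY.
    have hXY := hM _ (m _ t'0 t1) _ HXY.
    have hY := hM _ (m _ t0 (le_trans tt' t1)) _ HY.
    have eY : Y v - (w * t%:C) *: A (Y v) = v by rewrite -[RHS](AY v Hv) /At scalerA.
    have eX : X v - (w * t'%:C) *: A (X v) = v by rewrite -[RHS](AX v Hv) /At scalerA.
    (* Resolvent identity: applying 1 - w t' A to the difference of the inverses leaves w (t' - t) A
       Y v. *)
    have e : X v - Y v - (w * t'%:C) *: A (X v - Y v) = (w * (t' - t)%:C) *: A (Y v).
      rewrite (linB sH lA)// scalerBr opprD addrACA eX opprK -[X in X + _]eY.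
      by rewrite addrACA subrr add0r addrC rmorphB mulrBr scalerBl.
    rewrite eY in hY.
    rewrite (le_trans hXY)// e rnormZ cmodM w1 mul1r cmod_real ger0_norm ?subr_ge0//.
    have h1 : rnorm (A (Y v)) <= a * (M * rnorm v).
      by rewrite (le_trans (ha _ HY))// ler_wpM2l// ltW.
    have h2 : (t' - t) * rnorm (A (Y v)) <= dl * (a * (M * rnorm v)).
      by rewrite ler_pM ?rnorm_ge0// subr_ge0.
    rewrite (le_trans (ler_wpM2l (ltW M0) h2))// le_eqVlt; apply/orP; left; apply/eqP.
    by rewrite /dl; field; rewrite !gt_eqF.
  have [|n hn] := @geo_small R th C 8^-1 th01; first by rewrite invr_gt0.
  apply: (@half_decays (At t') (2 ^ n)) => //.
  - exact: bounded_on_scale.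
  - by rewrite expn_gt0.
  - apply: (@rot_close_half _ (iter (2 ^ n) (At t))).
    + exact: iter_stable.
    + exact: iter_stable.
    + exact: rot_close_iter.
    + move=> v Hv; rewrite (le_trans (hC _ _ Hv))// ler_wpM2r ?rnorm_ge0//.
      rewrite (le_trans (ler_norm _))// ltW// hn//.
      by rewrite ltnW// ltn_expl.
(* The march starts at the zero operator, which decays trivially, and the minimum with 1 makes the
   last step land exactly at t = 1. *)
have all k : decays (At (Num.min (k%:R * dl) 1)).
  elim: k => [|k ih].
    exists 1, 0; split; first by rewrite lexx ltr01.
    move=> n v Hv; rewrite iter_scale// mul0r min_l ?ler01//.
    case: n => [|n]; first by rewrite !expr0 scale1r !mul1r.
    by rewrite expr0n /= expr0n/= scale0r mulr0 mul0r rnorm0.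
  apply: step ih.
  - by rewrite le_min ler01 mulr_ge0// ltW.
  - by rewrite le_min !ge_min lexx orbT andbT ler_pM2r// ler_nat leqnSn.
  - by rewrite ge_min lexx orbT.
  - have e : k.+1%:R * dl = k%:R * dl + dl by rewrite -addn1 natrD mulrDl mul1r.
    rewrite e; set x := k%:R * dl.
    by case: (leP x 1) => h; case: (leP (x + dl) 1) => h'; lra.
have [k hk] : exists k : nat, 1 <= k%:R * dl.
  exists (Num.truncn (dl^-1)).+1.
  by rewrite -ler_pdivrMr// mul1r ltW// truncnS_gt.
have := all k; rewrite min_r// => -[C [th [th01 hC]]].
exists C, th; split => // n v Hv; have := hC n v Hv.
by rewrite iter_scale// expr1n scale1r.
Qed.

(** Rescaling: with A = T / rho and w = rho / z, the exterior of the disc of radius [rho] becomes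
    the punctured unit disc, and w = 0 is filled in by the identity. *)
Lemma decays_resolvent_set T (rho : R) : 0 < rho -> linear_on H T ->
  stable_under T H -> bounded_on H T ->
  (forall z : R[i], rho <= cmod z -> resolvent_set_on H T z) ->
  exists C th, [/\ 0 <= th, th < rho &
    forall n v, H v -> rnorm (iter n T v) <= C * th ^+ n * rnorm v].
Proof.
move=> r0 lT sT bT hz.
have rC0 : (rho%:C : R[i]) != 0 by rewrite -cmod_gt0 cmod_real normr_gt0 gt_eqF.
have [] := @disc_decays (fun v => rho%:C^-1 *: T v).
- exact: linear_on_scale.
- exact: stable_scale.
- exact: bounded_on_scale.
- move=> w w1; have [->|w0] := eqVneq w 0.
    exists id; split; last by exists 1 => v _; rewrite mul1r.
    by split => // v Hv /=; rewrite scale0r subr0.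
  have z1 : rho <= cmod (rho%:C / w).
    rewrite cmodM cmodV cmod_real (ger0_norm (ltW r0)) ler_pdivlMr ?cmod_gt0//.
    by rewrite ler_piMr// ltW.
  have [S [sS lS bS ST TS]] := hz _ z1.
  have zn0 : rho%:C / w != 0 by rewrite mulf_neq0// invr_eq0.
  exists (fun v => (rho%:C / w) *: S v); split; last exact: bounded_on_scale.
  split; [exact: stable_scale|exact: linear_on_scale| |].
  + move=> v Hv; rewrite -(linZ sH lS); last first.
      by apply: (subspB sH) => //; do 2 apply: (subspZ sH); exact: sT.
    by rewrite scalerBr !scalerA divfK// mulfV// scale1r ST.
  + move=> v Hv; have HS := sS _ Hv; rewrite (linZ sH lT)// !scalerA.
    rewrite -[RHS](TS v Hv); congr (_ - _).
    by rewrite mulrA divfK// mulfV// scale1r.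
move=> C [th [/andP[th0 th1] hC]]; exists C, (th * rho); split.
- by rewrite mulr_ge0// ltW.
- by rewrite gtr_pMl.
move=> n v Hv; have := hC n v Hv; rewrite iter_scale// rnormZ cmodX cmodV.
rewrite cmod_real (ger0_norm (ltW r0)) exprVn exprMn.
rewrite ler_pdivrMl ?exprn_gt0// => /le_trans; apply.
by rewrite le_eqVlt; apply/orP; left; apply/eqP; ring.
Qed.

Hypothesis (cH : closed H) (cV : seq_complete V).

Lemma spectral_radius_on_ge0 T : 0 <= spectral_radius_on H T.
Proof.
rewrite /spectral_radius_on; set A := (X in sup X).
have [hA|/sup_out->//] := pselect (has_sup A).
have [x Ax] := hA.1; apply: le_trans (ub_le_sup hA.2 Ax).
by case: Ax => z _ <-; exact: cmod_ge0.
Qed.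

Lemma spectral_radius_on_le T C (th : R) : linear_on H T -> stable_under T H ->
  0 <= th -> (forall n v, H v -> rnorm (iter n T v) <= C * th ^+ n * rnorm v) ->
  spectral_radius_on H T <= th.
Proof.
move=> lT sT th0 hC; rewrite /spectral_radius_on; set A := (X in sup X).
have [A0|/set0P nA0] := eqVneq A set0; first by rewrite A0 sup0.
apply: ge_sup => // _ [z sz <-]; rewrite leNgt; apply/negP => zth.
by apply: sz; exact: (neumann sH cH lT sT th0 cV hC).
Qed.

(** A supremum dominates its set only when the set is bounded; the Neumann series beyond the norm of
    [T] provides this for the spectrum. *)
Lemma spectral_radius_on_resolvent T (z : R[i]) : linear_on H T ->
  stable_under T H -> bounded_on H T -> spectral_radius_on H T < cmod z ->
  resolvent_set_on H T z.
Proof.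
move=> lT sT /bounded_onP[M M0 hM] rz; apply: contrapT => nz.
suff : cmod z <= spectral_radius_on H T by rewrite leNgt rz.
apply: sup_upper_bound; last by exists z.
split; first by exists (cmod z), z.
exists M => _ [w sw <-]; rewrite leNgt; apply/negP => Mw; apply: sw.
apply: (neumann sH cH lT sT (ltW M0) cV (C := 1)) => // n v Hv.
by rewrite mul1r; exact: (iter_bound sT n (ltW M0) hM).
Qed.

(** The strict inequality puts even the circle of radius [rho] in the resolvent set, and compactness
    up to that circle yields a rate strictly below [rho]. *)
Lemma gelfand T (rho : R) : linear_on H T -> stable_under T H -> bounded_on H T ->
  spectral_radius_on H T < rho ->
  exists C th, [/\ 0 <= th, th < rho &
    forall n v, H v -> rnorm (iter n T v) <= C * th ^+ n * rnorm v].
Proof.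
move=> lT sT bT rT; apply: decays_resolvent_set => //.
  exact: le_lt_trans (spectral_radius_on_ge0 T) rT.
by move=> z zr; apply: spectral_radius_on_resolvent => //; exact: lt_le_trans zr.
Qed.

Lemma spectral_radius_on_lt T (rho : R) : 0 < rho -> linear_on H T ->
  stable_under T H -> bounded_on H T ->
  (forall z : R[i], rho <= cmod z -> resolvent_set_on H T z) ->
  spectral_radius_on H T < rho.
Proof.
move=> r0 lT sT bT hz; have [C [th [th0 thr hC]]] := decays_resolvent_set r0 lT sT bT hz.
exact: le_lt_trans (spectral_radius_on_le lT sT th0 hC) thr.
Qed.

End gelfand.

(** * Bounded projections and operators of finite rank *)

Section projection.
Context {R : realType} {V : normedModType R[i]}.
Implicit Types (u v w : V) (H F : set V).

Definition lin_span n (e : 'I_n -> V) : set V :=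
  [set \sum_(i < n) a i *: e i | a in [set: 'I_n -> R[i]]].

Lemma lin_span_subspace n (e : 'I_n -> V) : linear_subspace (lin_span e).
Proof.
split; first by exists (fun=> 0) => //; rewrite big1// => i _; rewrite scale0r.
move=> a _ _ [b _ <-] [c _ <-]; exists (fun i => a * b i + c i) => //.
rewrite scaler_sumr -big_split/=; apply: eq_bigr => i _.
by rewrite scalerDl scalerA.
Qed.

Lemma lin_spanS n (e : 'I_n.+1 -> V) w : lin_span e w <->
  exists a w', lin_span (fun i => e (widen_ord (leqnSn n) i)) w' /\ w = a *: e ord_max + w'.
Proof.
split=> [[b _ <-]|[a [_ [[b _ <-] ->]]]].
  rewrite big_ord_recr/= addrC; exists (b ord_max); eexists; split; last by [].
  by exists (fun i => b (widen_ord (leqnSn n) i)).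
exists (fun i => if insub (val i) is Some j then b j else a) => //.
rewrite big_ord_recr/= addrC; congr (_ *: _ + _).
  by rewrite insubN// ltnn.
by apply: eq_bigr => i _; rewrite insubT//= => h; congr (b _ *: _); exact: val_inj.
Qed.

Definition add_line H v : set V := [set x | exists a h, H h /\ x = a *: v + h].

Lemma add_line_subspace H v : linear_subspace H -> linear_subspace (add_line H v).
Proof.
move=> sH; split; first by exists 0, 0; rewrite scale0r addr0; split => //; exact: subsp0.
move=> a _ _ [b [h [Hh ->]]] [c [k [Hk ->]]]; exists (a * b + c), (a *: h + k).
by split; [exact: sH.2|rewrite scalerDr scalerDl scalerA addrACA].
Qed.

(** [c] is a lower bound for the distance from [v] to the closed subspace [H]; homogeneity does the
    rest. It makes the coefficient along [v] a bounded function of the vector. *)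
Lemma dist_line H v : linear_subspace H -> closed H -> ~ H v ->
  exists2 c : R, 0 < c & forall a h, H h -> c * cmod a <= rnorm (a *: v + h).
Proof.
move=> sH cH nHv.
have [c c0 hc] : exists2 c : R, 0 < c & forall h, H h -> c <= rnorm (v - h).
  apply: contrapT => h; apply: nHv; apply: (closedP H).1 => // e e0.
  apply: contrapT => h'; apply: h; exists e => // h Hh.
  by rewrite leNgt; apply/negP => he; apply: h'; exists h.
exists c => // a h Hh; have [->|a0] := eqVneq a 0; first by rewrite cmod0 mulr0 rnorm_ge0.
have -> : a *: v + h = a *: (v - - a^-1 *: h).
  by rewrite scaleNr opprK scalerDr scalerA mulfV// scale1r.
rewrite rnormZ mulrC ler_wpM2l ?cmod_ge0// hc//; exact: (subspZ sH).
Qed.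

(** Along approximants of [w] the coefficients of [v] form a Cauchy sequence by [dist_line]; once
    their limit is subtracted, closedness of [H] applies. *)
Lemma closed_add_line H v : linear_subspace H -> closed H -> ~ H v ->
  closed (add_line H v).
Proof.
move=> sH cH nHv; have [c c0 hc] := dist_line sH cH nHv.
apply/closedP => w hw.
have hw' n : exists ah : R[i] * V, H ah.2 /\ rnorm (w - (ah.1 *: v + ah.2)) < n.+1%:R^-1.
  have [|_ [a [h [Hh ->]]] wah] := hw n.+1%:R^-1; first by rewrite invr_gt0.
  by exists (a, h).
have [ah hah] := choice hw'.
pose a n := (ah n).1; pose h n := (ah n).2.
have small (e : R) : 0 < e -> exists N, forall n, (N <= n)%N -> n.+1%:R^-1 < e.
  move=> e0; exists (Num.truncn e^-1) => n Nn.
  rewrite invf_plt// ?posrE//; apply: lt_le_trans (truncnS_gt _) _.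
  by rewrite ler_nat.
have [|l hl] := @complex_cauchy R a.
  move=> e e0; have e2 : 0 < c * e / 2 by rewrite divr_gt0// mulr_gt0.
  have [N hN] := small _ e2; exists N => m n /hN hm /hN hn.
  rewrite -(ltr_pM2l c0); apply: le_lt_trans (hc _ (h m - h n) _) _.
    by apply: (subspB sH); [exact: (hah m).1|exact: (hah n).1].
  have -> : (a m - a n) *: v + (h m - h n) =
      (w - (a n *: v + h n)) - (w - (a m *: v + h m)).
    by rewrite scalerBl [RHS]addrC opprB [RHS]addrA subrK opprD addrACA.
  rewrite (le_lt_trans (rnormB _ _))//.
  have hn1 : rnorm (w - (a n *: v + h n)) < n.+1%:R^-1 := (hah n).2.
  have hm1 : rnorm (w - (a m *: v + h m)) < m.+1%:R^-1 := (hah m).2.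
  by rewrite (splitr (c * e)) ltrD//; [exact: lt_trans hn1 hn|exact: lt_trans hm1 hm].
exists l, (w - l *: v); split; last by rewrite addrC subrK.
apply: (closedP H).1 => // e e0.
have e2 : 0 < e / 2 by rewrite divr_gt0.
have [N1 h1] := small _ e2.
have v0 : 0 < rnorm v + 1 by rewrite ltr_wpDl ?rnorm_ge0.
have [N2 h2] := hl _ (divr_gt0 e2 v0).
pose n := maxn N1 N2; exists (h n); first exact: (hah n).1.
have -> : w - l *: v - h n = (w - (a n *: v + h n)) + (a n - l) *: v.
  by rewrite scalerBl [a n *: v + h n]addrC opprD !addrA subrK addrAC.
rewrite (le_lt_trans (rnormD _ _))// (splitr e) ltrD//.
  by rewrite (lt_trans (hah n).2)// h1// leq_maxl.
rewrite rnormZ; have := h2 n (leq_maxr _ _); rewrite ltr_pdivlMr//; apply: le_lt_trans.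
by rewrite ler_wpM2l ?cmod_ge0// lerDl.
Qed.

(** Boundedness of the projection onto [F] along [H], by induction on the spanning family instead of
    the open mapping theorem: a vector [v] of [F] outside the smaller span is transferred from [F]
    to [H], which stays closed by [closed_add_line]. *)
Lemma proj_bound n (e : 'I_n -> V) : forall F H, linear_subspace F ->
  F `<=` lin_span e -> linear_subspace H -> closed H ->
  (forall v, F v -> H v -> v = 0) ->
  exists2 K : R, 0 <= K & forall f h, F f -> H h -> rnorm f <= K * rnorm (f + h).
Proof.
elim: n e => [|n ih] e F H sF Fe sH cH FH.
  exists 0 => // f h /Fe[a _ <-] _.
  by rewrite big_ord0 rnorm0 mul0r.
pose e' i := e (widen_ord (leqnSn n) i).
have [Fe'|] := pselect (F `<=` lin_span e'); first exact: ih Fe' sH cH FH.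
move=> /existsNP[v /not_implyP[Fv nv]].
have [a [v' [e'v' vE]]] := (lin_spanS e v).1 (Fe _ Fv).
have a0 : a != 0.
  by apply/eqP => a0; apply: nv; rewrite vE a0 scale0r add0r.
have sE' := lin_span_subspace e'.
have v0 : v != 0.
  by apply/eqP => v0; apply: nv; rewrite v0; exact: (subsp0 sE').
have nHv : ~ H v by move=> Hv; move: v0; rewrite (FH v)// eqxx.
pose F' := F `&` lin_span e'.
have sF' : linear_subspace F'.
  split; first by split; [exact: (subsp0 sF)|exact: (subsp0 sE')].
  by move=> b x y [? ?] [? ?]; split; [exact: sF.2|exact: sE'.2].
have [c c0 hc] := dist_line sH cH nHv.
have [|||x [Fx ex] [b [h [Hh xE]]]|K K0 hK] := ih e' F' (add_line H v) sF'.
- by move=> x [].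
- exact: add_line_subspace.
- exact: closed_add_line.
- have xb : x = b *: v.
    apply/eqP; rewrite -subr_eq0; apply/eqP/FH; first by apply: (subspB sF) => //; exact: (subspZ sF).
    by rewrite xE addrC addrA addNr add0r.
  have [b0|b0] := eqVneq b 0; first by rewrite xb b0 scale0r.
  exfalso; apply: nv; have -> : v = b^-1 *: x by rewrite xb scalerA mulVf// scale1r.
  exact: (subspZ sE').
exists ((1 + K) * rnorm v / c + K).
  apply: addr_ge0 => //; apply: divr_ge0; last exact: ltW.
  by apply: mulr_ge0; [exact: addr_ge0|exact: rnorm_ge0].
move=> f h Ff Hh.
have [b [f' [ef' fE]]] := (lin_spanS e f).1 (Fe _ Ff).
pose l := b / a; pose g := f - l *: v.
have Fg : F' g.
  split; first by apply: (subspB sF) => //; exact: (subspZ sF).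
  rewrite /g fE vE scalerDr scalerA /l divfK// opprD addrACA subrr add0r.
  by apply: (subspB sE') => //; exact: (subspZ sE').
have fE' : f = l *: v + g by rewrite /g addrC subrK.
move: g Fg fE' => g Fg fE'.
have h1 : rnorm g <= K * rnorm (f + h).
  have -> : f + h = g + (l *: v + h) by rewrite {1}fE' -addrA addrCA.
  by apply: hK => //; exists l, h.
have h2 : rnorm (l *: v + h) <= (1 + K) * rnorm (f + h).
  have -> : l *: v + h = (f + h) - g by rewrite fE' addrAC addrK.
  by rewrite (le_trans (rnormB _ _))// mulrDl mul1r lerD2l.
have h3 : cmod l <= (1 + K) * rnorm (f + h) / c.
  by rewrite ler_pdivlMr// mulrC (le_trans (hc _ _ Hh)).
rewrite [X in rnorm X]fE' (le_trans (rnormD _ _))// rnormZ mulrDl lerD//.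
rewrite (le_trans (ler_wpM2r (rnorm_ge0 _) h3))// le_eqVlt; apply/orP; left.
by apply/eqP; ring.
Qed.

Lemma closed_lin_span n (e : 'I_n -> V) : closed (lin_span e).
Proof.
elim: n e => [|n ih] e.
  apply/closedP => w hw; suff -> : w = 0 by exact: (subsp0 (lin_span_subspace e)).
  apply: eq_of_small => d /hw[_ [a _ <-]].
  by rewrite big_ord0.
pose e' i := e (widen_ord (leqnSn n) i).
have cE := ih e'; have sE := lin_span_subspace e'.
have [ee|ne] := pselect (lin_span e' (e ord_max)).
  suff -> : lin_span e = lin_span e' by [].
  apply/seteqP; split=> w.
    by move=> /lin_spanS[a [w' [ew' ->]]]; exact: sE.2.
  by move=> ew; apply/lin_spanS; exists 0, w; rewrite scale0r add0r.
suff -> : lin_span e = add_line (lin_span e') (e ord_max) by exact: closed_add_line.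
by apply/seteqP; split=> w; [move=> /lin_spanS|move=> h; apply/lin_spanS].
Qed.

Definition bdd_lin (T : V -> V) : Prop := linear_on [set: V] T /\ bounded_on [set: V] T.

Definition bdd_form (phi : V -> R[i]) : Prop :=
  (forall a u v, phi (a *: u + v) = a * phi u + phi v) /\ exists M : R, forall v, cmod (phi v) <= M * rnorm v.

(** Bounded coordinate forms are part of the data: sums and compositions are then immediate, and the
    Fredholm alternative becomes a matrix computation. [finrank_of_range] is the bridge from the
    condition on the range. *)
Definition finrank (U : V -> V) : Prop := exists k (phi : 'I_k -> V -> R[i]) (e : 'I_k -> V),
  (forall j, bdd_form (phi j)) /\ forall v, U v = \sum_(j < k) phi j v *: e j.

(** The coefficient along the last vector is unique and bounded by [dist_line], hence a bounded
    form; subtracting its contribution leaves an operator with range in the smaller span. *)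
Lemma finrank_of_range n (e : 'I_n -> V) : forall T, bdd_lin T ->
  range T `<=` lin_span e -> finrank T.
Proof.
elim: n e => [|n ih] e T bT Te.
  exists 0%N, (fun=> fun=> 0), (fun=> 0); split; first by case.
  by move=> v; have [|a _ <-] := Te (T v); [exists v|rewrite !big_ord0].
pose e' i := e (widen_ord (leqnSn n) i).
have cE := @closed_lin_span _ e'; have sE := lin_span_subspace e'.
have [ee|ne] := pselect (lin_span e' (e ord_max)).
  apply: (ih e') => // _ [v _ <-].
  have [|a [w' [ew' ->]]] := (lin_spanS e (T v)).1 _; first by apply: Te; exists v.
  exact: sE.2.
have [c c0 hc] := dist_line sE cE ne.
have [M M0 hM] := bounded_onP bT.2.
have ex v : exists a, lin_span e' (T v - a *: e ord_max).
  have [|a [w' [ew' ->]]] := (lin_spanS e (T v)).1 _; first by apply: Te; exists v.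
  by exists a; rewrite addrAC subrr add0r.
have [a ha] := choice ex.
have uniq b x : lin_span e' (x - b *: e ord_max) -> forall b', 
    lin_span e' (x - b' *: e ord_max) -> b = b'.
  move=> hb b' hb'; apply/eqP; rewrite -subr_eq0 -cmod_eq0; apply/eqP/le_anti.
  rewrite cmod_ge0 andbT -(ler_pM2l c0) mulr0.
  rewrite (le_trans (hc (b - b') _ (subspB sE hb hb')))//.
  by rewrite scalerBl opprB addrACA addrA [_ + (x - _)]addrC !addrA subrK subrK subrr rnorm0.
have fa : bdd_form a.
  split.
    move=> b u v; apply: (@uniq _ (T (b *: u + v))); first exact: ha.
    rewrite bT.1// scalerDl opprD addrACA -scalerA -scalerBr.
    by apply: sE.2; exact: ha.
  exists (M / c) => v; rewrite mulrAC ler_pdivlMr// mulrC.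
  by rewrite (le_trans (hc _ _ (ha v)))// addrC subrK hM.
have bT' : bdd_lin (fun v => T v - a v *: e ord_max).
  split.
    move=> b u v _ _; rewrite bT.1// fa.1 scalerDl opprD addrACA -scalerA -scalerBr//.
  have [M' hM'] := fa.2.
  exists (M + M' * rnorm (e ord_max)) => v _; rewrite (le_trans (rnormB _ _))//.
  rewrite mulrDl lerD ?hM// rnormZ mulrAC.
  by rewrite ler_wpM2r ?rnorm_ge0.
have [|k [phi [f [hphi Tf]]]] := ih e' _ bT'; first by move=> _ [v _ <-].
exists k.+1, (fun j => if insub (val j) is Some i then phi i else a),
  (fun j => if insub (val j) is Some i then f i else e ord_max); split.
  by move=> j; case: insubP => // i _ _.
move=> v; rewrite big_ord_recr/= insubN ?ltnn//.
rewrite (eq_bigr (fun i => phi i v *: f i)); last first.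
  by move=> i _; rewrite (_ : insub _ = Some i)//; exact: valK.
by rewrite -Tf subrK.
Qed.

End projection.

(** * Finite-rank perturbations of invertible operators *)

Section operators.
Context {R : realType} {V : normedModType R[i]}.
Implicit Types (u v w : V) (S T U B D : V -> V).

Lemma bdd_lin_id : bdd_lin (@id V).
Proof. by split => //; exists 1 => v _; rewrite mul1r. Qed.

Lemma bdd_linD S T : bdd_lin S -> bdd_lin T -> bdd_lin (fun v => S v + T v).
Proof.
move=> [lS [M hM]] [lT [N hN]]; split.
  by move=> a u v _ _; rewrite lS// lT// scalerDr addrACA.
by exists (M + N) => v _; rewrite mulrDl (le_trans (rnormD _ _))// lerD ?hM ?hN.
Qed.

Lemma bdd_linZ (a : R[i]) T : bdd_lin T -> bdd_lin (fun v => a *: T v).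
Proof.
move=> [lT bT]; split; [exact: linear_on_scale|exact: bounded_on_scale].
Qed.

Lemma bdd_linN T : bdd_lin T -> bdd_lin (fun v => - T v).
Proof.
move=> /(bdd_linZ (-1)); rewrite (_ : (fun v => -1 *: T v) = (fun v => - T v))//.
by apply/funext => v; rewrite scaleN1r.
Qed.

Lemma bdd_linB S T : bdd_lin S -> bdd_lin T -> bdd_lin (fun v => S v - T v).
Proof. by move=> hS /bdd_linN; exact: bdd_linD. Qed.

Lemma bdd_lin_comp S T : bdd_lin S -> bdd_lin T -> bdd_lin (fun v => S (T v)).
Proof.
move=> [lS bS] [lT [N hN]]; have [M M0 hM] := bounded_onP bS; split.
  by move=> a u v _ _; rewrite lT// lS.
exists (M * N) => v _; rewrite (le_trans (hM _ _))// -mulrA.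
by rewrite ler_wpM2l ?hN// ltW.
Qed.

Lemma bdd_lin_iter n T : bdd_lin T -> bdd_lin (iter n T).
Proof.
by move=> bT; elim: n => [|n ih]; [exact: bdd_lin_id|exact: bdd_lin_comp].
Qed.

Lemma bdd_form_comp phi T : bdd_form phi -> bdd_lin T -> bdd_form (fun v => phi (T v)).
Proof.
move=> [lp [M hM]] [lT [N hN]]; split.
  by move=> a u v; rewrite lT// lp.
exists (`|M| * N) => v; rewrite (le_trans (hM _))// -mulrA.
rewrite (@le_trans _ _ (`|M| * rnorm (T v)))//.
  by rewrite ler_wpM2r ?rnorm_ge0// ler_norm.
by rewrite ler_wpM2l// hN.
Qed.

Lemma bdd_formN (phi : V -> R[i]) : bdd_form phi -> bdd_form (fun v => - phi v).
Proof.
move=> [lp [M hM]]; split; last by exists M => v; rewrite cmodN.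
by move=> a u v; rewrite lp opprD mulrN.
Qed.

Lemma bdd_form_sum n (phi : 'I_n -> V -> R[i]) (c : 'I_n -> R[i]) :
  (forall i, bdd_form (phi i)) -> bdd_form (fun v => \sum_(i < n) phi i v * c i).
Proof.
move=> h; split.
  move=> a u v; rewrite mulr_sumr -big_split/=; apply: eq_bigr => i _.
  by rewrite (h i).1 mulrDl mulrA.
have /choice[M hM] := fun i => (h i).2.
exists (\sum_(i < n) M i * cmod (c i)) => v.
rewrite mulr_suml; elim/big_ind2 : _ => //; first by rewrite cmod0.
  by move=> x1 x2 y1 y2 h1 h2; rewrite (le_trans (cmodD _ _))// lerD.
by move=> i _; rewrite cmodM mulrAC ler_wpM2r ?cmod_ge0.
Qed.

Lemma finrank_bdd U : finrank U -> bdd_lin U.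
Proof.
move=> [k [phi [e [hphi hU]]]]; split.
  move=> a u v _ _; rewrite !hU scaler_sumr -big_split/=; apply: eq_bigr => j _.
  by rewrite (hphi j).1 scalerDl scalerA.
have /choice[M hM] := fun j => (hphi j).2.
exists (\sum_(j < k) M j * rnorm (e j)) => v _; rewrite hU.
rewrite (le_trans (rnorm_sum _ _ _))// mulr_suml ler_sum// => j _.
by rewrite rnormZ mulrAC ler_wpM2r ?rnorm_ge0.
Qed.

Lemma finrank0 : finrank (fun=> 0 : V).
Proof.
exists 0%N, (fun=> fun=> 0), (fun=> 0); split; first by case.
by move=> v; rewrite big_ord0.
Qed.

Lemma finrankD S T : finrank S -> finrank T -> finrank (fun v => S v + T v).
Proof.
move=> [k [phi [e [hphi hS]]]] [l [psi [f [hpsi hT]]]].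
exists (k + l)%N, (fun j => match fintype.split j with inl i => phi i | inr i => psi i end),
  (fun j => match fintype.split j with inl i => e i | inr i => f i end); split.
  by move=> j; case: fintype.split => i.
move=> v; rewrite hS hT big_split_ord/=; congr (_ + _); apply: eq_bigr => i _.
  by case: splitP => j /= => [/val_inj ->//|E]; have := ltn_ord i; rewrite E ltnNge leq_addr.
case: splitP => j /= => [E|/addnI /val_inj ->//].
by have := ltn_ord j; rewrite -E ltnNge leq_addr.
Qed.

Lemma finrank_compl B U : bdd_lin B -> finrank U -> finrank (fun v => B (U v)).
Proof.
move=> [lB _] [k [phi [e [hphi hU]]]]; exists k, phi, (fun j => B (e j)); split => // v.
rewrite hU (lin_sum linear_subspaceT lB)//; apply: eq_bigr => j _.
by rewrite (linZ linear_subspaceT lB).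
Qed.

Lemma finrank_compr B U : bdd_lin B -> finrank U -> finrank (fun v => U (B v)).
Proof.
move=> bB [k [phi [e [hphi hU]]]]; exists k, (fun j v => phi j (B v)), e; split.
  by move=> j; exact: bdd_form_comp.
by move=> v; rewrite hU.
Qed.

Lemma finrankN U : finrank U -> finrank (fun v => - U v).
Proof.
move=> fU; have := finrank_compl (bdd_linN bdd_lin_id) fU; exact.
Qed.

Lemma finrankB S T : finrank S -> finrank T -> finrank (fun v => S v - T v).
Proof. by move=> hS /finrankN; exact: finrankD. Qed.

Definition invertible_op B := bdd_lin B /\
  exists B', [/\ bdd_lin B', forall v, B' (B v) = v & forall v, B (B' v) = v].

Lemma invertible_op_comp B D : invertible_op B -> invertible_op D ->
  invertible_op (fun v => B (D v)).
Proof.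
move=> [bB [B' [bB' B'B BB']]] [bD [D' [bD' D'D DD']]].
split; first exact: bdd_lin_comp.
exists (fun v => D' (B' v)); split; first exact: bdd_lin_comp.
- by move=> v; rewrite B'B D'D.
- by move=> v; rewrite DD' BB'.
Qed.

End operators.

Section fredholm.
Context {R : realType} {V : normedModType R[i]}.
Implicit Types (u v w : V).
Variables (S B U : V -> V).
Hypothesis iB : invertible_op B.
Hypothesis fU : finrank U.
Hypothesis SE : forall v, S v = B v + U v.

(* Writing S = (1 - K) B with K w = \sum_j psi_j(w) e_j, the operator 1 - K is
   governed by the matrix N = 1 - (psi_j(e_i))_(i, j): psi((1 - K) w) = psi(w) N. *)
Let setup : exists k (psi : 'I_k -> V -> R[i]) (e : 'I_k -> V) (B' : V -> V),
  [/\ bdd_lin B', (forall v, B' (B v) = v), (forall v, B (B' v) = v),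
     (forall j, bdd_form (psi j)) &
     forall v, S v = B v - \sum_(j < k) psi j (B v) *: e j].
Proof.
have [bB [B' [bB' B'B BB']]] := iB; have [k [phi [e [hphi hU]]]] := fU.
exists k, (fun j v => - phi j (B' v)), e, B'; split => //.
  by move=> j; apply: bdd_formN; exact: bdd_form_comp.
move=> v; rewrite SE hU -sumrN; congr (_ + _); apply: eq_bigr => j _.
by rewrite B'B scaleNr opprK.
Qed.

Section matrix.
Variables (k : nat) (psi : 'I_k -> V -> R[i]) (e : 'I_k -> V).
Hypothesis hpsi : forall j, bdd_form (psi j).

Let row_psi w : 'rV[R[i]]_k := \row_j psi j w.
Let emb (c : 'rV[R[i]]_k) : V := \sum_(j < k) c 0 j *: e j.
Let N : 'M[R[i]]_k := 1%:M - \matrix_(i, j) psi j (e i).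

Let psi0 j : psi j 0 = 0.
Proof. by have := (hpsi j).1 (-1) 0 0; rewrite scaler0 addr0 mulN1r addNr. Qed.

Let psi_sum j (c : 'rV[R[i]]_k) : psi j (emb c) = \sum_(i < k) c 0 i * psi j (e i).
Proof.
rewrite /emb; elim/big_rec2 : _ => [|i x y _ <-]; first exact: psi0.
by rewrite (hpsi j).1.
Qed.

Let row_emb c : row_psi (emb c) = c - c *m N.
Proof.
rewrite /N mulmxBr mulmx1 opprB addrCA subrr addr0.
apply/rowP => j; rewrite !mxE psi_sum; apply: eq_bigr => i _.
by rewrite !mxE.
Qed.

Let rowB u v : row_psi (u - v) = row_psi u - row_psi v.
Proof.
apply/rowP => j; rewrite !mxE [u - v]addrC -scaleN1r (hpsi j).1 mulN1r.
exact: addrC.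
Qed.

Let K1 w := w - emb (row_psi w).

Let row_K1 w : row_psi (K1 w) = row_psi w *m N.
Proof. by rewrite /K1 rowB row_emb opprB addrCA subrr addr0. Qed.

(** Belonging to the range is a condition on finitely many bounded forms: if psi(w) = c N, then w +
    [emb c] is a preimage because its row of forms is exactly c. *)
Let range_K1 w : (exists v, K1 v = w) <-> (row_psi w <= N)%MS.
Proof.
split=> [[v <-]|/submxP[c cN]]; first by rewrite row_K1 submxMl.
exists (w + emb c); rewrite /K1.
have -> : row_psi (w + emb c) = c.
  rewrite -[emb c]opprK rowB -[- emb c]sub0r rowB.
  rewrite (_ : row_psi 0 = 0); last by apply/rowP => j; rewrite !mxE psi0.
  by rewrite sub0r opprK row_emb cN addrC subrK.
by rewrite addrK.
Qed.

Let row_mul_form (A : 'M[R[i]]_k) j : bdd_form (fun w => (row_psi w *m A) 0 j).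
Proof.
have -> : (fun w => (row_psi w *m A) 0 j) = (fun w => \sum_(i < k) psi i w * A i j).
  by apply/funext => w; rewrite mxE; apply: eq_bigr => i _; rewrite mxE.
exact: bdd_form_sum.
Qed.

Let kerK1 c : c *m N = 0 -> K1 (emb c) = 0.
Proof. by move=> cN; rewrite /K1 row_emb cN subr0 subrr. Qed.

(** A row c with c N = 0 gives [emb c] in the kernel of [K1], and [row_emb] recovers c from it; so
    injectivity makes [N] invertible. The inverse is w + emb (psi(w) N^-1). *)
Let K1_inverse : (forall w, K1 w = 0 -> w = 0) ->
  exists X, [/\ bdd_lin X, forall w, X (K1 w) = w & forall w, K1 (X w) = w].
Proof.
move=> inj.
have uN : N \in unitmx.
  rewrite -row_free_unit -kermx_eq0; apply/eqP/row_matrixP => i; rewrite row0.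
  set c := row i _; have cN : c *m N = 0 by rewrite -row_mul mulmx_ker row0.
  have c0 := inj _ (kerK1 cN).
  have := row_emb c; rewrite c0 cN subr0 => <-.
  by apply/rowP => j; rewrite !mxE psi0.
pose X w := w + emb (row_psi w *m invmx N).
exists X; split.
- apply: bdd_linD; first exact: bdd_lin_id.
  suff : finrank (fun v => emb (row_psi v *m invmx N)) by exact: finrank_bdd.
  by exists k, (fun j w => (row_psi w *m invmx N) 0 j), e.
- by move=> w; rewrite /X row_K1 mulmxK// /K1 subrK.
- move=> w; rewrite /K1 /X.
  set c := row_psi w *m invmx N.
  have cN : row_psi w = c *m N by rewrite /c mulmxKV.
  have -> : row_psi (w + emb c) = c.
    rewrite -[emb c]opprK rowB -[- emb c]sub0r rowB.
    rewrite (_ : row_psi 0 = 0); last by apply/rowP => j; rewrite !mxE psi0.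
    by rewrite sub0r opprK row_emb cN addrC subrK.
  by rewrite addrK.
Qed.

(** By [range_K1] the range is the common kernel of the forms psi(w) times the cokernel matrix of
    [N], and these forms are bounded. *)
Let K1_closed : closed (range K1).
Proof.
apply/closedP => w hw; suff /range_K1[v <-] : (row_psi w <= N)%MS by exists v.
rewrite submxE; apply/eqP/rowP => j; rewrite [RHS]mxE.
have [lf [M hM]] := row_mul_form (cokermx N) j.
have M1 : 0 < `|M| + 1 by rewrite ltr_wpDl.
apply/eqP; rewrite -cmod_eq0; apply/eqP/le_anti; rewrite cmod_ge0 andbT.
apply/ler_addgt0Pr => d d0; rewrite add0r.
have [_ [v _ <-] wv] := hw _ (divr_gt0 d0 M1).
have h0 : (row_psi (K1 v) *m cokermx N) 0 j = 0.
  by rewrite row_K1 -mulmxA mulmx_coker mulmx0 mxE.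
have -> : (row_psi w *m cokermx N) 0 j = (row_psi (w - K1 v) *m cokermx N) 0 j.
  by rewrite rowB mulmxBl [RHS]mxE [X in _ + X]mxE h0 subr0.
apply: le_trans (hM _) _; apply: (@le_trans _ _ ((`|M| + 1) * rnorm (w - K1 v))).
  by rewrite ler_wpM2r ?rnorm_ge0// (le_trans (ler_norm _))// lerDl.
by rewrite mulrC -ler_pdivlMr// ltW.
Qed.

(** A dimension count: [B'] carries the kernel of [N] injectively to rows that meet the row space of
    [N] only in 0, so by rank-nullity both together fill the whole row space. [B'] occurs because S
    = K1 B, so that the kernel of S is the image by [B'] of that of [K1]. *)
Let range_ker_sum (B' : V -> V) : bdd_lin B' -> (forall v, B' v = 0 -> v = 0) ->
  (forall f, K1 f = 0 -> (exists v, K1 v = B' f) -> B' f = 0) ->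
  forall w, exists f v, K1 f = 0 /\ w = B' f + K1 v.
Proof.
move=> bB' injB' h w.
pose L : 'M[R[i]]_k := \matrix_(i, j) psi j (B' (e i)).
have BL c : row_psi (B' (emb c)) = c *m L.
  apply/rowP => j; rewrite !mxE /emb.
  rewrite (lin_sum linear_subspaceT bB'.1)//.
  rewrite (eq_bigr (fun i => c 0 i *: B' (e i))); last first.
    by move=> i _; rewrite (linZ linear_subspaceT bB'.1).
  rewrite [RHS](eq_bigr (fun i => c 0 i * psi j (B' (e i)))); last first.
    by move=> i _; rewrite mxE.
  elim/big_rec2 : _ => [|i x y _ <-]; first exact: psi0.
  by rewrite (hpsi j).1.
have key (c : 'rV[R[i]]_k) : (c <= kermx N)%MS -> (c *m L <= N)%MS -> c = 0.
  move=> /sub_kermxP cN cL; have K0 := kerK1 cN.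
  have B0 : B' (emb c) = 0 by apply: h => //; apply/range_K1; rewrite BL.
  have e0 := injB' _ B0; have := row_emb c; rewrite e0 cN subr0 => <-.
  by apply/rowP => j; rewrite !mxE psi0.
have rk : \rank (kermx N *m L) = \rank (kermx N).
  apply/mxrank_injP; rewrite -submx0; apply/rV_subP => c.
  rewrite sub_capmx => /andP[c1 /sub_kermxP c2].
  by rewrite (key c) ?sub0mx// c2 sub0mx.
have cap : (kermx N *m L :&: N)%MS = 0.
  apply/eqP; rewrite -submx0; apply/rV_subP => c.
  rewrite sub_capmx => /andP[/submxP[b ->] c2].
  by rewrite mulmxA (key (b *m kermx N)) ?mul0mx ?sub0mx ?submxMl// -mulmxA.
have full : row_full (kermx N *m L + N)%MS.
  rewrite /row_full (mxrank_disjoint_sum cap) rk mxrank_ker subnK//.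
  exact: rank_leq_row.
have := submx_full (row_psi w) full => /sub_addsmxP[[c1 c2] /= cE].
exists (emb (c1 *m kermx N)).
have : (row_psi (w - B' (emb (c1 *m kermx N))) <= N)%MS.
  by rewrite rowB BL cE mulmxA [X in X - _]addrC addrK submxMl.
move=> /range_K1[v vE]; exists v; split; last by rewrite vE addrC subrK.
by apply: kerK1; rewrite -mulmxA mulmx_ker mulmx0.
Qed.

Variable (B' : V -> V).
Hypotheses (bB' : bdd_lin B') (B'B : forall v, B' (B v) = v) (BB' : forall v, B (B' v) = v).
Hypothesis SK : forall v, S v = B v - \sum_(j < k) psi j (B v) *: e j.

Let SK1 v : S v = K1 (B v).
Proof.
by rewrite SK /K1 /emb; congr (_ - _); apply: eq_bigr => j _; rewrite mxE.
Qed.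

Let B0 : B 0 = 0. Proof. exact: (lin0 linear_subspaceT iB.1.1). Qed.
Let B'0 : B' 0 = 0. Proof. exact: (lin0 linear_subspaceT bB'.1). Qed.

Let fredholm_inverse0 : (forall v, S v = 0 -> v = 0) ->
  exists X, [/\ bdd_lin X, forall w, X (S w) = w & forall w, S (X w) = w].
Proof.
move=> inj; have [|X [bX XK KX]] := K1_inverse.
  move=> w K0; have : B' w = 0 by apply: inj; rewrite SK1 BB'.
  by move=> /(congr1 B); rewrite BB' B0.
exists (fun w => B' (X w)); split; first exact: bdd_lin_comp.
- by move=> w; rewrite SK1 XK B'B.
- by move=> w; rewrite SK1 BB' KX.
Qed.

Let fredholm_closed0 : closed (range S).
Proof.
suff -> : range S = range K1 by exact: K1_closed.
apply/seteqP; split=> _ [v _ <-]; first by exists (B v) => //; rewrite SK1.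
by exists (B' v) => //; rewrite SK1 BB'.
Qed.

Let fredholm_ker0 v : S v = 0 -> exists c : 'rV[R[i]]_k, v = \sum_(j < k) c 0 j *: B' (e j).
Proof.
rewrite SK1 => /eqP; rewrite subr_eq0 => /eqP vE; exists (row_psi (B v)).
rewrite -[LHS]B'B [in LHS]vE /emb (lin_sum linear_subspaceT bB'.1)//.
by apply: eq_bigr => j _; rewrite (linZ linear_subspaceT bB'.1).
Qed.

Let fredholm_sum0 : (forall v, S (S v) = 0 -> S v = 0) ->
  forall w, exists f v, S f = 0 /\ w = f + S v.
Proof.
move=> h w; have [| |f [v [Kf wE]]] := range_ker_sum bB' _ _ w.
- by move=> v /(congr1 B); rewrite BB' B0.
- move=> f Kf [v vE]; have e1 : S (B' v) = B' f by rewrite SK1 BB'.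
  by rewrite -e1; apply: h; rewrite e1 SK1 BB'.
exists (B' f), (B' v); split; first by rewrite SK1 BB' Kf.
by rewrite SK1 BB'.
Qed.

Let fredholm_all0 :
  [/\ (forall v, S v = 0 -> v = 0) ->
     exists X, [/\ bdd_lin X, forall w, X (S w) = w & forall w, S (X w) = w],
     closed (range S), finite_dimensional [set v | S v = 0] &
     (forall v, S (S v) = 0 -> S v = 0) ->
       forall w, exists f v, S f = 0 /\ w = f + S v].
Proof.
split.
- exact: fredholm_inverse0.
- exact: fredholm_closed0.
- exists k, (fun j => B' (e j)) => v /= /fredholm_ker0[c ->].
  by exists (c 0).
- exact: fredholm_sum0.
Qed.

Definition fredholm_all := fredholm_all0.

End matrix.

Let all : [/\ (forall v, S v = 0 -> v = 0) ->
     exists X, [/\ bdd_lin X, forall w, X (S w) = w & forall w, S (X w) = w],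
     closed (range S), finite_dimensional [set v | S v = 0] &
     (forall v, S (S v) = 0 -> S v = 0) ->
       forall w, exists f v, S f = 0 /\ w = f + S v].
Proof.
have [k [psi [e [B' [bB' B'B BB' hpsi SK]]]]] := setup.
exact: fredholm_all hpsi _ bB' B'B BB' SK.
Qed.

Lemma fredholm_inverse : (forall v, S v = 0 -> v = 0) ->
  exists X, [/\ bdd_lin X, forall w, X (S w) = w & forall w, S (X w) = w].
Proof. by case: all. Qed.

Lemma fredholm_closed_range : closed (range S).
Proof. by case: all. Qed.

Lemma fredholm_ker_finite : finite_dimensional [set v | S v = 0].
Proof. by case: all. Qed.

Lemma fredholm_ker_range : (forall v, S (S v) = 0 -> S v = 0) ->
  forall w, exists f v, S f = 0 /\ w = f + S v.
Proof. by case: all. Qed.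

End fredholm.

(** * Quasi-compact operators *)

Section pigeonhole.
Context {R : realType}.

Lemma truncn_eq_dist (x y : R) : 0 <= x -> 0 <= y ->
  Num.truncn x = Num.truncn y -> `|x - y| < 1.
Proof.
move=> x0 y0 xy; have := truncn_itv x0; have := truncn_itv y0.
rewrite xy -natr1 => /andP[h1 h2] /andP[h3 h4].
by rewrite ltr_norml; apply/andP; split; lra.
Qed.

(** A finite form of Bolzano-Weierstrass: real and imaginary parts of all coordinates are coded by
    intervals of length eta / 2, and finitely many codes force a repetition. The shift by [M] makes
    the quantities to truncate nonnegative. *)
Lemma bounded_pigeonhole k (a : nat -> 'I_k -> R[i]) (M eta : R) : 0 < eta ->
  (forall n j, cmod (a n j) <= M) ->
  exists m n, (m < n)%N /\ forall j, cmod (a n j - a m j) < eta.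
Proof.
move=> eta0 aM.
pose s x := (x + M) / (eta / 2).
have eta2 : 0 < eta / 2 by rewrite divr_gt0.
pose L := Num.truncn (s M).
have s0 x : `|x| <= M -> 0 <= s x.
  by rewrite ler_norml => /andP[h _]; rewrite divr_ge0 ?(ltW eta2)//; lra.
have sL x : `|x| <= M -> (Num.truncn (s x) < L.+1)%N.
  move=> h; rewrite ltnS le_truncn// ler_pM2r ?invr_gt0//.
  by rewrite lerD2r (le_trans (ler_norm _)).
have close x y : `|x| <= M -> `|y| <= M ->
    inord (Num.truncn (s x)) = inord (Num.truncn (s y)) :> 'I_L.+1 ->
    `|x - y| < eta / 2.
  move=> hx hy /(congr1 val); rewrite /= !inordK ?sL// => /truncn_eq_dist.
  move=> /(_ (s0 _ hx) (s0 _ hy)); rewrite /s -mulrBl opprD addrACA subrr addr0.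
  by rewrite normrM [X in _ * X]gtr0_norm ?invr_gt0// ltr_pdivrMr// mul1r.
pose T := {ffun 'I_k -> 'I_L.+1 * 'I_L.+1}.
pose code (n : nat) : T := [ffun j => (inord (Num.truncn (s (complex.Re (a n j)))),
  inord (Num.truncn (s (complex.Im (a n j)))))].
have /injectivePn[x [y xy cxy]] : ~~ injectiveb (fun i : 'I_#|T|.+1 => code i).
  apply/negP => /injectiveP inj; have := leq_card _ inj.
  by rewrite card_ord ltnn.
wlog lt : x y xy cxy / (x < y)%N.
  move=> h; case: (ltngtP x y) => xy'.
  - exact: h cxy _.
  - by apply: (h y x) => //; rewrite eq_sym.
  - by move: xy; rewrite (val_inj xy') eqxx.
exists x, y; split => // j.
have := congr1 (fun f : T => f j) cxy; rewrite !ffunE => -[c1 c2].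
rewrite (le_lt_trans (cmod_le_ReIm _))// !raddfB/= (splitr eta) ltrD//.
  by rewrite distrC; apply: close c1; rewrite (le_trans (cmod_Re _)).
by rewrite distrC; apply: close c2; rewrite (le_trans (cmod_Im _)).
Qed.

End pigeonhole.

Section riesz.
Context {R : realType} {V : normedModType R[i]}.

Lemma riesz_lemma (H : set V) v : linear_subspace H -> closed H -> ~ H v ->
  exists a h, [/\ H h, rnorm (a *: v + h) <= 1 &
    forall g, H g -> 2^-1 <= rnorm (a *: v + h - g)].
Proof.
move=> sH cH nHv; have [c c0 hc] := dist_line sH cH nHv.
pose A := [set rnorm (v - h) | h in H].
have iA : has_inf A.
  split; first by exists (rnorm (v - 0)), 0 => //; exact: (subsp0 sH).
  by exists 0 => _ [h _ <-]; exact: rnorm_ge0.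
pose d := inf A.
have dlb h : H h -> d <= rnorm (v - h).
  by move=> Hh; apply: ge_inf; [exact: iA.2|exists h].
have d0 : 0 < d.
  apply: (lt_le_trans c0); apply: lb_le_inf; first exact: iA.1.
  move=> _ [h Hh <-]; have := hc 1 (- h) (subspN sH Hh).
  by rewrite cmod1 mulr1 scale1r.
(* A point of [H] within twice the distance [d]; normalising the difference gives the constant
   1/2. *)
have [_ [h Hh <-] hd] := inf_adherent d0 iA.
pose n := rnorm (v - h).
have n0 : 0 < n by apply: (lt_le_trans d0); exact: dlb.
have cn : cmod (n^-1)%:C = n^-1 by rewrite cmod_real gtr0_norm// invr_gt0.
have nC : (n%:C : R[i]) != 0 by rewrite -cmod_gt0 cmod_real gtr0_norm.
exists (n^-1)%:C, (- (n^-1)%:C *: h); split.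
- exact: (subspZ sH).
- by rewrite scaleNr -scalerBr rnormZ cn mulVf ?gt_eqF.
- move=> g Hg.
  have -> : (n^-1)%:C *: v + - (n^-1)%:C *: h - g = (n^-1)%:C *: (v - (h + n%:C *: g)).
    rewrite opprD addrA scalerBr scalerA fmorphV mulVf// scale1r.
    by rewrite scaleNr -scalerBr.
  rewrite rnormZ cn mulrC ler_pdivlMr//.
  have : d <= rnorm (v - (h + n%:C *: g)).
    by apply: dlb; apply: (subspD sH) => //; exact: (subspZ sH).
  by move: hd; rewrite -/d -/n; lra.
Qed.

End riesz.

Section quasicompact.
Context {R : realType} {V : normedModType R[i]}.
Implicit Types (u v w : V) (s t : seq R[i]) (z : R[i]).
Hypothesis cV : seq_complete V.
Variables (P D U : V -> V) (delta sigma : R).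
Hypotheses (bD : bdd_lin D) (fU : finrank U) (PE : forall v, P v = D v + U v).
Hypotheses (delta0 : 0 <= delta) (Dd : forall v, rnorm (D v) <= delta * rnorm v).
Hypothesis ds : 4 * delta < sigma.

Let sT := @linear_subspaceT R V.
Let sigma0 : 0 < sigma. Proof. by move: delta0 ds; lra. Qed.

Let bP : bdd_lin P.
Proof.
rewrite (_ : P = fun v => D v + U v); last exact/funext.
by apply: bdd_linD => //; exact: finrank_bdd.
Qed.
Let lP := bP.1.

Let D_inv z : sigma <= cmod z -> invertible_op (fun v => z *: v - D v).
Proof.
move=> zs; have dz : delta < cmod z by apply: lt_le_trans zs; move: delta0 ds; lra.
have sD : stable_under D [set: V] by [].
have hD n v : [set: V] v -> rnorm (iter n D v) <= 1 * delta ^+ n * rnorm v.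
  by move=> _; rewrite mul1r; apply: (iter_bound sD) => // w _; exact: Dd.
have [S [_ lS bS SD DS]] := neumann sT closedT bD.1 sD delta0 cV hD dz.
split; first by apply: bdd_linB => //; apply: bdd_linZ; exact: bdd_lin_id.
by exists S; split => //; [move=> v; exact: SD|move=> v; exact: DS].
Qed.

(** The product of the factors z - P over [s]. For a suitable [s] its kernel and range are the two
    summands of the splitting; lists make it easy to add one factor at a time. *)
Definition poly_op s : V -> V := foldr (fun z (f : V -> V) v => z *: f v - P (f v)) id s.

Lemma poly_op_cons z s v : poly_op (z :: s) v = z *: poly_op s v - P (poly_op s v).
Proof. by []. Qed.

Lemma poly_op_bdd s : bdd_lin (poly_op s).
Proof.
elim: s => [|z s ih]; first exact: bdd_lin_id.
by apply: bdd_linB; [exact: bdd_linZ|exact: bdd_lin_comp].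
Qed.

Lemma poly_op_comm (Q : V -> V) s v : linear_on [set: V] Q ->
  (forall v, Q (P v) = P (Q v)) -> Q (poly_op s v) = poly_op s (Q v).
Proof.
move=> lQ QP; elim: s => [//|z s ih].
by rewrite !poly_op_cons -ih (linB sT lQ)// (linZ sT lQ)// QP.
Qed.

Lemma poly_op_commute s t v : poly_op s (poly_op t v) = poly_op t (poly_op s v).
Proof.
apply: poly_op_comm; first exact: (poly_op_bdd s).1.
by move=> w; rewrite (@poly_op_comm P).
Qed.

(** Each factor is the invertible z - D minus the finite-rank [U], and operators of the form
    invertible plus finite rank are stable under composition. *)
Lemma poly_op_fredholm s : all (fun z => sigma <= cmod z) s ->
  exists B U', [/\ invertible_op B, finrank U' & forall v, poly_op s v = B v + U' v].
Proof.
elim: s => [_|z s ih /=/andP[zs /ih[B [U' [iB fU' SE]]]]].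
  exists id, (fun=> 0); split; [|exact: finrank0|by move=> v; rewrite addr0].
  by split; [exact: bdd_lin_id|exists id; split => //; exact: bdd_lin_id].
exists (fun v => z *: B v - D (B v)), (fun v => z *: U' v - P (U' v) - U (B v)); split.
- exact: invertible_op_comp (D_inv zs) iB.
- apply: finrankB; last by apply: finrank_compr => //; exact: iB.1.
  apply: finrankB; first by apply: (finrank_compl _ fU'); apply: bdd_linZ; exact: bdd_lin_id.
  exact: finrank_compl.
- move=> v; rewrite SE scalerDr (linD lP)// [P (B v)]PE !opprD.
  rewrite -!addrA; congr (_ + _); rewrite [RHS]addrCA; congr (_ + _); congr (_ + _).
  exact: addrC.
Qed.

(* Along an infinite strictly increasing chain of such kernels Riesz's lemma gives
   bounded vectors whose images by P stay sigma / 2 apart, while U has finite rank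
   and D is too small to separate them. *)
Lemma poly_op_maximal_ker : exists2 s, all (fun z => sigma <= cmod z) s &
  forall z v, sigma <= cmod z -> poly_op (z :: s) v = 0 -> poly_op s v = 0.
Proof.
apply: contrapT => H.
have next s : exists z, all (fun z => sigma <= cmod z) s -> sigma <= cmod z /\
    exists v, poly_op (z :: s) v = 0 /\ poly_op s v <> 0.
  have [hs|hs] := pselect (all (fun z => sigma <= cmod z) s); last by exists 0.
  apply: contrapT => h; apply: H; exists s => // z v zs zv.
  by apply: contrapT => nv; apply: h; exists z => _; split => //; exists v.
have [f hf] := choice next.
pose s n := iter n (fun s => f s :: s) [::].
have hs n : all (fun z => sigma <= cmod z) (s n).
  elim: n => [//|n ih]; rewrite /s iterS -/(s n) /= ih andbT.
  exact: (hf _ ih).1.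
pose K n := [set v | poly_op (s n) v = 0].
have sK n : linear_subspace (K n).
  have lS := (poly_op_bdd (s n)).1.
  split; first exact: (lin0 sT lS).
  by move=> a u v Ku Kv; rewrite /K /= lS// Ku Kv scaler0 addr0.
have cK n : closed (K n).
  have [lS bS] := poly_op_bdd (s n); have [M M0 hM] := bounded_onP bS.
  apply/closedP => w hw; apply: eq_of_small => e e0.
  have [h Kh wh] := hw _ (divr_gt0 e0 M0).
  rewrite subr0 -[poly_op _ w]subr0 -[X in _ - X]Kh -(linB sT lS)//.
  by rewrite (le_lt_trans (hM _ _))// mulrC -ltr_pdivlMr.
have KS n v : K n v -> K n.+1 v.
  move=> Kv; change (f (s n) *: poly_op (s n) v - P (poly_op (s n) v) = 0).
  by rewrite (Kv : poly_op (s n) v = 0) scaler0 (lin0 sT lP) subrr.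
have Kmon m n v : (m <= n)%N -> K m v -> K n v.
  by move=> /subnKC <-; elim: (n - m)%N => [|k ih]; rewrite ?addn0// addnS => /ih/KS.
have ex n : exists u, [/\ K n.+1 u, rnorm u <= 1 &
    forall g, K n g -> 2^-1 <= rnorm (u - g)].
  have [_ [v [v1 v2]]] := hf _ (hs n).
  have [a [h [Kh h1 h2]]] := riesz_lemma (sK n) (cK n) v2.
  exists (a *: v + h); split => //; apply: (sK n.+1).2 => //; exact: KS.
have [u hu] := choice ex.
have [k [phi [e [hphi UE]]]] := fU.
have /choice[M hM] := fun j => (hphi j).2.
pose E := \sum_(j < k) rnorm (e j).
have E0 : 0 <= E by rewrite sumr_ge0// => j _; exact: rnorm_ge0.
(* What must be left to [U] once [D] has separated two images by at most [2 * delta]; positivity of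
   [g] is precisely the condition [4 * delta < sigma]. *)
pose g := sigma / 2 - 2 * delta.
have g0 : 0 < g by rewrite /g; move: ds; lra.
have eta0 : 0 < g / (E + 1) by rewrite divr_gt0// ltr_wpDl.
have [|m [n [mn hmn]]] := @bounded_pigeonhole R k (fun n j => phi j (u n))
    (\sum_(j < k) `|M j|) _ eta0.
  move=> n j; rewrite (le_trans (hM j _))// (bigD1 j)//=.
  rewrite (@le_trans _ _ `|M j|)//; last by rewrite lerDl sumr_ge0.
  rewrite (le_trans (ler_wpM2r (rnorm_ge0 _) (ler_norm (M j))))//.
  by rewrite ler_piMr//; have [] := hu n.
have [Kn un1 hn] := hu n; have [Km um1 _] := hu m.
have hU : rnorm (U (u n) - U (u m)) <= g / (E + 1) * E.
  rewrite !UE -sumrB (le_trans (rnorm_sum _ _ _))// mulr_sumr ler_sum// => j _.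
  by rewrite -scalerBl rnormZ ler_wpM2r ?rnorm_ge0// ltW.
have hU' : rnorm (U (u n) - U (u m)) < g.
  apply: (le_lt_trans hU); rewrite -mulrA gtr_pMr// mulrC ltr_pdivrMr ?ltr_wpDl//.
  by rewrite mul1r ltrDl.
have hD : rnorm (D (u n) - D (u m)) <= 2 * delta.
  rewrite (le_trans (rnormB _ _))// mulr_natl mulr2n lerD//;
    by rewrite (le_trans (Dd _))// ler_piMr.
have hP : rnorm (P (u n) - P (u m)) < sigma / 2.
  rewrite !PE opprD addrACA (le_lt_trans (rnormD _ _))//.
  by move: hU' hD; rewrite /g; lra.
pose z := f (s n).
have zs : sigma <= cmod z by exact: (hf _ (hs n)).1.
have z0 : z != 0 by rewrite -cmod_gt0; exact: lt_le_trans zs.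
(* [b] lies in [K n]: its first part because [u n] is in [K n.+1], its second because [P] preserves
   [K m.+1], contained in [K n]. Then P (u n) - P (u m) equals z times u n minus an element of
   [K n], so it has norm at least sigma / 2. *)
pose b := (z *: u n - P (u n)) + P (u m).
have Kb : K n b.
  have comm v : P (poly_op (s n) v) = poly_op (s n) (P v) by exact: poly_op_comm.
  apply: (subspD (sK n)).
    have lS := (poly_op_bdd (s n)).1.
    change (poly_op (s n) (z *: u n - P (u n)) = 0).
    by rewrite (linB sT lS)// (linZ sT lS)// -comm; exact: Kn.
  apply: (Kmon m.+1 n) => //.
  change (poly_op (s m.+1) (P (u m)) = 0).
  by rewrite -(@poly_op_comm P)// (Km : poly_op (s m.+1) (u m) = 0) (lin0 sT lP).
have PE' : P (u n) - P (u m) = z *: (u n - z^-1 *: b).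
  rewrite scalerBr scalerA mulfV// scale1r /b opprD opprB addrA.
  by rewrite [_ *: _ + _]addrC subrK.
have := hn _ (subspZ (sK n) z^-1 Kb).
move: hP; rewrite PE' rnormZ => h1 h2.
have : sigma * 2^-1 <= cmod z * rnorm (u n - z^-1 *: b) by rewrite ler_pM// ltW.
by move=> h3; have := le_lt_trans h3 h1; rewrite ltxx.
Qed.

Section splitting.
Variable s : seq R[i].
Hypothesis hs : all (fun z => sigma <= cmod z) s.
Hypothesis hmax : forall z v, sigma <= cmod z -> poly_op (z :: s) v = 0 -> poly_op s v = 0.

Let S := poly_op s.
Let F : set V := [set v | S v = 0].
Let H : set V := range S.
Let bS : bdd_lin S := poly_op_bdd s.
Let lS := bS.1.

(** Maximality removes the factors of [t] one by one. For [t] = [s] it says that S^2 and S have the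
    same kernel, the condition for kernel and range to be complementary. *)
Let ker_stable t v : all (fun z => sigma <= cmod z) t -> poly_op t (S v) = 0 -> S v = 0.
Proof.
elim: t v => [//|z t ih] v /= /andP[zs ts] h.
apply: ih => //; rewrite /S -poly_op_commute; apply: (hmax zs).
by rewrite poly_op_cons poly_op_commute.
Qed.

Let sF : linear_subspace F.
Proof.
split; first exact: (lin0 sT lS).
by move=> a u v Fu Fv; rewrite /F /= lS// Fu Fv scaler0 addr0.
Qed.

Let sH : linear_subspace H.
Proof.
split; first by exists 0 => //; exact: (lin0 sT lS).
by move=> a _ _ [u _ <-] [v _ <-]; exists (a *: u + v) => //; rewrite lS.
Qed.

Let FH0 v : F v -> H v -> v = 0.
Proof. by move=> Fv [u _ uv]; rewrite -uv; apply: (ker_stable hs); rewrite uv. Qed.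

Let closedH : closed H.
Proof. by have [B [U' [iB fU' SE]]] := poly_op_fredholm hs; exact: fredholm_closed_range SE. Qed.

Let finF : finite_dimensional F.
Proof. by have [B [U' [iB fU' SE]]] := poly_op_fredholm hs; exact: fredholm_ker_finite SE. Qed.

Let sumFH v : exists f h, [/\ F f, H h & v = f + h].
Proof.
have [B [U' [iB fU' SE]]] := poly_op_fredholm hs.
have [|f [u [Sf ->]]] := fredholm_ker_range iB fU' SE _ v; first by move=> w; exact: ker_stable.
by exists f, (S u); split => //; exists u.
Qed.

Let stable_comm (Q : V -> V) : linear_on [set: V] Q -> (forall v, Q (P v) = P (Q v)) ->
  stable_under Q F /\ stable_under Q H.
Proof.
move=> lQ QP; split.
  by move=> v Fv; rewrite /F /= /S -(poly_op_comm _ _ lQ QP) (Fv : poly_op s v = 0) (lin0 sT lQ).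
by move=> _ [u _ <-]; exists (Q u) => //; rewrite /S -(poly_op_comm _ _ lQ QP).
Qed.

Let PH : stable_under P H. Proof. by have [] := stable_comm lP (fun=> erefl). Qed.

(** On an eigenvector the polynomial acts as the scalar product of the y - z, y in [s]; it vanishes
    only if [z] is one of the roots, all of modulus at least [sigma]. *)
Let eigenF z v : F v -> v != 0 -> P v = z *: v -> sigma <= cmod z.
Proof.
move=> Fv v0 Pv.
have SE t : poly_op t v = (\prod_(y <- t) (y - z)) *: v.
  elim: t => [|y t ih]; first by rewrite big_nil scale1r.
  by rewrite poly_op_cons ih big_cons (linZ sT lP)// Pv !scalerA -scalerBl [_ * z]mulrC -mulrBl.
move: Fv; rewrite /F /= /S SE => /eqP; rewrite scaler_eq0 (negPf v0) orbF.
rewrite prodf_seq_eq0 => /hasP[y ys /=]; rewrite subr_eq0 => /eqP <-.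
exact: (allP hs).
Qed.

Let projection : exists Pi : V -> V, [/\ bdd_lin Pi, finrank Pi, forall v, F (Pi v),
  (forall v, H (v - Pi v)) & forall v, H v -> Pi v = 0].
Proof.
have [n [e Fe]] := finF.
have [K K0 hK] := proj_bound sF Fe sH closedH FH0.
have ex v : exists f, F f /\ H (v - f).
  have [f [h [Ff Hh ->]]] := sumFH v; exists f; split => //.
  by rewrite addrAC subrr add0r.
have [Pi hPi] := choice ex.
have uniq v f : F f -> H (v - f) -> Pi v = f.
  move=> Ff Hf; have [Fp Hp] := hPi v; apply/eqP; rewrite -subr_eq0; apply/eqP/FH0.
    exact: (subspB sF).
  have -> : Pi v - f = (v - f) - (v - Pi v) by rewrite opprB [RHS]addrC subrKA.
  exact: (subspB sH).
have bPi : bdd_lin Pi.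
  split.
    move=> a u v _ _; apply: uniq.
      by apply: sF.2; exact: (hPi _).1.
    rewrite opprD addrACA -scalerBr; apply: sH.2; exact: (hPi _).2.
  exists K => v _; have [Fp Hp] := hPi v.
  by have := hK _ _ Fp Hp; rewrite addrC subrK.
exists Pi; split => //.
- by apply: (finrank_of_range (e := e)) => // _ [v _ <-]; apply: Fe; exact: (hPi v).1.
- by move=> v; exact: (hPi v).1.
- by move=> v; exact: (hPi v).2.
- by move=> v Hv; apply: uniq; [exact: (subsp0 sF)|rewrite subr0].
Qed.

Let injH z v : sigma <= cmod z -> H v -> z *: v - P v = 0 -> v = 0.
Proof.
move=> zs [u _ <-] h; apply: (hmax zs); exact: h.
Qed.

(** Inversion on [H] is deduced from inversion on the whole space: [T] replaces [P] by its composite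
    with the projection on [H], a finite-rank change. A kernel vector of [T] lies in [H], where
    [injH] applies, so the Fredholm alternative inverts [T]. *)
Let resolventH z : sigma <= cmod z -> resolvent_set_on H P z.
Proof.
move=> zs; have z0 : z != 0 by rewrite -cmod_gt0; exact: lt_le_trans zs.
have [Pi [bPi fPi FPi HPi PiH]] := projection.
pose T v := z *: v - P (v - Pi v).
have fPP : finrank (fun v => P (Pi v)) by exact: finrank_compl.
have TE v : T v = (z *: v - D v) + (P (Pi v) - U v).
  by rewrite /T (linB sT lP)// opprB [P v]PE opprD -[RHS]addrA; congr (_ + _); rewrite addrCA.
have HT w v : H w -> T v = w -> H v.
  move=> Hw E; have : H (z *: v).
    have -> : z *: v = w + P (v - Pi v) by rewrite -E /T subrK.
    by apply: (subspD sH) => //; apply: PH; exact: HPi.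
  by move=> /(subspZ sH z^-1); rewrite scalerA mulVf// scale1r.
have TH v : H v -> T v = z *: v - P v by move=> Hv; rewrite /T PiH// subr0.
have [|X [bX XT TX]] := fredholm_inverse (D_inv zs) (finrankB fPP fU) TE.
  move=> v Tv; have Hv := HT 0 v (subsp0 sH) Tv.
  by apply: (injH zs) => //; rewrite -TH.
have HX : stable_under X H by move=> w Hw; apply: (HT w) => //; exact: TX.
exists X; split => //.
- by move=> a u v _ _; rewrite bX.1.
- by have [M hM] := bX.2; exists M => v _; exact: hM.
- by move=> v Hv; rewrite -TH.
- by move=> v Hv; rewrite -TH ?TX//; exact: HX.
Qed.

Variables (Q : V -> V) (N : nat) (rho : R).
Hypotheses (bQ : bdd_lin Q) (N0 : (0 < N)%N) (rho0 : 0 < rho).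
Hypotheses (QN : forall v, iter N Q v = P v) (sigmaE : sigma = rho ^+ N).

Let lQ := bQ.1.
Let QP v : Q (P v) = P (Q v). Proof. by rewrite -!QN -iterS iterSr. Qed.
Let QF : stable_under Q F. Proof. by have [] := stable_comm lQ QP. Qed.
Let QH : stable_under Q H. Proof. by have [] := stable_comm lQ QP. Qed.

(** z^N - Q^N factors as z - Q times the geometric sum [G N], so the inverse for P = Q^N at z^N,
    composed with [G N], inverts z - Q. *)
Let resolventQ z : rho <= cmod z -> resolvent_set_on H Q z.
Proof.
move=> zr; have zs : sigma <= cmod (z ^+ N).
  by rewrite sigmaE cmodX lerXn2r// nnegrE ?cmod_ge0// ltW.
have [X [HX lX bX XP PX]] := resolventH zs.
pose G n v := \sum_(k < n) z ^+ (n - k.+1) *: iter k Q v.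
have GS n v : G n.+1 v = z *: G n v + iter n Q v.
  rewrite /G big_ord_recr/= subnn expr0 scale1r; congr (_ + _).
  rewrite scaler_sumr; apply: eq_bigr => k _; rewrite scalerA -exprS.
  by rewrite subSS -subnSK.
have bG n : bdd_lin (G n).
  elim: n => [|n ih].
    rewrite (_ : G 0%N = fun=> 0); first exact: finrank_bdd finrank0.
    by apply/funext => v; rewrite /G big_ord0.
  rewrite (_ : G n.+1 = fun v => z *: G n v + iter n Q v); last exact/funext.
  by apply: bdd_linD; [exact: bdd_linZ|exact: bdd_lin_iter].
have HG n : stable_under (G n) H.
  move=> v Hv; apply: (subsp_sum sH) => k _; apply: (subspZ sH); exact: iter_stable.
have QG n v : Q (G n v) = G n (Q v).
  elim: n => [|n ih]; first by rewrite /G !big_ord0 (lin0 sT lQ).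
  by rewrite !GS (linD lQ)// (linZ sT lQ)// ih -iterS -iterSr.
have tele n v : z *: G n v - Q (G n v) = z ^+ n *: v - iter n Q v.
  elim: n => [|n ih].
    by rewrite /G big_ord0 (lin0 sT lQ) scaler0 expr0 scale1r !subrr.
  rewrite {1}GS scalerDr {1}GS (linD lQ)// (linZ sT lQ)// opprD addrACA -scalerBr ih.
  by rewrite scalerBr scalerA -exprS -iterS addrA subrK.
have teleN v : z *: G N v - Q (G N v) = z ^+ N *: v - P v by rewrite tele QN.
have GQ v : G N (z *: v - Q v) = z ^+ N *: v - P v.
  by rewrite (linB sT (bG N).1)// (linZ sT (bG N).1)// -QG.
exists (fun v => X (G N v)); split.
- by move=> v Hv; apply: HX; exact: HG.
- by move=> a u v Hu Hv; rewrite (bG N).1// lX//; exact: HG.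
- have [M M0 hM] := bounded_onP bX; have [L hL] := (bG N).2.
  exists (M * L) => v Hv; rewrite (le_trans (hM _ _))//; first exact: HG.
  by rewrite -mulrA ler_wpM2l ?hL// ltW.
- by move=> v Hv; rewrite GQ XP.
- move=> v Hv; set y := X (G N v).
  have Hy : H y by apply: HX; exact: HG.
  have HGv : H (G N v) by exact: HG.
  have Hzy : H (z *: y - Q y) by apply: (subspB sH); [exact: (subspZ sH)|exact: QH].
  (* Both sides are written as images by [X], which avoids showing that [X] commutes with [Q]. *)
  rewrite -[LHS](XP _ Hzy) -[RHS](XP _ Hv); congr X.
  have yE : z ^+ N *: y - P y = G N v by exact: PX.
  rewrite -[RHS]teleN -yE (linB sT lP)// (linZ sT lP)// (linB sT lQ)// (linZ sT lQ)//.
  rewrite QP !scalerBr !scalerA [z ^+ N * z]mulrC !opprB addrACA [RHS]addrACA.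
  by congr (_ + _); exact: addrC.
Qed.

(** [F] and [H] come from a polynomial in Q^N, which commutes with [Q]; hence they are invariant
    under [Q] itself, and moduli pass from P to [Q] by taking N-th powers. *)
Lemma splitting0 : exists F H, quasicompact_splitting Q rho F H.
Proof.
exists F, H; split => //.
- split => //; split; first exact: sumFH.
  apply/seteqP; split=> v; first by move=> [Fv Hv]; exact: FH0.
  by move=> ->; split; [exact: (subsp0 sF)|exact: (subsp0 sH)].
- split => //; apply: spectral_radius_on_lt => //; first by move=> a u v _ _; exact: lQ.
  by have [M hM] := bQ.2; exists M => v _; exact: hM.
- move=> z v Fv v0 Qv.
  have iterE n : iter n Q v = z ^+ n *: v.
    elim: n => [|n ih]; first by rewrite expr0 scale1r.
    by rewrite iterS ih (linZ sT lQ)// Qv scalerA -exprSr.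
  have : sigma <= cmod (z ^+ N) by apply: (eigenF Fv v0); rewrite -QN.
  rewrite sigmaE cmodX; rewrite ler_pXn2r// nnegrE ?cmod_ge0// ltW//.
Qed.

End splitting.

End quasicompact.

Theorem quasicompact_splitting_exists {R : realType} {V : normedModType R[i]}
    (Q D U : V -> V) (N : nat) (delta rho : R) :
  seq_complete V -> bdd_lin Q -> (0 < N)%N -> 0 < rho -> bdd_lin D -> finrank U ->
  (forall v, iter N Q v = D v + U v) ->
  0 <= delta -> (forall v, rnorm (D v) <= delta * rnorm v) -> 4 * delta < rho ^+ N ->
  exists F H, quasicompact_splitting Q rho F H.
Proof.
move=> cV bQ N0 r0 bD fU QE d0 Dd ds.
have [s hs hmax] := poly_op_maximal_ker bD fU QE d0 Dd ds.
exact: (splitting0 cV bD fU QE d0 Dd ds hs hmax bQ N0 r0).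
Qed.

(** * Kernel operators *)

Section bounded_real.
Context {d : measure_display} {E : measurableType d} {R : realType}.
Implicit Types (g h : E -> R) (f : bmfun E R) (K L T : R.-fker E ~> E).

Definition bmreal g := measurable_fun [set: E] g /\ exists M : R, forall y, `|g y| <= M.

Lemma bmreal_cst (c : R) : bmreal (fun=> c).
Proof. by split; [exact: measurable_cst|exists `|c|]. Qed.

Lemma bmrealD g h : bmreal g -> bmreal h -> bmreal (fun y => g y + h y).
Proof.
move=> [mg [M gM]] [mh [N hN]]; split; first exact: measurable_funD.
by exists (M + N) => y; rewrite (le_trans (ler_normD _ _))// lerD.
Qed.

Lemma bmrealM g h : bmreal g -> bmreal h -> bmreal (fun y => g y * h y).
Proof.
move=> [mg [M gM]] [mh [N hN]]; split; first exact: measurable_funM.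
by exists (M * N) => y; rewrite normrM ler_pM.
Qed.

Lemma bmrealZ (c : R) g : bmreal g -> bmreal (fun y => c * g y).
Proof. by apply: bmrealM; exact: bmreal_cst. Qed.

Lemma bmrealN g : bmreal g -> bmreal (fun y => - g y).
Proof.
move=> [mg [M gM]]; split; first exact: measurableT_comp.
by exists M => y; rewrite normrN.
Qed.

Lemma bmrealB g h : bmreal g -> bmreal h -> bmreal (fun y => g y - h y).
Proof. by move=> bg /bmrealN; exact: bmrealD. Qed.

Lemma bmreal_norm g : bmreal g -> bmreal (fun y => `|g y|).
Proof.
move=> [mg [M gM]]; split; first exact: measurableT_comp.
by exists M => y; rewrite normr_id.
Qed.

Lemma bmreal_indic (A : set E) : measurable A -> bmreal (\1_A : E -> R).
Proof.
move=> mA; split; first exact: measurable_indic.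
by exists 1 => y; rewrite indicE; case: (_ \in _) => /=; rewrite ?normr1 ?normr0.
Qed.

Definition bmcomplex_subproof (g h : E -> R) : bmreal g -> bmreal h ->
  (fun y => g y +i* h y) \in @bmfun_pred _ E R.
Proof.
move=> [mg [M gM]] [mh [N hN]]; apply/bmfunP; split => //.
exists (M + N) => y; rewrite -cmodC lecR.
by rewrite (le_trans (cmod_le_ReIm _))//= lerD.
Qed.

Lemma bmreal_Re f : bmreal (fun y => complex.Re (f y)).
Proof.
have [mr _ [M fM]] := bmfun_boundedP f; split => //; exists M => y.
by rewrite (le_trans (cmod_Re _))// -lecR cmodC.
Qed.

Lemma bmreal_Im f : bmreal (fun y => complex.Im (f y)).
Proof.
have [_ mi [M fM]] := bmfun_boundedP f; split => //; exists M => y.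
by rewrite (le_trans (cmod_Im _))// -lecR cmodC.
Qed.

Lemma cmodE (z : R[i]) : cmod z = Num.sqrt (complex.Re z ^+ 2 + complex.Im z ^+ 2).
Proof. by rewrite /cmod normc_def. Qed.

Lemma rnorm_ub f y : cmod (f y) <= rnorm f.
Proof. by rewrite -lecR cmodC; exact: supnorm_ub. Qed.

Lemma rnorm_le f (M : R) : (forall y, cmod (f y) <= M) -> rnorm f <= M.
Proof. by move=> h; apply: supnorm_le => y; rewrite -cmodC lecR. Qed.

Lemma bmreal_cmod f : bmreal (fun y => cmod (f y)).
Proof.
split; last by exists (rnorm f) => y; rewrite ger0_norm ?cmod_ge0// rnorm_ub.
rewrite (_ : (fun y => _) = (fun y => Num.sqrt (complex.Re (f y) ^+ 2 + complex.Im (f y) ^+ 2))).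
  apply: (@measurableT_comp _ _ _ _ _ _ (@Num.sqrt R)).
    by apply: continuous_measurable_fun => x; exact: sqrt_continuous.
  apply: measurable_funD; apply: measurable_funX.
    exact: (bmreal_Re f).1.
  exact: (bmreal_Im f).1.
by apply/funext => y; rewrite cmodE.
Qed.

Lemma bmfun_complete : seq_complete (bmfun E R).
Proof.
move=> u hu.
have pt (y : E) : exists l : R[i], forall e, 0 < e -> exists N, forall n, (N <= n)%N ->
    cmod (u n y - l) < e.
  apply: complex_cauchy => e /hu[N hN]; exists N => m n Nm Nn.
  exact: le_lt_trans (rnorm_ub (u m - u n) y) (hN _ _ Nm Nn).
have [l hl] := choice pt.
have unif (e : R) : 0 < e -> exists N, forall n, (N <= n)%N -> forall y, cmod (u n y - l y) <= e.
  move=> e0; have e2 : 0 < e / 2 by rewrite divr_gt0.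
  have [N hN] := hu _ e2; exists N => n Nn y.
  have [N' hN'] := hl y _ e2.
  have h1 := hN' _ (leq_maxr N N').
  have h2 := hN _ _ Nn (leq_maxl N N').
  have h3 := rnorm_ub (u n - u (maxn N N')) y.
  have -> : u n y - l y = (u n y - u (maxn N N') y) + (u (maxn N N') y - l y).
    by rewrite subrKA.
  rewrite (le_trans (cmodD _ _))// (splitr e) lerD ?(ltW h1)//.
  exact: le_trans h3 (ltW h2).
have lm : l \in @bmfun_pred _ E R.
  apply/bmfunP; split.
  - apply: (measurable_fun_cvg (h := fun n y => complex.Re (u n y))).
      by move=> n; exact: (bmreal_Re (u n)).1.
    move=> y _; apply/cvgrPdist_lt => e /(hl y)[N hN]; exists N => // n /= Nn.
    rewrite distrC -raddfB; exact: le_lt_trans (cmod_Re _) (hN _ Nn).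
  - apply: (measurable_fun_cvg (h := fun n y => complex.Im (u n y))).
      by move=> n; exact: (bmreal_Im (u n)).1.
    move=> y _; apply/cvgrPdist_lt => e /(hl y)[N hN]; exists N => // n /= Nn.
    rewrite distrC -raddfB; exact: le_lt_trans (cmod_Im _) (hN _ Nn).
  - have [N hN] := unif 1 ltr01; exists (1 + rnorm (u N)) => y.
    rewrite -cmodC lecR.
    have -> : l y = - (u N y - l y) + u N y by rewrite opprB subrK.
    by rewrite (le_trans (cmodD _ _))// cmodN lerD ?hN ?rnorm_ub.
exists (Bmfun lm) => e e0; have e2 : 0 < e / 2 by rewrite divr_gt0.
have [N hN] := unif _ e2; exists N => n Nn.
have : rnorm (u n - Bmfun lm) <= e / 2 by apply: rnorm_le => y; exact: hN.
by move=> /le_lt_trans; apply; rewrite ltr_pdivrMr// ltr_pMr// ltr1n.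
Qed.

End bounded_real.

Section finite_measure_integral.
Context {d : measure_display} {E : measurableType d} {R : realType}.
Implicit Types (g h : E -> R).
Variable mu : {measure set E -> \bar R}.
Hypothesis mufin : (mu [set: E] < +oo)%E.

Lemma bmreal_integrable g : bmreal g -> mu.-integrable [set: E] (EFin \o g).
Proof.
move=> [mg [M gM]]; apply: measurable_bounded_integrable => //.
exists M; split; first exact: num_real.
by move=> t Mt y _ /=; exact: le_trans (gM y) (ltW Mt).
Qed.

Lemma bmreal_RintegralD g h : bmreal g -> bmreal h ->
  \int[mu]_y (g y + h y) = \int[mu]_y g y + \int[mu]_y h y.
Proof. by move=> bg bh; apply: RintegralD => //; exact: bmreal_integrable. Qed.

Lemma bmreal_RintegralB g h : bmreal g -> bmreal h ->
  \int[mu]_y (g y - h y) = \int[mu]_y g y - \int[mu]_y h y.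
Proof. by move=> bg bh; apply: RintegralB => //; exact: bmreal_integrable. Qed.

Lemma bmreal_RintegralZ (c : R) g : bmreal g ->
  \int[mu]_y (c * g y) = c * \int[mu]_y g y.
Proof. by move=> bg; apply: RintegralZl => //; exact: bmreal_integrable. Qed.

Lemma bmreal_le_Rintegral g h : bmreal g -> bmreal h -> (forall y, g y <= h y) ->
  \int[mu]_y g y <= \int[mu]_y h y.
Proof. by move=> bg bh gh; apply: le_Rintegral => //; exact: bmreal_integrable. Qed.

Lemma bmreal_integral_fin g : bmreal g -> (\int[mu]_y (g y)%:E)%E \is a fin_num.
Proof. by move=> bg; apply: integrable_fin_num => //; exact: bmreal_integrable. Qed.

Lemma bmreal_RintegralE g : bmreal g ->
  (\int[mu]_y g y)%:E = (\int[mu]_y (g y)%:E)%E.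
Proof. by move=> bg; rewrite /Rintegral fineK//; exact: bmreal_integral_fin. Qed.

End finite_measure_integral.

Section kernel_integral.
Context {d : measure_display} {E : measurableType d} {R : realType}.
Implicit Types (g h : E -> R) (f : bmfun E R) (K L T : R.-fker E ~> E) (x : E).

Lemma kernel_setT_fin K x : (K x [set: E] < +oo)%E.
Proof. by have [r Kr] := measure_uub K; rewrite (lt_trans (Kr x))// ltry. Qed.

Lemma kernel_fin K x A : measurable A -> K x A \is a fin_num.
Proof.
move=> mA; rewrite ge0_fin_numE//; apply: le_lt_trans (kernel_setT_fin K x).
by apply: le_measure; rewrite ?inE.
Qed.

Definition kint K g x : R := \int[K x]_y g y.

Lemma kop_E K f x : kop K f x =
  kint K (fun y => complex.Re (f y)) x +i* kint K (fun y => complex.Im (f y)) x.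
Proof. by []. Qed.

Lemma kint_bmreal K g : bmreal g -> bmreal (kint K g).
Proof.
move=> bg; have := bmreal_Re (kop K (Bmfun (bmcomplex_subproof bg (bmreal_cst 0)))).
by [].
Qed.

Lemma kintD K g h x : bmreal g -> bmreal h ->
  kint K (fun y => g y + h y) x = kint K g x + kint K h x.
Proof. by move=> bg bh; apply: bmreal_RintegralD => //; exact: kernel_setT_fin. Qed.

Lemma kintB K g h x : bmreal g -> bmreal h ->
  kint K (fun y => g y - h y) x = kint K g x - kint K h x.
Proof. by move=> bg bh; apply: bmreal_RintegralB => //; exact: kernel_setT_fin. Qed.

Lemma kintZ K (c : R) g x : bmreal g -> kint K (fun y => c * g y) x = c * kint K g x.
Proof. by move=> bg; apply: bmreal_RintegralZ => //; exact: kernel_setT_fin. Qed.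

Lemma kint_le K g h x : bmreal g -> bmreal h -> (forall y, g y <= h y) ->
  kint K g x <= kint K h x.
Proof. by move=> bg bh; apply: bmreal_le_Rintegral => //; exact: kernel_setT_fin. Qed.

Lemma kint_ge0 K g x : (forall y, 0 <= g y) -> 0 <= kint K g x.
Proof. by move=> g0; apply: Rintegral_ge0. Qed.

Lemma kint_cst K (c : R) x : kint K (fun=> c) x = c * fine (K x [set: E]).
Proof. by rewrite /kint Rintegral_cst. Qed.

Lemma kint_indic K A x : measurable A -> kint K (\1_A) x = fine (K x A).
Proof. by move=> mA; rewrite /kint /Rintegral integral_indic// setIT. Qed.

Lemma kint_kid g x : bmreal g -> kint kid g x = g x.
Proof.
move=> [mg _]; rewrite /kint /Rintegral integral_dirac//; first by rewrite diracT mul1e.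
exact/measurable_EFinP.
Qed.

Lemma kint_kle K T g x : kle T K -> bmreal g -> (forall y, 0 <= g y) ->
  kint T g x <= kint K g x.
Proof.
move=> TK bg g0.
rewrite -lee_fin !bmreal_RintegralE//; try exact: kernel_setT_fin.
apply: ge0_le_measure_integral => //; last by move: bg => [mg _]; exact/measurable_EFinP.
by move=> S mS; exact: TK.
Qed.

Let kint_kmul_ge0 K L g x : bmreal g -> (forall y, 0 <= g y) ->
  kint (kmul K L) g x = kint K (kint L g) x.
Proof.
move=> bg g0; rewrite /kint /Rintegral; congr fine.
transitivity (\int[K x]_y (\int[ksnd L (x, y)]_z (g z)%:E))%E.
  apply: (integral_kcomp K (ksnd L) x (f := fun y => (g y)%:E)) => [y|].
    by rewrite lee_fin.
  by move: bg => [mg _]; exact/measurable_EFinP.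
by apply: eq_integral => y _; rewrite -bmreal_RintegralE//; exact: kernel_setT_fin.
Qed.

Lemma kint_kmul K L g x : bmreal g -> kint (kmul K L) g x = kint K (kint L g) x.
Proof.
move=> bg; have [M gM] := bg.2.
have bM := @bmreal_cst _ E R M.
have bgM := bmrealD bg bM.
(* The composition formula is first known for nonnegative functions; a bounded [g] is shifted by its
   bound. *)
have e : g = fun y => (g y + M) - M by apply/funext => y; rewrite addrK.
have gM0 y : 0 <= g y + M by have := gM y; rewrite ler_norml => /andP[+ _]; lra.
have M0 (y : E) : 0 <= M by exact: le_trans (normr_ge0 _) (gM y).
rewrite {1}e kintB// kint_kmul_ge0// [X in _ - X]kint_kmul_ge0//.
rewrite -kintB; [|exact: kint_bmreal|exact: kint_bmreal].
congr (kint K _ x); apply/funext => y; rewrite -kintB//.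
by congr (kint L _ y); apply/funext => z; rewrite addrK.
Qed.

(** The difference of the kernels is handled as the positive functional [Lam], with no need to
    construct a difference of measures. The modulus of its value is a real part after a rotation,
    and Re (u f) <= |f| when |u| = 1. *)
Lemma kint_abs_diff K T f x : kle T K ->
  cmod (kop K f x - kop T f x) <=
    kint K (fun y => cmod (f y)) x - kint T (fun y => cmod (f y)) x.
Proof.
move=> TK.
have bre := bmreal_Re f; have bim := bmreal_Im f; have babs := bmreal_cmod f.
pose Lam g := kint K g x - kint T g x.
have LamZ c g : bmreal g -> Lam (fun y => c * g y) = c * Lam g.
  by move=> bg; rewrite /Lam !kintZ// mulrBr.
have LamB g h : bmreal g -> bmreal h -> Lam (fun y => g y - h y) = Lam g - Lam h.
  by move=> bg bh; rewrite /Lam !kintB//; ring.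
have Lam_le g h : bmreal g -> bmreal h -> (forall y, g y <= h y) -> Lam g <= Lam h.
  move=> bg bh gh; rewrite -subr_ge0 -LamB//; rewrite /Lam subr_ge0.
  apply: kint_kle => //; first exact: bmrealB.
  by move=> y; rewrite subr_ge0.
have LamR : Lam (fun y => complex.Re (f y)) = complex.Re (kop K f x - kop T f x) by [].
have LamI : Lam (fun y => complex.Im (f y)) = complex.Im (kop K f x - kop T f x) by [].
rewrite -/(Lam _); set z := _ - _ in LamR LamI *.
have [->|z0] := eqVneq z 0.
  rewrite cmod0 subr_ge0; apply: kint_kle => // y; exact: cmod_ge0.
have zn0 : `|z| != 0 by rewrite normr_eq0.
(* The unimodular factor that turns [z] onto the positive half-line. *)
pose u := `|z| / z.
have u1 : cmod u = 1.
  rewrite cmodM cmodV; have -> : cmod `|z| = cmod z by rewrite /cmod normr_id.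
  by rewrite divff// gt_eqF// cmod_gt0.
have uz : u * z = (cmod z)%:C by rewrite /u divfK// cmodC.
have ReM (a b : R[i]) : complex.Re (a * b) =
    complex.Re a * complex.Re b - complex.Im a * complex.Im b by case: a b => [? ?] [? ?].
have -> : cmod z = complex.Re (u * z) by rewrite uz.
rewrite ReM -LamR -LamI -!LamZ// -LamB; [|exact: bmrealZ|exact: bmrealZ].
apply: Lam_le => //; first by apply: bmrealB; exact: bmrealZ.
move=> y; rewrite -ReM -[leRHS]mul1r -u1 -cmodM.
exact: le_trans (ler_norm _) (cmod_Re _).
Qed.

Lemma kint_abs K f x : cmod (kop K f x) <= kint K (fun y => cmod (f y)) x.
Proof.
pose Z : R.-fker E ~> E := @kzero d d E E R.
have ZK : kle Z K by move=> y A mA; rewrite [Z y A](_ : _ = 0%E)// measure_ge0.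
have Z0 g y : kint Z g y = 0 by rewrite /kint /Rintegral integral_measure_zero.
have := kint_abs_diff f x ZK; rewrite Z0 subr0; apply: le_trans.
rewrite [kop Z f x]kop_E !Z0 (_ : 0 +i* 0 = 0 :> R[i])// subr0//.
Qed.

Lemma kop_linear K : linear_on [set: bmfun E R] (kop K).
Proof.
move=> a f g _ _; apply/val_inj/funext => x /=.
have bre := bmreal_Re f; have bim := bmreal_Im f.
have bre' := bmreal_Re g; have bim' := bmreal_Im g.
rewrite !fctE.
change (kop K (a *: f + g) x = a * kop K f x + kop K g x).
rewrite !kop_E.
have -> : (fun y => complex.Re ((a *: f + g) y)) = (fun y =>
   (complex.Re a * complex.Re (f y) - complex.Im a * complex.Im (f y)) + complex.Re (g y)).
  apply/funext => y; change ((a *: f + g) y) with (a * f y + g y).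
  by case: a (f y) (g y) => [? ?] [? ?] [? ?].
have -> : (fun y => complex.Im ((a *: f + g) y)) = (fun y =>
   (complex.Re a * complex.Im (f y) + complex.Im a * complex.Re (f y)) + complex.Im (g y)).
  apply/funext => y; change ((a *: f + g) y) with (a * f y + g y).
  by case: a (f y) (g y) => [? ?] [? ?] [? ?].
have b1 := bmrealZ (complex.Re a) bre; have b2 := bmrealZ (complex.Im a) bim.
have b3 := bmrealZ (complex.Re a) bim; have b4 := bmrealZ (complex.Im a) bre.
rewrite (kintD _ _ (bmrealB b1 b2) bre') (kintD _ _ (bmrealD b3 b4) bim').
rewrite (kintB _ _ b1 b2) (kintD _ _ b3 b4) !kintZ//.
by case: a {b1 b2 b3 b4}.
Qed.

Lemma kop_bdd_lin K : bdd_lin (kop K).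
Proof.
split; first exact: kop_linear.
have [r Kr] := measure_uub K; exists r => f _; apply: rnorm_le => x.
apply: le_trans (kint_abs K f x) _.
rewrite (@le_trans _ _ (kint K (fun=> rnorm f) x))//.
  apply: kint_le; [exact: bmreal_cmod|exact: bmreal_cst|exact: rnorm_ub].
rewrite kint_cst mulrC ler_wpM2r ?rnorm_ge0//.
by rewrite -lee_fin fineK ?kernel_fin// ltW.
Qed.

Lemma kop_kmul K L f : kop (kmul K L) f = kop K (kop L f).
Proof.
apply/val_inj/funext => x; change (kop (kmul K L) f x = kop K (kop L f) x).
rewrite !kop_E !kint_kmul//; [exact: bmreal_Im|exact: bmreal_Re].
Qed.

Lemma kop_kid f : kop kid f = f.
Proof.
apply/val_inj/funext => x; change (kop kid f x = f x).
rewrite kop_E !kint_kid; [|exact: bmreal_Im|exact: bmreal_Re].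
by case: (f x).
Qed.

Lemma kop_kpow K n f : kop (kpow K n) f = iter n (kop K) f.
Proof.
elim: n => [|n ih]; first exact: kop_kid.
by rewrite iterS -ih -kop_kmul.
Qed.

End kernel_integral.

Section operator_norm.
Context {R : realType} {V : normedModType R[i]}.
Implicit Types (T : V -> V).

Lemma opnorm_ub T v : bdd_lin T -> rnorm (T v) <= opnorm T * rnorm v.
Proof.
move=> [lT bT]; have [M M0 hM] := bounded_onP bT.
have hs : has_sup [set rnorm (T v) | v in [set v | rnorm v <= 1]].
  split; first by exists (rnorm (T 0)), 0 => //=; rewrite rnorm0.
  exists M => _ [w w1 <-]; rewrite (le_trans (hM _ _))//.
  by rewrite ler_piMr// ltW.
have [->|v0] := eqVneq v 0.
  by rewrite (lin0 linear_subspaceT lT) rnorm0 mulr0.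
have nv : 0 < rnorm v by rewrite rnorm_gt0.
rewrite -ler_pdivrMr//; apply: ub_le_sup; first exact: hs.2.
have c : cmod ((rnorm v)^-1%:C) = (rnorm v)^-1 by rewrite cmod_real gtr0_norm// invr_gt0.
exists ((rnorm v)^-1%:C *: v); first by rewrite /= rnormZ c mulVf// gt_eqF.
by rewrite (linZ linear_subspaceT lT)// rnormZ c mulrC.
Qed.

Lemma opnorm_le T (c : R) : (forall v, rnorm v <= 1 -> rnorm (T v) <= c) -> opnorm T <= c.
Proof.
move=> h; apply: ge_sup; first by exists (rnorm (T 0)), 0 => //=; rewrite rnorm0.
by move=> _ [v v1 <-]; exact: h.
Qed.

Lemma opnorm_ge0 T : bdd_lin T -> 0 <= opnorm T.
Proof.
move=> [lT bT]; have [M M0 hM] := bounded_onP bT.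
apply: le_trans (rnorm_ge0 (T 0)) _; apply: ub_le_sup.
  exists M => _ [w w1 <-]; rewrite (le_trans (hM _ _))//.
  by rewrite ler_piMr// ltW.
by exists 0 => //=; rewrite rnorm0.
Qed.

End operator_norm.

(** For a positive difference the constant function 1 realises the norm: positivity is applied to 1
    - |f|, which is nonnegative when |f| <= 1. *)
Lemma opnorm_kop_diff_le d (E : measurableType d) (R : realType)
    (K T : R.-fker E ~> E) (c : R) : kle T K ->
  (forall x, fine (K x [set: E]) - fine (T x [set: E]) <= c) ->
  opnorm (kop K \- kop T) <= c.
Proof.
move=> TK h; apply: opnorm_le => f f1; apply: rnorm_le => x.
apply: le_trans (kint_abs_diff f x TK) _; apply: le_trans (h x).
have bc := bmreal_cmod f; have b1 := @bmreal_cst _ E R 1.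
rewrite -[fine (K x _)]mul1r -[fine (T x _)]mul1r -!kint_cst.
have : kint T (fun y => 1 - cmod (f y)) x <= kint K (fun y => 1 - cmod (f y)) x.
  apply: kint_kle => //; first exact: bmrealB.
  by move=> y; rewrite subr_ge0; exact: le_trans (rnorm_ub f y) f1.
rewrite !kintB//; lra.
Qed.

(** * From a splitting to Delta *)

Section delta.
Context {d : measure_display} {E : measurableType d} {R : realType}.
Implicit Types (K : R.-fker E ~> E) (nu : probability E R).

Let sups nu K (eta : R) := ereal_sup [set r : \bar R | exists x A,
         [/\ measurable A, (nu A <= eta%:E)%E & r = K x A]].

Let sups_mono nu K (a b : R) : a <= b -> (sups nu K a <= sups nu K b)%E.
Proof.
move=> ab; apply: ge_ereal_sup => _ [x [A [mA nA ->]]].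
apply: ereal_sup_ubound; exists x, A; split => //.
by apply: le_trans nA _; rewrite lee_fin.
Qed.

(** The suprema are monotone in [eta], so the right limit at 0 is an infimum; in this form an upper
    bound needs only one [eta]. *)
Lemma DeltaE nu K :
  Delta nu K = ereal_inf (sups nu K @` [set` Interval (BRight 0) (BInfty R false)]).
Proof.
apply/cvg_lim => //; apply: nondecreasing_at_right_cvge => //.
by move=> a b _ _; exact: sups_mono.
Qed.

Lemma Delta_le nu K (c eta : R) : 0 < eta ->
  (forall x A, measurable A -> (nu A <= eta%:E)%E -> (K x A <= c%:E)%E) ->
  (Delta nu K <= c%:E)%E.
Proof.
move=> e0 h; rewrite DeltaE; apply: le_trans (ereal_inf_lbound _) _.
  by exists eta => //=; rewrite in_itv/= e0.
by apply: ge_ereal_sup => _ [x [A [mA nA ->]]]; exact: h.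
Qed.

Lemma Delta_lt nu K (c : R) : (Delta nu K < c%:E)%E ->
  exists2 eta : R, 0 < eta &
    forall x A, measurable A -> (nu A <= eta%:E)%E -> (K x A <= c%:E)%E.
Proof.
rewrite DeltaE => /ereal_inf_lt[_ [eta /= + <-]] h.
rewrite in_itv/= andbT => e0; exists eta => // x A mA nA.
apply: le_trans (ltW h); apply: ereal_sup_ubound; by exists x, A.
Qed.

Lemma Delta_ge0 nu K : (0 <= Delta nu K)%E.
Proof.
rewrite DeltaE; apply: le_ereal_inf_tmp => _ [eta /= + <-].
rewrite in_itv/= andbT => e0.
apply: (@le_trans _ _ (K point set0)); first by rewrite measure0.
by apply: ereal_sup_ubound; exists point, set0; split; rewrite ?measure0 ?lee_fin ?ltW.
Qed.

End delta.

Section dominating.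
Context {d : measure_display} {E : measurableType d} {R : realType}.

Lemma dominating_probability (K : R.-fker E ~> E) (xs : seq E) :
  exists (nu : probability E R) (c : R), 0 < c /\
    forall x A, x \in xs -> measurable A -> (K x A <= c%:E * nu A)%E.
Proof.
have [kap [kfin k1 hk]] : exists kap : {measure set E -> \bar R},
    [/\ (kap [set: E] < +oo)%E, (1 <= kap [set: E])%E &
    forall x A, x \in xs -> measurable A -> (K x A <= kap A)%E].
  elim: xs => [|y xs [kap [kfin k1 hk]]].
    (* Starting from a Dirac mass keeps the total mass at least 1, so the final normalisation cannot
       degenerate, even for an empty list. *)
    exists (@dirac _ E point R).
    have d1 : @dirac _ E point R [set: E] = 1%E by rewrite diracT.
    by split; [rewrite [X in (X < _)%E]d1 ltry|rewrite [X in (_ <= X)%E]d1|move=> x A; rewrite in_nil].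
  pose m : {measure set E -> \bar R} := measure_add (K y) kap.
  have mE A : m A = (K y A + kap A)%E by exact: measure_addE.
  exists m; split.
  - by rewrite mE lte_add_pinfty// kernel_setT_fin.
  - by rewrite mE (le_trans k1)// leeDr.
  - move=> x A; rewrite inE mE => /orP[/eqP-> mA|xs' mA]; first by rewrite leeDl.
    by rewrite (le_trans (hk _ _ xs' mA))// leeDr.
pose nu : probability E R := mnormalize kap (@dirac _ E point R).
have kf : kap [set: E] \is a fin_num by rewrite ge0_fin_numE.
exists nu, (fine (kap [set: E])); split.
  by rewrite -lte_fin fineK// (lt_le_trans _ k1)// lte_fin.
move=> x A xA mA; apply: le_trans (hk _ _ xA mA) _.
rewrite /nu /= /mnormalize fineK//.
have k0 : kap [set: E] != 0%E by rewrite gt_eqF// (lt_le_trans _ k1)// lte_fin.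
have ky : kap [set: E] != +oo%E by rewrite lt_eqF.
rewrite (negPf k0) (negPf ky)/= muleCA -[X in (_ * (X * _))%E]fineK// -EFinM.
rewrite divff ?mule1// fine_eq0//.
Qed.

(** Induction by elimination: pick [x] where some [e j] is nonzero and subtract the multiple of
    [e j] that agrees with [f] at [x]. This projection kills [e j], so the image is spanned by one
    vector fewer. *)
Lemma norming_points n (e : 'I_n -> bmfun E R) : exists (xs : seq E) (K : R), 0 <= K /\
  forall f c, lin_span e f -> 0 <= c -> (forall x, x \in xs -> cmod (f x) <= c) ->
  rnorm f <= K * c.
Proof.
elim: n e => [|n ih] e.
  by exists [::], 0; split => // f c [a _ <-] _ _; rewrite big_ord0 rnorm0 mul0r.
have [e0|/existsNP[j ej]] := pselect (forall j, e j = 0).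
  exists [::], 0; split => // f c [a _ <-] _ _.
  by rewrite big1 ?rnorm0 ?mul0r// => i _; rewrite e0 scaler0.
have [x ejx] : exists x, e j x != 0.
  apply: contrapT => h; apply: ej; apply: rnorm_le_eq0; apply: rnorm_le => y.
  have [->|h'] := eqVneq (e j y) 0; first by rewrite cmod0.
  by exfalso; apply: h; exists y.
pose L (f : bmfun E R) := f - (f x / e j x) *: e j.
have lL : linear_on [set: bmfun E R] L.
  move=> a f g _ _; rewrite /L.
  have -> : (a *: f + g) x = a * f x + g x by [].
  by rewrite mulrDl scalerDl -mulrA -scalerA opprD addrACA -scalerBr.
have [xs [K [K0 hK]]] := ih (fun i => L (e (lift j i))).
pose al := rnorm (e j) / cmod (e j x).
have ejx0 : 0 < cmod (e j x) by rewrite cmod_gt0.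
have al0 : 0 <= al by rewrite divr_ge0 ?rnorm_ge0// ltW.
exists (x :: xs), (al + K * (1 + al)); split.
  by rewrite addr_ge0// mulr_ge0// addr_ge0.
move=> f c [a _ fE] c0 hc.
have Lf : lin_span (fun i => L (e (lift j i))) (L f).
  exists (fun i => a (lift j i)) => //.
  rewrite -fE (lin_sum linear_subspaceT lL)// (bigD1_ord j)//=.
  rewrite (linZ linear_subspaceT lL)// {2}/L divff// scale1r subrr scaler0 add0r.
  by apply: eq_bigr => i _; rewrite (linZ linear_subspaceT lL).
have fx : cmod (f x / e j x) <= c / cmod (e j x).
  by rewrite cmodM cmodV ler_pM2r ?invr_gt0// hc// mem_head.
have h1 : cmod (f x / e j x) * rnorm (e j) <= al * c.
  rewrite (le_trans (ler_wpM2r (rnorm_ge0 _) fx))// /al le_eqVlt; apply/orP; left.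
  by apply/eqP; ring.
have h2 : rnorm (L f) <= K * ((1 + al) * c).
  apply: hK => //; first by rewrite mulr_ge0// addr_ge0.
  move=> y yxs; have -> : L f y = f y - (f x / e j x) * e j y by [].
  rewrite (le_trans (cmodD _ _))// cmodN cmodM mulrDl mul1r lerD//.
    by rewrite hc// inE yxs orbT.
  by apply: le_trans h1; rewrite ler_wpM2l ?cmod_ge0// rnorm_ub.
have -> : f = (f x / e j x) *: e j + L f by rewrite /L addrC subrK.
rewrite (le_trans (rnormD _ _))// rnormZ mulrDl -mulrA lerD//.
Qed.

End dominating.

Section upper_bound.
Context {d : measure_display} {E : measurableType d} {R : realType}.
Variables (Q : R.-fker E ~> E) (rho : R) (F H : set (bmfun E R)).
Hypotheses (sF : linear_subspace F) (sH : linear_subspace H) (FH : direct_sum F H).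
Hypotheses (QF : stable_under (kop Q) F) (QH : stable_under (kop Q) H).
Hypotheses (cH : closed H) (rH : spectral_radius_on H (kop Q) < rho).
Hypothesis (fF : finite_dimensional F).

(* On F the values at finitely many points x_i control the norm, so an iterate
   Q^l 1_A is controlled by the numbers Q^l(x_i, A) up to its small H-component. *)
Lemma splitting_Delta : exists (l : nat) (nu : probability E R),
  (1 <= l)%N /\ (Delta nu (kpow Q l) <= (rho ^+ l)%:E)%E.
Proof.
have rho0 : 0 < rho by apply: le_lt_trans rH; exact: spectral_radius_on_ge0.
have cV := @bmfun_complete d E R.
have lQ := kop_linear Q.
have [n [e Fe]] := fF.
have FH0 v : F v -> H v -> v = 0.
  by move=> Fv Hv; have : (F `&` H) v by []; rewrite FH.2.
have [K K0 hK] := proj_bound sF Fe sH cH FH0.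
have [C [th [th0 thr hC]]] : exists C th, [/\ 0 <= th, th < rho &
    forall n v, H v -> rnorm (iter n (kop Q) v) <= C * th ^+ n * rnorm v].
  apply: (gelfand sH cH cV) => //; first by move=> a u v _ _; exact: lQ.
  by have [_ [M hM]] := kop_bdd_lin Q; exists M => v _; exact: hM.
have [xs [K2 [K20 hK2]]] := norming_points e.
pose C' := `|C| * (1 + K).
have C'0 : 0 <= C' by rewrite mulr_ge0// addr_ge0.
pose c0 := K2 * C' + C'.
have c00 : 0 <= c0 by rewrite addr_ge0// mulr_ge0.
(* [c0] collects both contributions of the [H]-component, directly and through the values at the
   points; [l] makes them less than half of rho^l. It is fixed before [nu], which is built from
   Q^l. *)
have [l l1 hl] : exists2 l, (1 <= l)%N & c0 * th ^+ l < rho ^+ l / 2.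
  have q01 : 0 <= th / rho < 1 by rewrite divr_ge0 ?(ltW rho0)//= ltr_pdivrMr// mul1r.
  have [|N hN] := @geo_small R (th / rho) c0 2^-1 q01; first by rewrite invr_gt0.
  exists N.+1 => //; have := hN N.+1 (leqnSn N).
  move=> /(le_lt_trans (ler_norm _)); rewrite expr_div_n mulrA ltr_pdivrMr ?exprn_gt0//.
  by rewrite [2^-1 * _]mulrC.
have [nu [c [cc hnu]]] := dominating_probability (kpow Q l) xs.
exists l, nu; split => //.
have r0 : 0 < rho ^+ l by rewrite exprn_gt0.
(* Then nu(A) <= eta gives Q^l(x_i, A) <= c eta, and multiplication by [K2] still leaves at most the
   other half of rho^l. The + 1 covers [K2] = 0. *)
pose eta := rho ^+ l / 2 / (K2 + 1) / c.
have K21 : 0 < K2 + 1 by rewrite ltr_wpDl.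
have eta0 : 0 < eta by rewrite !divr_gt0.
apply: (Delta_le eta0) => x A mA nA.
have b1 := @bmreal_indic d E R A mA; have b0 := @bmreal_cst _ E R 0.
pose f1 : bmfun E R := Bmfun (bmcomplex_subproof b1 b0).
have f1E y : kop (kpow Q l) f1 y = (fine (kpow Q l y A))%:C.
  rewrite kop_E; congr Complex; first exact: kint_indic.
  by rewrite (kint_cst (kpow Q l) 0 y) mul0r.
have nf1 : rnorm f1 <= 1.
  apply: rnorm_le => y; have -> : f1 y = (\1_A y)%:C by [].
  by rewrite cmod_real indicE; case: (_ \in _) => /=; rewrite ?normr1 ?normr0.
have [f [h [Ff Hh fh]]] := FH.1 f1.
have nf : rnorm f <= K by rewrite (le_trans (hK _ _ Ff Hh))// -fh ler_piMr.
have nh : rnorm h <= 1 + K.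
  have -> : h = f1 - f by rewrite fh addrAC subrr add0r.
  by rewrite (le_trans (rnormB _ _))// lerD.
pose g := iter l (kop Q) f; pose k := iter l (kop Q) h.
have gk : kop (kpow Q l) f1 = g + k.
  by rewrite kop_kpow fh /g /k; have [li _] := bdd_lin_iter l (kop_bdd_lin Q); rewrite (linD li).
have nk : rnorm k <= C' * th ^+ l.
  have tl : 0 <= th ^+ l by rewrite exprn_ge0.
  rewrite (le_trans (hC _ _ Hh))//.
  rewrite (@le_trans _ _ (`|C| * th ^+ l * (1 + K)))//; last first.
    by rewrite /C' le_eqVlt; apply/orP; left; apply/eqP; ring.
  rewrite (@le_trans _ _ (`|C| * th ^+ l * rnorm h))//.
    by rewrite ler_wpM2r ?rnorm_ge0// ler_wpM2r// ler_norm.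
  by rewrite ler_wpM2l// mulr_ge0.
have Fg : F g by exact: iter_stable.
have small y : y \in xs -> cmod (g y) <= rho ^+ l / 2 / (K2 + 1) + C' * th ^+ l.
  move=> yxs.
  have -> : g y = kop (kpow Q l) f1 y - k y by rewrite gk -[(g + k) y]/(g y + k y) addrK.
  rewrite (le_trans (cmodD _ _))// cmodN lerD//; last exact: le_trans (rnorm_ub _ _) nk.
  rewrite f1E cmod_real ger0_norm ?fine_ge0// -lee_fin fineK ?kernel_fin//.
  rewrite (le_trans (hnu _ _ yxs mA))//.
  have := lee_wpmul2l (_ : 0 <= c%:E)%E nA; rewrite lee_fin => /(_ (ltW cc)).
  move=> /le_trans; apply; rewrite -EFinM lee_fin /eta mulrC divfK// gt_eqF//.
have ng : rnorm g <= K2 * (rho ^+ l / 2 / (K2 + 1) + C' * th ^+ l).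
  apply: hK2 => //; first exact: Fe.
  by apply: addr_ge0; [apply: divr_ge0; [apply: divr_ge0 => //; exact: ltW|exact: ltW]|by rewrite mulr_ge0// exprn_ge0].
rewrite -[kpow Q l x A]fineK ?kernel_fin// lee_fin.
have -> : fine (kpow Q l x A) = cmod (kop (kpow Q l) f1 x).
  by rewrite f1E cmod_real ger0_norm// fine_ge0.
rewrite gk (le_trans (rnorm_ub _ _))// (le_trans (rnormD _ _))//.
apply: le_trans (lerD ng nk) _.
have h1 : K2 * (rho ^+ l / 2 / (K2 + 1)) <= rho ^+ l / 2.
  rewrite mulrCA ler_piMr ?divr_ge0 ?(ltW r0)//.
  by rewrite ler_pdivrMr// mul1r lerDl.
have h2 : K2 * (rho ^+ l / 2 / (K2 + 1) + C' * th ^+ l) + C' * th ^+ l =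
  K2 * (rho ^+ l / 2 / (K2 + 1)) + c0 * th ^+ l by rewrite /c0; ring.
by rewrite h2 [leRHS](splitr (rho ^+ l)) lerD// ltW.
Qed.

End upper_bound.

(** * Differentiation of measures along a generating sequence *)

Section finite_measure.
Context {d : measure_display} {E : measurableType d} {R : realType}.
Variable mu : {measure set E -> \bar R}.
Hypothesis mufin : (mu [set: E] < +oo)%E.
Implicit Types (A B C D : set E).

Definition rmeas A : R := fine (mu A).

Lemma rmeasE A : measurable A -> (rmeas A)%:E = mu A.
Proof.
move=> mA; rewrite /rmeas fineK// ge0_fin_numE//.
by apply: le_lt_trans mufin; apply: le_measure; rewrite ?inE.
Qed.

Lemma rmeas_ge0 A : 0 <= rmeas A.
Proof. exact: fine_ge0. Qed.

Lemma rmeas_mono A B : measurable A -> measurable B -> A `<=` B -> rmeas A <= rmeas B.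
Proof.
by move=> mA mB AB; rewrite -lee_fin !rmeasE//; apply: le_measure; rewrite ?inE.
Qed.

Lemma rmeas_sub2 A B C : measurable A -> measurable B -> measurable C ->
  A `<=` B `|` C -> rmeas A <= rmeas B + rmeas C.
Proof.
move=> mA mB mC ABC; rewrite -lee_fin EFinD !rmeasE//.
apply: le_trans (_ : mu (B `|` C) <= _)%E; last exact: measureU2.
by apply: le_measure; rewrite ?inE//; exact: measurableU.
Qed.

Lemma rmeas_disjU A B : measurable A -> measurable B -> A `&` B = set0 ->
  rmeas (A `|` B) = rmeas A + rmeas B.
Proof.
move=> mA mB AB; apply: EFin_inj; rewrite EFinD !rmeasE ?measureU//.
exact: measurableU.
Qed.

Definition symdiff A B := (A `\` B) `|` (B `\` A).

Lemma measurable_symdiff A B : measurable A -> measurable B -> measurable (symdiff A B).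
Proof. by move=> mA mB; apply: measurableU; exact: measurableD. Qed.

Variable G : set (set E).
Hypotheses (GC : forall A, G A -> G (~` A)) (GU : forall A B, G A -> G B -> G (A `|` B))
  (G0 : G set0) (Gm : G `<=` measurable).

(** The sets approximable in symmetric difference by elements of the algebra form a sigma-algebra;
    continuity from below reduces countable unions to finite ones. *)
Lemma algebra_approximation D (e : R) : <<s G >> D -> 0 < e ->
  measurable D /\ exists2 B, G B & rmeas (symdiff D B) < e.
Proof.
pose S := [set D | measurable D /\ forall e : R, 0 < e ->
  exists2 B, G B & rmeas (symdiff D B) < e].
suff GS : <<s G >> `<=` S by move=> /GS[mD hD] e0; split => //; exact: hD.
have SU A B : S A -> S B -> S (A `|` B).
  move=> [mA hA] [mB hB]; split; first exact: measurableU.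
  move=> e' e0; have e2 : 0 < e' / 2 by rewrite divr_gt0.
  have [A' GA' hA'] := hA _ e2; have [B' GB' hB'] := hB _ e2.
  exists (A' `|` B'); first exact: GU.
  rewrite (splitr e'); apply: le_lt_trans (ltrD hA' hB').
  have mA' := Gm GA'; have mB' := Gm GB'.
  apply: rmeas_sub2; try (apply: measurable_symdiff => //; exact: measurableU).
  move=> x [[[]] ? /not_orP[? ?]|[[] ? /not_orP[? ?]]].
  - by left; left.
  - by right; left.
  - by left; right.
  - by right; right.
apply: smallest_sub; last first.
  move=> A GA; split; first exact: Gm.
  move=> e' e0; exists A => //.
  by rewrite /symdiff setDv setU0 /rmeas measure0.
split.
- split => // e' e0; exists set0 => //.
  by rewrite /symdiff setDv setU0 /rmeas measure0.
- move=> A [mA hA]; rewrite setTD; split; first exact: measurableC.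
  move=> e' /hA[B GB hB]; exists (~` B); first exact: GC.
  suff -> : symdiff (~` A) (~` B) = symdiff A B by [].
  by rewrite /symdiff !setDE !setCK [LHS]setUC [~` A `&` B]setIC [~` B `&` A]setIC.
- move=> F hF; have mF n : measurable (F n) by case: (hF n).
  have mUF : measurable (\bigcup_k F k) by exact: bigcup_measurable.
  split => // e' e0; have e2 : 0 < e' / 2 by rewrite divr_gt0.
  pose H n := \big[setU/set0]_(i < n) F i.
  have SH n : S (H n).
    rewrite /H; elim: n => [|n ih].
      rewrite big_ord0; split => // e1 e10; exists set0 => //.
      by rewrite /symdiff setDv setU0 /rmeas measure0.
    by rewrite big_ord_recr; exact: SU.
  have mH n : measurable (H n) by case: (SH n).
  have HF : \bigcup_n H n = \bigcup_k F k.
    apply/seteqP; split => x.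
      by move=> [n _]; rewrite /H -bigcup_mkord => -[i _ ?]; exists i.
    move=> [n _ Fx]; exists n.+1 => //; rewrite /H -bigcup_mkord.
    by exists n => /=.
  have ndH : nondecreasing_seq H.
    move=> m n mn; apply/subsetPset; rewrite /H -!bigcup_mkord => x [i /= im Fx].
    by exists i => //=; exact: leq_trans mn.
  have : mu \o H @ \oo --> mu (\bigcup_k F k).
    by rewrite -HF; apply: nondecreasing_cvg_mu => //; rewrite HF.
  rewrite -rmeasE// => /fine_cvgP[_ /cvgrPdist_lt/(_ _ e2)[N _ /(_ N (leqnn N))]].
  rewrite /= -/(rmeas (H N)) => hN.
  have HsubF : H N `<=` \bigcup_k F k by rewrite -HF => x Hx; exists N.
  have dN : rmeas ((\bigcup_k F k) `\` H N) < e' / 2.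
    apply: le_lt_trans hN; apply: le_trans (ler_norm _).
    rewrite lerBrDr -rmeas_disjU//; last 2 first.
      exact: measurableD.
      by apply/seteqP; split => x // [[]].
    apply: rmeas_mono => //; first by apply: measurableU => //; exact: measurableD.
    by move=> x [[]//|]; exact: HsubF.
  have [_ /(_ _ e2)[B GB hB]] := SH N.
  exists B => //; rewrite (splitr e'); apply: le_lt_trans (ltrD dN hB).
  have mB := Gm GB.
  apply: rmeas_sub2; [exact: measurable_symdiff|exact: measurableD|exact: measurable_symdiff|].
  move=> x [[Fx nB]|[Bx nF]].
    by have [Hx|nHx] := pselect (H N x); [right; left|left].
  by right; right; split => // Hx; apply: nF; exact: HsubF.
Qed.

End finite_measure.

Section continuity.
Context {d : measure_display} {E : measurableType d} {R : realType}.
Variable mu : {measure set E -> \bar R}.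
Hypothesis mufin : (mu [set: E] < +oo)%E.

Lemma rmeas_bigcup_cvg (F : nat -> set E) : (forall n, measurable (F n)) ->
  nondecreasing_seq F ->
  rmeas mu (F n) @[n --> \oo] --> rmeas mu (\bigcup_n F n).
Proof.
move=> mF ndF; have mU : measurable (\bigcup_n F n) by exact: bigcup_measurable.
have := nondecreasing_cvg_mu mF mU ndF.
by move=> /(_ R mu); rewrite -rmeasE// => /fine_cvgP[].
Qed.

End continuity.

(** * Finite partitions given by a sequence of sets *)

Section codes.
Context {d : measure_display} {E : measurableType d}.
Variables (A : nat -> set E) (mA : forall n, measurable (A n)).

Definition bits n (y : E) : {ffun 'I_n -> bool} := [ffun i : 'I_n => y \in A i].

Definition cell n y : set E := [set y' | bits n y' = bits n y].

(** Unions of level-n cells, that is, members of the finite algebra generated by the first n sets,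
    described without listing cells. *)
Definition saturated n (D : set E) := forall y y', bits n y = bits n y' -> D y -> D y'.

Lemma bits_le k n y y' : (k <= n)%N -> bits n y = bits n y' -> bits k y = bits k y'.
Proof.
move=> kn /ffunP h; apply/ffunP => i; have := h (widen_ord kn i).
by rewrite !ffunE.
Qed.

Lemma saturated_le k n D : (k <= n)%N -> saturated k D -> saturated n D.
Proof. by move=> kn sD y y' /(bits_le kn); exact: sD. Qed.

Lemma saturatedC n D : saturated n D -> saturated n (~` D).
Proof. by move=> sD y y' e nD Dy'; apply: nD; apply: sD Dy'. Qed.

Lemma saturatedU n D D' : saturated n D -> saturated n D' -> saturated n (D `|` D').
Proof. by move=> sD sD' y y' e [/(sD _ _ e)|/(sD' _ _ e)]; [left|right]. Qed.

Lemma saturatedI n D D' : saturated n D -> saturated n D' -> saturated n (D `&` D').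
Proof. by move=> sD sD' y y' e [/(sD _ _ e) ? /(sD' _ _ e)]. Qed.

Lemma saturated_A n : saturated n.+1 (A n).
Proof.
move=> y y' /ffunP /(_ ord_max); rewrite !ffunE /= => e Ay.
by apply/set_mem; rewrite -e; exact: mem_set.
Qed.

Definition bits_set n (b : {ffun 'I_n -> bool}) : set E := [set y | bits n y = b].

Lemma measurable_bits_set n b : measurable (@bits_set n b).
Proof.
have -> : bits_set b = \bigcap_(i in [set: 'I_n]) (if b i then A i else ~` A i).
  apply/seteqP; split=> y.
    move=> <- i _; rewrite ffunE; case: ifPn => [/set_mem//|/negP h Ay].
    by apply: h; exact: mem_set.
  move=> h; apply/ffunP => i; rewrite ffunE; have := h i Logic.I.
  case: (b i) => [Ay|nA]; first exact: mem_set.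
  by apply/negP => /set_mem.
apply: fin_bigcap_measurable; first exact: finite_finset.
by move=> i _; case: ifP => _; [exact: mA|exact: measurableC].
Qed.

Lemma measurable_cell n y : measurable (cell n y).
Proof. exact: measurable_bits_set. Qed.

Lemma saturated_measurable n D : saturated n D -> measurable D.
Proof.
move=> sD.
have -> : D = \bigcup_(b in [set b | exists2 y, D y & bits n y = b]) bits_set b.
  apply/seteqP; split=> y; first by move=> Dy; exists (bits n y) => //; exists y.
  by move=> [_ [y' Dy' <-] e]; apply: sD Dy'.
apply: fin_bigcup_measurable; last by move=> b _; exact: measurable_bits_set.
exact: finite_finset.
Qed.

Context {R : realType}.

Lemma rmeas_saturated (mu : {measure set E -> \bar R}) n D :
  (mu [set: E] < +oo)%E -> saturated n D ->
  rmeas mu D = \sum_(b | `[< exists2 y, D y & bits n y = b >]) rmeas mu (bits_set b).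
Proof.
move=> mufin sD; pose P (b : {ffun 'I_n -> bool}) := `[< exists2 y, D y & bits n y = b >].
have key (s : seq {ffun 'I_n -> bool}) : uniq s ->
    rmeas mu [set y | bits n y \in s] = \sum_(b <- s) rmeas mu (bits_set b).
  elim: s => [_|b s ih /=/andP[bs us]].
    by rewrite big_nil -[RHS](congr1 fine (measure0 mu)); congr (rmeas mu _); apply/seteqP; split.
  rewrite big_cons -ih//.
  have ms : measurable [set y | bits n y \in s].
    by apply: (@saturated_measurable n) => y y' /= ->.
  rewrite -rmeas_disjU//; first last.
  - apply/seteqP; split=> y // [/= e]; rewrite /bits_set /= in e.
    by rewrite e (negPf bs).
  - exact: measurable_bits_set.
  congr (rmeas mu _); apply/seteqP; split=> y /=; rewrite inE.
    by move=> /orP[/eqP|]; [left|right].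
  by move=> [->|->]; rewrite ?eqxx ?orbT.
have := key [seq b <- index_enum _ | P b] (filter_uniq _ (index_enum_uniq _)).
rewrite big_filter => <-; congr (rmeas mu _); apply/seteqP; split=> y /=.
  move=> Dy; rewrite mem_filter mem_index_enum andbT; apply/asboolP.
  by exists y.
by rewrite mem_filter => /andP[/asboolP[y' Dy' e] _]; apply: sD Dy'.
Qed.

Lemma saturated_rmeas_le (mu1 mu2 : {measure set E -> \bar R}) (a : R) n D :
  (mu1 [set: E] < +oo)%E -> (mu2 [set: E] < +oo)%E -> saturated n D ->
  (forall y, D y -> rmeas mu1 (cell n y) <= a * rmeas mu2 (cell n y)) ->
  rmeas mu1 D <= a * rmeas mu2 D.
Proof.
move=> m1 m2 sD h; rewrite !(rmeas_saturated _ sD)// mulr_sumr; apply: ler_sum => b.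
by move=> /asboolP[y Dy <-]; exact: h.
Qed.

(* Decompose the union according to the first n such that p n holds. *)
Lemma first_hitting (mu1 mu2 : {measure set E -> \bar R}) (a : R) (p : nat -> set E) :
  (mu1 [set: E] < +oo)%E -> (mu2 [set: E] < +oo)%E ->
  (forall n, saturated n (p n)) ->
  (forall n y, p n y -> rmeas mu1 (cell n y) <= a * rmeas mu2 (cell n y)) ->
  rmeas mu1 (\bigcup_n p n) <= a * rmeas mu2 (\bigcup_n p n).
Proof.
move=> m1 m2 sp hp.
pose H n := \big[setU/set0]_(i < n) p i.
have sH n : saturated n (H n).
  move=> y y' e; rewrite /H -bigcup_mkord => -[i /= ni piy]; exists i => //.
  by apply: sp piy; apply: bits_le e; exact: ltnW.
have HS n : H n.+1 = H n `|` (p n `\` H n).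
  rewrite /H big_ord_recr/= -/(H n); apply/seteqP; split=> y.
    by have [|nH] := pselect (H n y); [left|move=> [//|]; right].
  by move=> [|[? _]]; [left|right].
have mH n : measurable (H n) by exact: saturated_measurable.
have sD n : saturated n (p n `\` H n).
  by apply: saturatedI => //; apply: saturatedC.
have mD n : measurable (p n `\` H n) by exact: saturated_measurable.
have hH n : rmeas mu1 (H n) <= a * rmeas mu2 (H n).
  elim: n => [|n ih].
    by rewrite /H big_ord0 /rmeas !measure0 mulr0.
  rewrite HS !rmeas_disjU//; try by apply/seteqP; split => y // [? []].
  rewrite mulrDr lerD//; apply: (saturated_rmeas_le m1 m2 (sD n)) => y [py _].
  exact: hp.
have HE : \bigcup_n H n = \bigcup_n p n.
  apply/seteqP; split => x.
    by move=> [n _]; rewrite /H -bigcup_mkord => -[i _ ?]; exists i.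
  move=> [n _ Fx]; exists n.+1 => //; rewrite /H -bigcup_mkord.
  by exists n => /=.
have ndH : nondecreasing_seq H.
    move=> m n mn; apply/subsetPset; rewrite /H -!bigcup_mkord => x [i /= im Fx].
    by exists i => //=; exact: leq_trans mn.
have c1 := rmeas_bigcup_cvg m1 mH ndH; have c2 := rmeas_bigcup_cvg m2 mH ndH.
rewrite HE in c1 c2.
have c2' : a * rmeas mu2 (H n) @[n --> \oo] --> a * rmeas mu2 (\bigcup_n p n).
  by apply: cvgM => //; exact: cvg_cst.
by apply: (ler_cvg_to c1 c2'); exact: nearW.
Qed.

End codes.

Section oscillation.
Context {R : realType}.

(** A bounded sequence that does not converge crosses some gap between two rationals infinitely
    often. Here [q2] lies below the limsup and so is exceeded infinitely often; hence [u] cannot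
    return below [q1] infinitely often. *)
Lemma cvg_no_oscillation (u : nat -> R) (m : R) :
  (forall n, 0 <= u n <= m) ->
  (forall q1 q2 : rat, 0 <= ratr q1 :> R -> ratr q1 < ratr q2 :> R ->
     ~ ((forall k, exists2 n, (k <= n)%N & u n <= ratr q1) /\
        (forall k, exists2 n, (k <= n)%N & ratr q2 <= u n))) ->
  u @ \oo --> limn_sup u.
Proof.
move=> um h.
have ub : has_ubound (range u) by exists m => _ [n _ <-]; case/andP: (um n).
have lb : has_lbound (range u) by exists 0 => _ [n _ <-]; case/andP: (um n).
have cs := cvg_sups_inf ub lb; set L := inf _ in cs.
have sE : limn_sup u = L by exact: cvg_lim cs.
have hs n : has_sup (sdrop u n).
  split; first by exists (u n), n => /=.
  by exists m => _ [k _ <-]; case/andP: (um k).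
have uL n : u n <= sups u n.
  by apply: ub_le_sup; [exact: (hs n).2|exists n => /=].
have Ls n : L <= sups u n.
  apply: ge_inf; last by exists n.
  exists 0 => _ [k _ <-]; apply: (@le_trans _ _ (u k)); first by case/andP: (um k).
  exact: uL.
rewrite sE; apply/cvgrPdist_lt => e e0.
move/cvgrPdist_lt: cs => /(_ _ e0)[N1 _ hN1].
have [q1 [q1e q1']] : exists q1 : rat, L - e < ratr q1 /\ ratr q1 < L - e / 2 :> R.
  have [|q /[!in_itv]/= /andP[? ?]] := @rat_in_itvoo R (L - e) (L - e / 2); last by exists q.
  by rewrite ltrD2l ltrN2 ltr_pdivrMr// ltr_pMr// ltr1n.
have [q2 [q2e q2']] : exists q2 : rat, L - e / 2 < ratr q2 /\ ratr q2 < L :> R.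
  have [|q /[!in_itv]/= /andP[? ?]] := @rat_in_itvoo R (L - e / 2) L; last by exists q.
  by rewrite gtrDl oppr_lt0 divr_gt0.
have io2 k : exists2 n, (k <= n)%N & ratr q2 <= u n.
  have : ratr q2 < sups u k by apply: lt_le_trans (Ls k).
  move=> h'; have e1 : 0 < sups u k - ratr q2 by rewrite subr_gt0.
  have [_ [n /= kn <-] hn] := sup_adherent e1 (hs k).
  by exists n => //; move: hn; rewrite subKr => /ltW.
have low : exists N2, forall n, (N2 <= n)%N -> L - e < u n.
  (* For negative [q1] the bound follows from nonnegativity of [u]; for the others the absence of
     oscillation applies. *)
  have [q10|q10] := leP 0 (ratr q1 : R); last first.
    exists 0%N => n _; apply: (lt_trans q1e); apply: (lt_le_trans q10).
    by case/andP: (um n).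
  apply: contrapT => /forallNP nh; apply: (h q1 q2 q10); first exact: lt_trans q1' q2e.
  split => // k; have /existsNP[n /not_implyP[kn /negP]] := nh k.
  by rewrite -leNgt => un; exists n => //; apply: le_trans un (ltW q1e).
have [N2 hN2] := low.
exists (maxn N1 N2) => // n /=; rewrite geq_max => /andP[n1 n2].
have := hN1 n n1; have := hN2 n n2; have := uL n; have := Ls n.
rewrite /= => a b c dd; rewrite ltr_norml; apply/andP; split; last by lra.
by move: dd; rewrite ltr_norml => /andP[? ?]; lra.
Qed.

End oscillation.

(** * Densities as limits of ratios on cells *)

Section density.
Context {d : measure_display} {E : measurableType d} {R : realType}.
Variables (A : nat -> set E) (mA : forall n, measurable (A n)).
Hypothesis genA : d.-measurable = <<s range A >>.
Variables (mu nu : {measure set E -> \bar R}).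
Hypotheses (mufin : (mu [set: E] < +oo)%E) (nufin : (nu [set: E] < +oo)%E).
Variable m : R.
Hypothesis m0 : 0 <= m.
Hypothesis dom : forall n y, rmeas mu (cell A n y) <= m * rmeas nu (cell A n y).

(* This is 0 where nu vanishes on the cell, and mu does too by the hypothesis dom. *)
Definition cell_ratio n y : R := rmeas mu (cell A n y) / rmeas nu (cell A n y).

Let cell_eq n y y' : bits A n y = bits A n y' -> cell A n y = cell A n y'.
Proof. by rewrite /cell => ->. Qed.

Lemma ratio_bits n y y' : bits A n y = bits A n y' -> cell_ratio n y = cell_ratio n y'.
Proof. by rewrite /cell_ratio => /cell_eq ->. Qed.

Lemma cell_ratio_sum n y : cell_ratio n y = \sum_(b : {ffun 'I_n -> bool})
  rmeas mu (bits_set A b) / rmeas nu (bits_set A b) * \1_(bits_set A b) y.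
Proof.
rewrite (bigD1 (bits A n y))//= big1 ?addr0; last first.
  by move=> b; rewrite eq_sym => /eqP yb; rewrite indicE memNset ?mulr0.
by rewrite indicE mem_set// mulr1.
Qed.

Lemma ratio_bounds n y : 0 <= cell_ratio n y <= m.
Proof.
rewrite /cell_ratio divr_ge0 ?rmeas_ge0//=.
have [->|h] := eqVneq (rmeas nu (cell A n y)) 0; first by rewrite invr0 mulr0.
by rewrite ler_pdivrMr ?dom// lt_neqAle eq_sym h rmeas_ge0.
Qed.

Let ratioE n y : rmeas mu (cell A n y) = cell_ratio n y * rmeas nu (cell A n y).
Proof.
rewrite /cell_ratio; have [h|h] := eqVneq (rmeas nu (cell A n y)) 0; last by rewrite divfK.
have := dom n y; rewrite h !mulr0 => h'.
by apply/le_anti; rewrite h' rmeas_ge0.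
Qed.

Let ratio_le n y a : cell_ratio n y <= a ->
  rmeas mu (cell A n y) <= a * rmeas nu (cell A n y).
Proof. by move=> h; rewrite ratioE ler_wpM2r ?rmeas_ge0. Qed.

Let ratio_ge n y a : 0 < a -> a <= cell_ratio n y ->
  rmeas nu (cell A n y) <= a^-1 * rmeas mu (cell A n y).
Proof. by move=> a0 h; rewrite ratioE ler_pdivlMl// ler_wpM2r ?rmeas_ge0. Qed.

Definition algebra_A : set (set E) := [set D | exists n, saturated A n D].

(** Approximating for the sum [mu] + [nu] gives one saturated set that is good for both measures. *)
Lemma approx2 D (e : R) : measurable D -> 0 < e ->
  exists k B, [/\ saturated A k B, rmeas mu (symdiff D B) < e & rmeas nu (symdiff D B) < e].
Proof.
move=> mD e0.
pose kap : {measure set E -> \bar R} := measure_add mu nu.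
have kE X : kap X = (mu X + nu X)%E by exact: measure_addE.
have kfin : (kap [set: E] < +oo)%E by rewrite kE lte_add_pinfty.
have rE X : measurable X -> rmeas kap X = rmeas mu X + rmeas nu X.
  by move=> mX; apply: EFin_inj; rewrite EFinD !rmeasE// kE.
have [|||||//|_ [B [k sB] hB]] := @algebra_approximation d E R kap kfin algebra_A _ _ _ _ D e.
- by move=> X [n sX]; exists n; exact: saturatedC.
- move=> X Y [n sX] [k sY]; exists (maxn n k); apply: saturatedU.
    by apply: saturated_le sX; exact: leq_maxl.
  by apply: saturated_le sY; exact: leq_maxr.
- by exists 0%N => y y' _ [].
- by move=> X [n]; exact: saturated_measurable.
- move: mD; rewrite genA; apply: sub_smallest2r.
  + exact: smallest_sigma_algebra.
  + by move=> _ [n _ <-]; exists n.+1; exact: saturated_A.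
- exists k, B; move: hB; rewrite rE; last first.
    by apply: measurable_symdiff => //; exact: saturated_measurable sB.
  move=> hB; split => //; apply: le_lt_trans hB; rewrite ?lerDl ?lerDr rmeas_ge0//.
Qed.

Definition osc (a b : R) : set E :=
  [set y | (forall k, exists2 n, (k <= n)%N & cell_ratio n y <= a) /\
           (forall k, exists2 n, (k <= n)%N & b <= cell_ratio n y)].

Let sat_le_set n (a : R) : saturated A n [set y | cell_ratio n y <= a].
Proof. by move=> y y' e /=; rewrite (ratio_bits e). Qed.

Let sat_ge_set n (a : R) : saturated A n [set y | a <= cell_ratio n y].
Proof. by move=> y y' e /=; rewrite (ratio_bits e). Qed.

Lemma measurable_osc a b : measurable (osc a b).
Proof.
have -> : osc a b =
    (\bigcap_k \bigcup_(n in [set n | (k <= n)%N]) [set y | cell_ratio n y <= a]) `&`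
    (\bigcap_k \bigcup_(n in [set n | (k <= n)%N]) [set y | b <= cell_ratio n y]).
  apply/seteqP; split=> y [h1 h2]; split=> k.
  - by move=> _; have [n kn ?] := h1 k; exists n.
  - by move=> _; have [n kn ?] := h2 k; exists n.
  - by have [n /= kn ?] := h1 k Logic.I; exists n.
  - by have [n /= kn ?] := h2 k Logic.I; exists n.
apply: measurableI; apply: bigcapT_measurable => k; apply: bigcup_measurable => n _.
  exact: (saturated_measurable mA (@sat_le_set n a)).
exact: (saturated_measurable mA (@sat_ge_set n b)).
Qed.

(* On a level-k approximation B of osc a b, first hitting of {cell_ratio <= a} after k
   bounds mu B above by a nu, and first hitting of {cell_ratio >= b} below by b nu. *)
Lemma osc_null a b : 0 <= a -> a < b -> rmeas nu (osc a b) = 0.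
Proof.
move=> a0 ab; set N := osc a b; have mN : measurable N by exact: measurable_osc.
have b0 : 0 < b by exact: le_lt_trans ab.
suff h : b * rmeas nu N <= a * rmeas nu N.
  apply/le_anti; rewrite rmeas_ge0 andbT.
  have : (b - a) * rmeas nu N <= 0 by rewrite mulrBl subr_le0.
  by rewrite pmulr_rle0// subr_gt0.
apply/ler_addgt0Pr => e e0.
pose c := a + b + 1; have c0 : 0 < c by rewrite /c; lra.
have [k [B [sB hmu hnu]]] := approx2 mN (divr_gt0 e0 c0).
have mB : measurable B by exact: saturated_measurable sB.
set f := e / c in hmu hnu.
pose p n : set E := if (k <= n)%N then B `&` [set y | cell_ratio n y <= a] else set0.
pose q n : set E := if (k <= n)%N then B `&` [set y | b <= cell_ratio n y] else set0.
have sp n : saturated A n (p n).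
  rewrite /p; case: ifP => kn; last by move=> y y' _ [].
  by apply: saturatedI; [exact: saturated_le sB|exact: sat_le_set].
have sq n : saturated A n (q n).
  rewrite /q; case: ifP => kn; last by move=> y y' _ [].
  by apply: saturatedI; [exact: saturated_le sB|exact: sat_ge_set].
have hp : rmeas mu (\bigcup_n p n) <= a * rmeas nu (\bigcup_n p n).
  apply: (first_hitting mA) => // n y; rewrite /p; case: ifP => // _ [_ /=].
  exact: ratio_le.
have hq : rmeas nu (\bigcup_n q n) <= b^-1 * rmeas mu (\bigcup_n q n).
  apply: (first_hitting mA) => // n y; rewrite /q; case: ifP => // _ [_ /=].
  exact: ratio_ge.
have mp : measurable (\bigcup_n p n).
  by apply: bigcup_measurable => n _; exact: saturated_measurable (sp n).
have mq : measurable (\bigcup_n q n).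
  by apply: bigcup_measurable => n _; exact: saturated_measurable (sq n).
have pB : \bigcup_n p n `<=` B.
  by move=> y [n _]; rewrite /p; case: ifP => // _ [].
have qB : \bigcup_n q n `<=` B.
  by move=> y [n _]; rewrite /q; case: ifP => // _ [].
have Np : N `&` B `<=` \bigcup_n p n.
  move=> y [[h1 _] By]; have [n kn h] := h1 k; exists n => //.
  by rewrite /p kn.
have Nq : N `&` B `<=` \bigcup_n q n.
  move=> y [[_ h1] By]; have [n kn h] := h1 k; exists n => //.
  by rewrite /q kn.
have mS : measurable (symdiff N B) by exact: measurable_symdiff.
have n1 : rmeas nu N <= rmeas nu (\bigcup_n q n) + rmeas nu (symdiff N B).
  apply: rmeas_sub2 => // y Ny; have [By|nBy] := pselect (B y); first by left; exact: Nq.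
  by right; left.
have n2 : rmeas mu B <= rmeas mu (\bigcup_n p n) + rmeas mu (symdiff N B).
  apply: rmeas_sub2 => // y By; have [Ny|nNy] := pselect (N y); first by left; exact: Np.
  by right; right.
have n3 : rmeas nu B <= rmeas nu N + rmeas nu (symdiff N B).
  apply: rmeas_sub2 => // y By; have [Ny|nNy] := pselect (N y); first by left.
  by right; right.
have n4 : rmeas nu (\bigcup_n p n) <= rmeas nu B by exact: rmeas_mono.
have n5 : rmeas mu (\bigcup_n q n) <= rmeas mu B by exact: rmeas_mono.
rewrite ler_pdivlMl// in hq.
have f1 : a * f + b * f + f = e by rewrite /f /c; field; rewrite gt_eqF.
have m1 := ler_wpM2l (ltW b0) n1; rewrite mulrDr in m1.
have m2 := ler_wpM2l a0 n4.
have m3 := ler_wpM2l a0 n3; rewrite mulrDr in m3.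
have m4 := ler_wpM2l (ltW b0) (ltW hnu).
have m5 := ler_wpM2l a0 (ltW hnu).
rewrite -f1; lra.
Qed.

(** The divergence set is covered by the null sets [osc] indexed by pairs of rationals, enumerated
    by [pickle]. *)
Lemma ratio_cvg_ae : {ae nu, forall y, cell_ratio^~ y @ \oo --> limn_sup (cell_ratio^~ y)}.
Proof.
pose N (i : nat) : set E := if unpickle i is Some q then
  (if (0 <= ratr q.1 :> R) && (ratr q.1 < ratr q.2 :> R) then osc (ratr q.1) (ratr q.2) else set0)
  else set0 : set E.
have mN i : measurable (N i).
  by rewrite /N; case: unpickle => [[q1 q2]|]//; case: ifP => // _; exact: measurable_osc.
have N0 i : nu (N i) = 0%E.
  rewrite /N; case: unpickle => [[q1 q2]|]; last exact: measure0.
  case: ifP => [/andP[h1 h2]|_]; last exact: measure0.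
  by rewrite -(rmeasE nufin)/=; [rewrite osc_null|exact: measurable_osc].
have : nu.-negligible (\bigcup_i N i).
  apply: negligible_bigcup => i; exists (N i); split => //; exact: N0.
apply: negligibleS => y; apply: contra_notP => ny.
apply: (@cvg_no_oscillation _ _ m) => [n|q1 q2 h1 h2 h]; first exact: ratio_bounds.
apply: ny; exists (pickle (q1, q2)); first exact: Logic.I.
by rewrite /N pickleK h1 h2.
Qed.

(** A limsup rather than an almost everywhere limit: it is defined at every point by a formula
    explicit in [mu], so it remains measurable when [mu] depends on a parameter. *)
Definition ratio_limit y : R := limn_sup (cell_ratio^~ y).

Let ratio_ub y : has_ubound (range (cell_ratio^~ y)).
Proof. by exists m => _ [n _ <-]; case/andP: (ratio_bounds n y). Qed.

Let ratio_lb y : has_lbound (range (cell_ratio^~ y)).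
Proof. by exists 0 => _ [n _ <-]; case/andP: (ratio_bounds n y). Qed.

Lemma measurable_ratio n : measurable_fun [set: E] (cell_ratio n).
Proof.
move=> _ Y mY; rewrite setTI; apply: (saturated_measurable mA (n := n)).
by move=> y y' e; rewrite /preimage /= (ratio_bits e).
Qed.

Lemma measurable_ratio_limit : measurable_fun [set: E] ratio_limit.
Proof. by apply: measurable_fun_limn_sup => // n; exact: measurable_ratio. Qed.

Lemma ratio_limit_bounds y : 0 <= ratio_limit y <= m.
Proof.
have cs := cvg_sups_inf (ratio_ub y) (ratio_lb y).
have hs n : has_sup (sdrop (cell_ratio^~ y) n).
  split; first by exists (cell_ratio n y), n => /=.
  by exists m => _ [k _ <-]; case/andP: (ratio_bounds k y).
have cs' : cvgn (sups (cell_ratio^~ y)) by apply/cvg_ex; eexists; exact: cs.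
apply/andP; split.
  apply: limr_ge => //; apply: nearW => n.
  apply: (@le_trans _ _ (cell_ratio n y)); first by case/andP: (ratio_bounds n y).
  by apply: ub_le_sup; [exact: (hs n).2|exists n => /=].
apply: limr_le => //; apply: nearW => n; apply: ge_sup; first exact: (hs n).1.
by move=> _ [k _ <-]; case/andP: (ratio_bounds k y).
Qed.

Lemma ratio_bmreal n : bmreal (cell_ratio n).
Proof.
split; first exact: measurable_ratio.
by exists m => y; have /andP[? ?] := ratio_bounds n y; rewrite ger0_norm.
Qed.

Lemma ratio_limit_bmreal : bmreal ratio_limit.
Proof.
split; first exact: measurable_ratio_limit.
by exists m => y; have /andP[? ?] := ratio_limit_bounds y; rewrite ger0_norm.
Qed.

Lemma bmreal_Rintegral_sum (J : Type) (s : seq J) (P : pred J) (f : J -> E -> R) :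
  (forall j, bmreal (f j)) -> bmreal (fun y => \sum_(j <- s | P j) f j y) /\
  \int[nu]_y (\sum_(j <- s | P j) f j y) = \sum_(j <- s | P j) \int[nu]_y f j y.
Proof.
move=> bf; elim: s => [|j s [b ih]].
  have -> : (fun y => \sum_(j <- [::] | P j) f j y) = fun=> 0.
    by apply/funext => y; rewrite big_nil.
  split; first exact: bmreal_cst.
  by rewrite big_nil Rintegral_cst// mul0r.
have e : (fun y => \sum_(j <- j :: s | P j) f j y) =
    if P j then (fun y => f j y + \sum_(j <- s | P j) f j y) else
      (fun y => \sum_(j <- s | P j) f j y).
  by case: ifPn => Pj; apply/funext => y; rewrite big_cons ?Pj ?(negPf Pj).
rewrite e big_cons; case: ifP => // _; split; first exact: bmrealD.
by rewrite bmreal_RintegralD// ih.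
Qed.

Let I (f : E -> R) (D : set E) : R := \int[nu]_y (f y * \1_D y).

Let I_ratio n D : saturated A n D -> I (cell_ratio n) D = rmeas mu D.
Proof.
move=> sD; rewrite (rmeas_saturated mA mufin sD).
pose P (b : {ffun 'I_n -> bool}) := `[< exists2 y, D y & bits A n y = b >].
pose c (b : {ffun 'I_n -> bool}) := rmeas mu (bits_set A b) / rmeas nu (bits_set A b).
have mb b : measurable (bits_set A b) by exact: measurable_bits_set.
have e : (fun y => cell_ratio n y * \1_D y) =
    (fun y => \sum_(b | P b) c b * (\1_(bits_set A b) y : R)).
  apply/funext => y; rewrite big_mkcond (bigD1 (bits A n y))//= big1 ?addr0; last first.
    move=> b; rewrite eq_sym => /eqP by'; case: ifP => // _.
    by rewrite indicE memNset ?mulr0.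
  case: ifPn => [/asboolP[y' Dy' yy']|/asboolPn nP].
    have -> : \1_D y = 1 :> R by rewrite indicE mem_set//; exact: sD yy' Dy'.
    have -> : \1_(bits_set A (bits A n y)) y = 1 :> R by rewrite indicE mem_set.
    by rewrite !mulr1.
  have -> : \1_D y = 0 :> R; last by rewrite mulr0.
  by rewrite indicE memNset// => Dy; apply: nP; exists y.
rewrite /I e (bmreal_Rintegral_sum _ _ _).2; last first.
  by move=> b; apply: bmrealZ; exact: bmreal_indic.
apply: eq_bigr => b /asboolP[y Dy yb].
rewrite bmreal_RintegralZ//; last exact: bmreal_indic.
rewrite /Rintegral integral_indic// setIT -/(rmeas nu _) /c.
have -> : bits_set A b = cell A n y by rewrite /cell /bits_set yb.
by rewrite -/(cell_ratio n y) -ratioE.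
Qed.

(** From level [k] on, the integrals of the ratios over [D] all equal mu(D), and bounded convergence
    passes this to the limit. *)
Let I_limit k D : saturated A k D -> I ratio_limit D = rmeas mu D.
Proof.
move=> sD; have mD := saturated_measurable mA sD.
have bD := @bmreal_indic d E R D mD.
have br n : bmreal (fun y => cell_ratio n y * \1_D y) by apply: bmrealM => //; exact: ratio_bmreal.
have bl : bmreal (fun y => ratio_limit y * \1_D y).
  by apply: bmrealM => //; exact: ratio_limit_bmreal.
have [|||||_ _ h] := @dominated_convergence d E R nu [set: E] measurableT
  (fun n y => (cell_ratio n y * \1_D y)%:E) (fun y => (ratio_limit y * \1_D y)%:E) (fun=> m%:E).
- by move=> n; apply/measurable_EFinP; exact: (br n).1.
- by apply/measurable_EFinP; exact: bl.1.
- apply: filterS ratio_cvg_ae => y hy _; apply: cvg_EFin.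
    exact: nearW.
  by rewrite /=; apply: cvgM; [exact: hy|exact: cvg_cst].
- exact: (bmreal_integrable nufin (bmreal_cst m)).
- apply: aeW => y n _; rewrite /= lee_fin.
  have /andP[r0 rm] := ratio_bounds n y.
  rewrite indicE; case: (_ \in _); rewrite ?mulr0 ?mulr1 ?normr0//.
  by rewrite ger0_norm.
apply: EFin_inj; rewrite /I bmreal_RintegralE//.
apply: (cvg_unique _ h); first exact: ereal_hausdorff.
apply: cvg_near_cst; exists k => // n kn /=.
by rewrite -bmreal_RintegralE// -/(I (cell_ratio n) D) I_ratio//; exact: saturated_le sD.
Qed.

Lemma ratio_limit_integral D : measurable D ->
  (\int[nu]_(y in D) (ratio_limit y)%:E)%E = mu D.
Proof.
move=> mD.
have bl := ratio_limit_bmreal.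
have bM X : measurable X -> bmreal (fun y => ratio_limit y * \1_X y).
  by move=> mX; apply: bmrealM => //; exact: bmreal_indic.
suff h : I ratio_limit D = rmeas mu D.
  rewrite -rmeasE// -h /I bmreal_RintegralE; [|by []|exact: bM].
  rewrite integral_mkcond; apply: eq_integral => y _.
  by rewrite patchE indicE; case: ifP => _; rewrite ?mulr1 ?mulr0.
(* Since the density is at most [m], enlarging a set by Z adds at most m nu(Z); this transfers the
   identity from saturated sets to all measurable ones. *)
have I_sub X Y Z : measurable X -> measurable Y -> measurable Z -> X `<=` Y `|` Z ->
    I ratio_limit X <= I ratio_limit Y + m * rmeas nu Z.
  move=> mX mY mZ XYZ; have bZ := @bmreal_indic d E R Z mZ.
  have -> : m * rmeas nu Z = \int[nu]_y (m * \1_Z y).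
    by rewrite bmreal_RintegralZ// /Rintegral integral_indic// setIT.
  rewrite /I -bmreal_RintegralD; [|by []|exact: bM|exact: bmrealZ].
  apply: bmreal_le_Rintegral => //; first exact: bM.
    by apply: bmrealD; [exact: bM|exact: bmrealZ].
  move=> y; have /andP[l0 lm] := ratio_limit_bounds y.
  rewrite !indicE; have [Xy|nXy] := pselect (X y); last first.
    by rewrite memNset// mulr0 addr_ge0// mulr_ge0.
  rewrite mem_set// mulr1; have [Yy|Zy] := XYZ _ Xy.
    by rewrite [y \in Y]mem_set// mulr1 lerDl mulr_ge0.
  by rewrite [y \in Z]mem_set// mulr1 ler_wpDl// mulr_ge0.
suff h e : 0 < e -> `|I ratio_limit D - rmeas mu D| <= e.
  apply/eqP; rewrite -subr_eq0 -normr_le0; apply/ler_addgt0Pr => e e0.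
  by rewrite add0r h.
move=> e0; have e1 : 0 < e / (m + 1) by rewrite divr_gt0// ltr_wpDl.
have [k [B [sB hmu hnu]]] := approx2 mD e1.
have mB := saturated_measurable mA sB.
have mS := measurable_symdiff mD mB.
have IB := I_limit sB.
have sub1 : D `<=` B `|` symdiff D B.
  by move=> y Dy; have [By|nBy] := pselect (B y); [left|right; left].
have sub2 : B `<=` D `|` symdiff D B.
  by move=> y By; have [Dy|nDy] := pselect (D y); [left|right; right].
have h1 := I_sub _ _ _ mD mB mS sub1; have h2 := I_sub _ _ _ mB mD mS sub2.
have h3 := rmeas_sub2 mufin mD mB mS sub1; have h4 := rmeas_sub2 mufin mB mD mS sub2.
have h5 := ler_wpM2l m0 (ltW hnu).
have f : m * (e / (m + 1)) + e / (m + 1) = e by field; rewrite gt_eqF// ltr_wpDl.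
rewrite IB in h1 h2.
rewrite ler_norml; set g := e / (m + 1) in f hmu h5 *; set mg := m * g in f h5.
by apply/andP; split; move: f h5 h1 h2 h3 h4 hmu; lra.
Qed.

End density.

(** * Kernels with a density *)

Section kernel_restriction.
Context {d : measure_display} {E : measurableType d} {R : realType}.
Variables (P : R.-fker E ~> E) (S : set (E * E)) (mS : measurable S).

(** The set kept depends on [x]; taking it as the section of a jointly measurable set is what keeps
    the restriction a kernel. *)
Definition krestr (x : E) : {measure set E -> \bar R} :=
  mrestr (P x) (measurable_xsection x mS).

Lemma krestrE x U : krestr x U = P x (U `&` xsection S x).
Proof. by []. Qed.

Let measurable_krestr U : measurable U -> measurable_fun [set: E] (krestr ^~ U).
Proof.
move=> mU.
have mUS : measurable (([set: E] `*` U) `&` S).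
  by apply: measurableI => //; exact: measurableX.
have e : (krestr ^~ U) = fun x => P x (xsection (([set: E] `*` U) `&` S) x).
  apply/funext => x; rewrite krestrE; congr (P x _).
  by rewrite xsectionI; congr (_ `&` _); rewrite in_xsectionX// in_setT.
by rewrite e; apply: measurable_fun_xsection_finite_kernel; rewrite inE.
Qed.

HB.instance Definition _ := @isKernel.Build _ _ _ _ _ krestr measurable_krestr.

Let krestr_uub : measure_fam_uub krestr.
Proof.
have [r Pr] := measure_uub P; exists r => x; rewrite krestrE.
apply: le_lt_trans (Pr x); apply: le_measure; rewrite ?inE//.
by apply: measurableI => //; exact: measurable_xsection.
Qed.

HB.instance Definition _ := @Kernel_isFinite.Build _ _ _ _ _ krestr krestr_uub.

End kernel_restriction.

Section kernel_density.
Context {d : measure_display} {E : measurableType d} {R : realType}.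
Implicit Types (P T : R.-fker E ~> E) (nu : probability E R).

(** An injection of the generating family into the integers is inverted; integers outside its range
    receive [set0], which belongs to every sigma-algebra. *)
Lemma countably_generated_seq : countably_generated E ->
  exists A : nat -> set E, (forall n, measurable (A n)) /\
    d.-measurable = <<s range A >>.
Proof.
move=> [G [/pcard_injP[f finj] gE]].
pose A n : set E := xget set0 [set X | G X /\ f X = n].
have GA n : A n = set0 \/ G (A n).
  rewrite /A; case: xgetP => [X _ [GX _]|_]; first by right.
  by left.
have AG X : G X -> A (f X) = X.
  move=> GX; rewrite /A; case: xgetP => [Y _ [GY fY]|/(_ X)h]; last first.
    by exfalso; apply: h.
  by apply: finj => //; rewrite inE.
exists A; split.
  move=> n; case: (GA n) => [->//|GAn].
  by rewrite gE; exact: sub_sigma_algebra.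
apply/seteqP; split.
  rewrite {1}gE; apply: smallest_sub; first exact: smallest_sigma_algebra.
  by move=> X GX; apply: sub_sigma_algebra; exists (f X) => //; exact: AG.
rewrite gE; apply: smallest_sub; first exact: smallest_sigma_algebra.
move=> _ [n _ <-]; case: (GA n) => [->|]; last exact: sub_sigma_algebra.
exact: sigma_algebra0.
Qed.

Lemma measurable_fine_kernel P B : measurable B ->
  measurable_fun [set: E] (fun x => fine (P x B)).
Proof. by move=> mB; apply: measurableT_comp => //; exact: measurable_kernel. Qed.

Section joint.
Variables (A : nat -> set E) (mA : forall n, measurable (A n)).
Hypothesis genA : d.-measurable = <<s range A >>.
Variables (T : R.-fker E ~> E) (nu : probability E R) (m : R).
Hypothesis m0 : 0 <= m.
Hypothesis dom : forall x n y, rmeas (T x) (cell A n y) <= m * rmeas nu (cell A n y).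

Let nufin : (nu [set: E] < +oo)%E.
Proof. by rewrite probability_setT ltry. Qed.

Definition kernel_density (z : E * E) : R := ratio_limit A (T z.1) nu z.2.

Let kd_bounds z : 0 <= kernel_density z <= m.
Proof. exact: ratio_limit_bounds. Qed.

(** Written as a finite sum over codes, the ratio is a sum of products of a function of x and an
    indicator in y. *)
Lemma measurable_cell_ratio n :
  measurable_fun [set: E * E] (fun z => cell_ratio A (T z.1) nu n z.2).
Proof.
under eq_fun do rewrite cell_ratio_sum.
apply: measurable_sum => b; apply: measurable_funM.
  apply: measurable_funM; last exact: measurable_cst.
  exact: (measurableT_comp (measurable_fine_kernel T (measurable_bits_set mA b)) measurable_fst).
by apply: (measurableT_comp _ measurable_snd); apply: measurable_indic; exact: measurable_bits_set.
Qed.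

Lemma measurable_kernel_density : measurable_fun [set: E * E] kernel_density.
Proof.
have -> : kernel_density = (fun z => limn_sup (fun n => cell_ratio A (T z.1) nu n z.2)) by [].
apply: (@measurable_fun_limn_sup _ _ _ _ (fun n z => cell_ratio A (T z.1) nu n z.2)).
- move=> z _; exists m => _ [n _ <-].
  by have /andP[] := ratio_bounds m0 (dom z.1) n z.2.
- move=> z _; exists 0 => _ [n _ <-].
  by have /andP[] := ratio_bounds m0 (dom z.1) n z.2.
exact: measurable_cell_ratio.
Qed.

Lemma Tfun_kernel_density x D : measurable D -> T x D = Tfun nu kernel_density x D.
Proof.
move=> mD; rewrite /Tfun (ratio_limit_integral mA genA _ nufin m0 (dom x))//.
exact: kernel_setT_fin.
Qed.

Lemma Hclass_bounded (alpha : E * E -> R) (M : R) :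
  measurable_fun [set: E * E] alpha -> (forall z, 0 <= alpha z <= M) -> Hclass nu alpha.
Proof.
move=> ma ha; split => //; first by move=> z; case/andP: (ha z).
apply: cvg_near_cst; exists M; split; first exact: num_real.
move=> r Mr; apply/eqP.
have -> : [set r0 | exists x : E, r0 = (\int[nu]_(y in [set y | (r <= alpha (x, y))%R])
    (alpha (x, y))%:E)%E] = [set 0%E]; last by rewrite ereal_sup1.
have e x : [set y | (r <= alpha (x, y))%R] = set0.
  apply/seteqP; split=> y //= h; have /andP[_ h'] := ha (x, y).
  by have := le_lt_trans (le_trans h h') Mr; rewrite ltxx.
apply/seteqP; split=> [_ [x ->]|_ ->]; first by rewrite e integral_set0.
by exists point; rewrite e integral_set0.
Qed.

Lemma Kstar_dominated : Kstar T.
Proof.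
exists nu, kernel_density; split.
  by apply: (Hclass_bounded (M := m)) => //; exact: measurable_kernel_density.
exact: Tfun_kernel_density.
Qed.

End joint.

(* For each x, remove from P(x, .) the first cells on which P(x, .) >= m nu; by
   Markov's inequality the removed set is nu-small, and what remains is <= m nu. *)
Theorem Delta_Kstar P nu (c : R) : countably_generated E -> (Delta nu P < c%:E)%E ->
  exists T, [/\ Kstar T, kle T P & opnorm (kop P \- kop T) <= c].
Proof.
move=> /countably_generated_seq[A [mA genA]] /Delta_lt[eta eta0 hP].
have [r Pr] := measure_uub P.
have r0 : 0 < r by rewrite -lte_fin; apply: le_lt_trans (Pr point).
(* As P(x, E) < r, a set on which P(x, .) >= m nu has nu-measure at most r / m = eta. *)
pose m := r / eta; have m0 : 0 < m by rewrite divr_gt0.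
have nufin : (nu [set: E] < +oo)%E by rewrite probability_setT ltry.
pose p x n : set E := [set y | m * rmeas nu (cell A n y) <= rmeas (P x) (cell A n y)].
have sp x n : saturated A n (p x n).
  by move=> y y' e; rewrite /p /=; have -> : cell A n y = cell A n y' by rewrite /cell e.
pose S : set (E * E) := [set z | exists n, p z.1 n z.2].
have mS : measurable S.
  have -> : S = \bigcup_n \bigcup_(b in [set: {ffun 'I_n -> bool}])
      ([set x | m * rmeas nu (bits_set A b) <= fine (P x (bits_set A b))] `*` bits_set A b).
    apply/seteqP; split=> [[x y] [n /= pn]|[x y] [n _ [b _ [/= h e]]]].
      by exists n => //; exists (bits A n y).
    by exists n; rewrite /p /= /cell; rewrite /bits_set /= in e; rewrite e.
  apply: bigcup_measurable => n _; apply: fin_bigcup_measurable; first exact: finite_finset.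
  move=> b _; have mb := measurable_bits_set mA b.
  apply: measurableX => //.
  have := measurable_fine_kernel P mb measurableT (measurable_itv `[m * rmeas nu (bits_set A b), +oo[).
  rewrite setTI; congr measurable; apply/seteqP; split=> x /=; rewrite in_itv/= andbT//.
pose T : R.-fker E ~> E := krestr P (measurableC mS).
have TE x U : T x U = P x (U `&` ~` (xsection S x)).
  rewrite /T /= krestrE; congr (P x (_ `&` _)); apply/seteqP; split=> y.
    by move=> /set_mem nS /set_mem.
  by move=> nS; apply/mem_set => Sxy; apply: nS; exact: mem_set.
have secE x : xsection S x = \bigcup_n p x n.
  apply/seteqP; split=> y; rewrite /xsection /=.
    by move=> /set_mem[n pn]; exists n.
  by move=> [n _ pn]; apply/mem_set; exists n.
have msec x : measurable (xsection S x) by exact: measurable_xsection.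
have small x : (P x (xsection S x) <= c%:E)%E.
  apply: hP => //.
  rewrite -(rmeasE nufin)// lee_fin secE.
  have fh : rmeas nu (\bigcup_n p x n) <= m^-1 * rmeas (P x) (\bigcup_n p x n).
    apply: (first_hitting mA nufin (kernel_setT_fin P x) (sp x)) => n y /= h.
    by rewrite ler_pdivlMl.
  apply: (le_trans fh).
  have -> : eta = m^-1 * r by rewrite /m; field; rewrite !gt_eqF.
  rewrite ler_wpM2l ?invr_ge0 ?(ltW m0)// -secE -lee_fin rmeasE//; last exact: kernel_setT_fin.
  by apply: le_trans (ltW (Pr x)); apply: le_measure; rewrite ?inE.
have TP : kle T P.
  move=> x U mU; rewrite TE; apply: le_measure; rewrite ?inE//.
  by apply: measurableI => //; exact: measurableC.
exists T; split => //.
- apply: (Kstar_dominated mA genA (nu := nu) (m := m)); first exact: ltW.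
  move=> x n y; rewrite /rmeas TE -/(rmeas nu _).
  have mc := measurable_cell mA n y.
  (* A selected cell lies entirely in the removed section, so [T x] vanishes on it; on any other
     cell [P x], hence [T x], is already below m nu. *)
  have [py|/negP] := pselect (p x n y).
    rewrite (_ : _ `&` _ = set0) ?measure0; first by rewrite mulr_ge0 ?rmeas_ge0// ltW.
    apply/seteqP; split=> y' // [e]; rewrite secE; apply; exists n => //.
    by apply: sp py; rewrite e.
  rewrite -ltNge => /ltW; apply: le_trans; apply: rmeas_mono => //.
    exact: kernel_setT_fin.
  by apply: measurableI => //; exact: measurableC.
- apply: opnorm_kop_diff_le => // x; rewrite TE setTI.
  have Pf := kernel_setT_fin P x.
  rewrite -/(rmeas (P x) _) -/(rmeas (P x) (~` _)).
  have -> : [set: E] = xsection S x `|` ~` xsection S x by rewrite setUv.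
  rewrite rmeas_disjU// ?setICr//; last exact: measurableC.
  by rewrite addrK -lee_fin rmeasE.
Qed.

End kernel_density.

(** * Perturbation of operators *)

Section finrank_limits.
Context {R : realType} {V : normedModType R[i]}.
Implicit Types (S T U X B : V -> V).

(** It plays the part of compactness: the expansion uses only that this class is stable under sums,
    compositions with bounded operators and norm limits. *)
Definition finrank_limit X := forall e : R, 0 < e ->
  exists2 U, finrank U & forall v, rnorm (X v - U v) <= e * rnorm v.

Lemma finrank_limitD X Y : finrank_limit X -> finrank_limit Y ->
  finrank_limit (fun v => X v + Y v).
Proof.
move=> hX hY e e0; have e2 : 0 < e / 2 by rewrite divr_gt0.
have [U fU hU] := hX _ e2; have [W fW hW] := hY _ e2.
exists (fun v => U v + W v); first exact: finrankD.
move=> v; rewrite opprD addrACA (le_trans (rnormD _ _))//.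
by rewrite [e in e * _](splitr e) mulrDl lerD.
Qed.

Lemma finrank_limit_compl B X : bdd_lin B -> finrank_limit X ->
  finrank_limit (fun v => B (X v)).
Proof.
move=> bB hX e e0; have [M M0 hM] := bounded_onP bB.2.
have [U fU hU] := hX _ (divr_gt0 e0 M0).
exists (fun v => B (U v)); first exact: finrank_compl.
move=> v; rewrite -(linB linear_subspaceT bB.1)// (le_trans (hM _ _))//.
by rewrite mulrC -ler_pdivlMr// mulrAC hU.
Qed.

Lemma finrank_limit_compr B X : bdd_lin B -> finrank_limit X ->
  finrank_limit (fun v => X (B v)).
Proof.
move=> bB hX e e0; have [M M0 hM] := bounded_onP bB.2.
have [U fU hU] := hX _ (divr_gt0 e0 M0).
exists (fun v => U (B v)); first exact: finrank_compr.
move=> v; rewrite (le_trans (hU _))//.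
rewrite (le_trans (ler_wpM2l _ (hM _ _)))//; first by rewrite divr_ge0// ltW.
by rewrite mulrA divfK// gt_eqF.
Qed.

Lemma finrank_limit0 : finrank_limit (fun=> 0).
Proof.
move=> e e0; exists (fun=> 0); first exact: finrank0.
by move=> v; rewrite subrr rnorm0 mulr_ge0 ?rnorm_ge0// ltW.
Qed.

End finrank_limits.

Section perturbation.
Context {R : realType} {V : normedModType R[i]}.
Variables (S T : V -> V) (C s t : R).
Hypotheses (bS : bdd_lin S) (bT : bdd_lin T).
Hypotheses (C0 : 0 <= C) (s0 : 0 < s) (t0 : 0 <= t).
Hypothesis hS : forall n v, rnorm (iter n S v) <= C * s ^+ n * rnorm v.
Hypothesis hT : forall v, rnorm (T v) <= t * rnorm v.
Hypothesis TST : forall a, finrank_limit (fun v => T (iter a S (T v))).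

Let B v := S v + T v.
Let W n := iteri n (fun k (w : V -> V) v => S (w v) + T (iter k S v)) (fun=> 0).
Let K n := iteri n (fun k (w : V -> V) v => S (w v) + (T (W k v) + T (w v))) (fun=> 0).

Let bB : bdd_lin B. Proof. exact: bdd_linD. Qed.

Let WS n v : W n.+1 v = S (W n v) + T (iter n S v). Proof. by []. Qed.
Let KS n v : K n.+1 v = S (K n v) + (T (W n v) + T (K n v)). Proof. by []. Qed.

(* Expand (S + T)^n: W n collects the words with exactly one letter T and K n
   those with at least two. *)
Lemma iter_perturbation n v : iter n B v = iter n S v + (W n v + K n v).
Proof.
elim: n => [|n ih]; first by rewrite /= addr0 addr0.
rewrite !iterS ih WS KS /B.
rewrite (linD bS.1)// (linD bS.1)// (linD bT.1)// (linD bT.1)//.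
rewrite -!addrA; congr (_ + _); congr (_ + _).
by rewrite addrCA; congr (_ + _).
Qed.

Let cst := C ^+ 2 * t / s.

Let cst0 : 0 <= cst.
Proof. by rewrite /cst divr_ge0 ?(ltW s0)// mulr_ge0// exprn_ge0. Qed.

(** The n words S^j T S^(n-1-j) are each bounded by C^2 t s^(n-1), whence the division by [s] in
    [cst]. Carrying the prefix [iter a S] spares the induction a factor [C] at each step. *)
Lemma single_word_bound n a v :
  rnorm (iter a S (W n v)) <= n%:R * cst * s ^+ (a + n) * rnorm v.
Proof.
have bi k := bdd_lin_iter k bS.
elim: n a => [|n ih] a.
  by rewrite /W /= (lin0 linear_subspaceT (bi a).1) rnorm0 !mul0r.
rewrite WS (linD (bi a).1)// -iterSr.
rewrite (le_trans (rnormD _ _))// -natr1 mulrDl mul1r mulrDl mulrDl lerD//.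
  by rewrite (le_trans (ih _))// addSnnS.
have h1 : rnorm (iter a S (T (iter n S v))) <= C * s ^+ a * (t * (C * s ^+ n * rnorm v)).
  rewrite (le_trans (hS _ _))// ler_wpM2l//; first by rewrite mulr_ge0// exprn_ge0// ltW.
  by rewrite (le_trans (hT _))// ler_wpM2l.
rewrite (le_trans h1)// le_eqVlt; apply/orP; left; apply/eqP.
by rewrite /cst addnS [s ^+ (a + n).+1]exprS exprD; field; rewrite gt_eqF.
Qed.

Let TSW n a : finrank_limit (fun v => T (iter a S (W n v))).
Proof.
have bi k := bdd_lin_iter k bS.
elim: n a => [|n ih] a.
  rewrite (_ : (fun v => _) = fun=> 0); first exact: finrank_limit0.
  apply/funext => v; rewrite /W /= (lin0 linear_subspaceT (bi a).1).
  exact: (lin0 linear_subspaceT bT.1).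
rewrite (_ : (fun v => _) = fun v => T (iter a.+1 S (W n v)) + T (iter a S (T (iter n S v)))).
  apply: finrank_limitD; first exact: ih.
  exact: (finrank_limit_compr (bi n) (TST a)).
by apply/funext => v; rewrite WS (linD (bi a).1)// (linD bT.1)// -iterSr.
Qed.

Lemma multiple_words_limit n : finrank_limit (K n).
Proof.
elim: n => [|n ih]; first exact: finrank_limit0.
rewrite (_ : K n.+1 = fun v => S (K n v) + (T (W n v) + T (K n v))); last exact/funext.
apply: finrank_limitD; first exact: finrank_limit_compl.
by apply: finrank_limitD; [exact: (TSW n 0)|exact: finrank_limit_compl].
Qed.

Lemma perturbation_approx n (e : R) : 0 < e -> exists D U,
  [/\ bdd_lin D, finrank U, forall v, iter n B v = D v + U v &
   forall v, rnorm (D v) <= (C * s ^+ n + n%:R * cst * s ^+ n + e) * rnorm v].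
Proof.
move=> e0; have [U fU hU] := @multiple_words_limit n e e0.
have bBn := bdd_lin_iter n bB.
exists (fun v => iter n B v - U v), U; split => //.
- by apply: bdd_linB => //; exact: finrank_bdd.
- by move=> v; rewrite subrK.
move=> v; have -> : iter n B v - U v = iter n S v + (W n v + (K n v - U v)).
  by rewrite iter_perturbation -!addrA.
rewrite (le_trans (rnormD _ _))// -addrA mulrDl lerD//.
rewrite (le_trans (rnormD _ _))// mulrDl lerD//.
by have := single_word_bound n 0 v; rewrite add0n.
Qed.

End perturbation.

Theorem perturbation_splitting {R : realType} {V : normedModType R[i]}
    (Q S T : V -> V) (l : nat) (rho : R) :
  seq_complete V -> bdd_lin Q -> (0 < l)%N -> 0 < rho -> bdd_lin S -> bdd_lin T ->
  (forall v, iter l Q v = S v + T v) ->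
  (forall a, finrank_limit (fun v => T (iter a S (T v)))) ->
  spectral_radius S < rho ^+ l ->
  exists F H, quasicompact_splitting Q rho F H.
Proof.
move=> cV bQ l0 r0 bS bT QE TST rS.
set r := rho ^+ l in rS; have rl0 : 0 < r by rewrite exprn_gt0.
have stS : stable_under S [set: V] by [].
have [C1 [s1 [s10 s1r hS1]]] := gelfand linear_subspaceT closedT cV bS.1 stS bS.2 rS.
(* The rate [s1] may be 0, while [cst] divides by the rate; the midpoint is positive and still below
   [r]. *)
pose s := (s1 + r) / 2; have s0 : 0 < s by rewrite /s; lra.
have sr : s < r by rewrite /s; lra.
pose C := `|C1|.
have hS n v : rnorm (iter n S v) <= C * s ^+ n * rnorm v.
  rewrite (le_trans (hS1 n v Logic.I))// ler_wpM2r ?rnorm_ge0//.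
  rewrite (@le_trans _ _ (C * s1 ^+ n))//; first by rewrite ler_wpM2r ?exprn_ge0// ler_norm.
  apply: ler_wpM2l; first exact: normr_ge0.
  apply: lerXn2r; rewrite ?nnegrE ?(ltW s0)//; rewrite /s; lra.
have C0 : 0 <= C by rewrite normr_ge0.
have [t t0 hT0] := bounded_onP bT.2.
have hT v : rnorm (T v) <= t * rnorm v by exact: hT0.
pose c := C ^+ 2 * t / s.
have c0 : 0 <= c by rewrite /c divr_ge0 ?(ltW s0)// mulr_ge0 ?exprn_ge0// ltW.
(* A second, larger rate absorbs the number n of one-letter words: with s2 = s (1 + h), Bernoulli's
   inequality gives n h <= (1 + h)^n. *)
pose s2 := (s + r) / 2; have s2r : s2 < r by rewrite /s2; lra.
have ss2 : s < s2 by rewrite /s2; lra.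
have s20 : 0 < s2 by exact: lt_trans ss2.
pose h := (s2 - s) / s; have h0 : 0 < h by rewrite divr_gt0// subr_gt0.
have s2E : s2 = s * (1 + h) by rewrite /h; field; rewrite gt_eqF.
have bern n : n%:R * s ^+ n <= s2 ^+ n / h.
  have b1 : 1 + n%:R * h <= (1 + h) ^+ n.
    elim: n => [|n ih]; first by rewrite mul0r addr0 expr0.
    rewrite exprS -natr1; apply: (@le_trans _ _ ((1 + h) * (1 + n%:R * h))).
      have : 0 <= n%:R :> R by [].
      by set x := n%:R; have := ltW h0; nra.
    by rewrite ler_wpM2l// addr_ge0// ltW.
  rewrite ler_pdivlMr//.
  have -> : n%:R * s ^+ n * h = s ^+ n * (n%:R * h) by ring.
  rewrite s2E [(s * _) ^+ n]exprMn; apply: ler_wpM2l; first by rewrite exprn_ge0// ltW.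
  by apply: le_trans b1; rewrite lerDr.
have q01 : 0 <= s2 / r < 1 by rewrite divr_ge0 ?(ltW s20) ?(ltW rl0)//= ltr_pdivrMr// mul1r.
(* One sixteenth for the short words and one sixteenth for the finite-rank error make delta = r^n /
   8, so that 4 delta = r^n / 2 is below rho^(l n). *)
have [|N hN] := @geo_small R (s2 / r) (C + c / h) 16^-1 q01; first by rewrite invr_gt0.
pose n := N.+1.
have rn0 : 0 < r ^+ n by rewrite exprn_gt0.
have e0 : 0 < r ^+ n / 16 by rewrite divr_gt0.
have [D [U [bD fU BE hD]]] := perturbation_approx bS bT C0 s0 (ltW t0) hS hT TST n e0.
have small : (C + c / h) * s2 ^+ n < r ^+ n / 16.
  have := hN n (leqnSn N); move=> /(le_lt_trans (ler_norm _)).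
  by rewrite expr_div_n mulrA ltr_pdivrMr// [16^-1 * _]mulrC.
have dle : C * s ^+ n + n%:R * c * s ^+ n + r ^+ n / 16 <= r ^+ n / 8.
  have h1 : C * s ^+ n <= C * s2 ^+ n.
    by rewrite ler_wpM2l// lerXn2r ?nnegrE ?(ltW s0) ?(ltW s20) ?(ltW ss2).
  have h2 : n%:R * c * s ^+ n <= c / h * s2 ^+ n.
    have -> : n%:R * c * s ^+ n = c * (n%:R * s ^+ n) by ring.
    have -> : c / h * s2 ^+ n = c * (s2 ^+ n / h) by ring.
    exact: ler_wpM2l c0 _ _ (bern n).
  by move: small; rewrite mulrDl; set x := C * s ^+ n in h1 *; set y := n%:R * c * s ^+ n in h2 *; lra.
apply: (@quasicompact_splitting_exists R V Q D U (l * n) (r ^+ n / 8) rho) => //.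
- by rewrite muln_gt0 l0.
- move=> v; rewrite -BE; elim: (n) v => [|k ih] v; first by rewrite muln0.
  by rewrite mulnS iterD ih iterS QE.
- by rewrite divr_ge0// ltW.
- by move=> v; rewrite (le_trans (hD v))// ler_wpM2r ?rnorm_ge0.
- by rewrite exprM -/r; lra.
Qed.

(** * Compactness of the words in the expansion *)

Section bounded_convergence.
Context {d : measure_display} {E : measurableType d} {R : realType}.
Variable mu : {measure set E -> \bar R}.
Hypothesis mufin : (mu [set: E] < +oo)%E.

Lemma bounded_cvg0 (g : nat -> E -> R) (M : R) : (forall n, bmreal (g n)) ->
  (forall n y, `|g n y| <= M) -> {ae mu, forall y, g^~ y @ \oo --> 0} ->
  \int[mu]_y g n y @[n --> \oo] --> 0.
Proof.
move=> bg gM g0.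
have [|||||_ _ h] := @dominated_convergence d E R mu [set: E] measurableT
  (fun n y => (g n y)%:E) (fun=> 0%E) (fun=> M%:E).
- by move=> n; apply/measurable_EFinP; exact: (bg n).1.
- exact: measurable_cst.
- by apply: filterS g0 => y hy _; apply: cvg_EFin => //; exact: nearW.
- exact: (bmreal_integrable mufin (bmreal_cst M)).
- by apply: aeW => y n _; rewrite /= lee_fin.
rewrite integral0 in h; move/fine_cvgP: h => [_].
by apply: cvg_trans; apply: near_eq_cvg; exact: nearW.
Qed.

End bounded_convergence.

Section integral_density.
Context {d : measure_display} {E : measurableType d} {R : realType}.
Variables (mu nu : {measure set E -> \bar R}).
Hypotheses (mufin : (mu [set: E] < +oo)%E) (nufin : (nu [set: E] < +oo)%E).
Variables (beta : E -> R) (bb : bmreal beta) (b0 : forall y, 0 <= beta y).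
Hypothesis hD : forall D, measurable D -> (\int[nu]_(y in D) (beta y)%:E)%E = mu D.

Let Lam (f : E -> R) := \int[mu]_y f y - \int[nu]_y (f y * beta y).

Let LamD f g : bmreal f -> bmreal g -> Lam (fun y => f y + g y) = Lam f + Lam g.
Proof.
move=> bf bg; rewrite /Lam bmreal_RintegralD//.
rewrite (_ : (fun y => (f y + g y) * beta y) = fun y => f y * beta y + g y * beta y).
  by rewrite bmreal_RintegralD//; [ring|exact: bmrealM..].
by apply/funext => y; rewrite mulrDl.
Qed.

Let LamZ c f : bmreal f -> Lam (fun y => c * f y) = c * Lam f.
Proof.
move=> bf; rewrite /Lam bmreal_RintegralZ//.
rewrite (_ : (fun y => c * f y * beta y) = fun y => c * (f y * beta y)).
  by rewrite bmreal_RintegralZ//; [ring|exact: bmrealM].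
by apply/funext => y; rewrite mulrA.
Qed.

Let Lam_indic D : measurable D -> Lam (\1_D) = 0.
Proof.
move=> mD; rewrite /Lam; apply/eqP; rewrite subr_eq0; apply/eqP.
apply: EFin_inj; have bD := @bmreal_indic d E R D mD.
rewrite !bmreal_RintegralE//; last exact: bmrealM.
rewrite integral_indic// setIT -hD// integral_mkcond; apply: eq_integral => y _.
by rewrite patchE indicE; case: ifP => _; rewrite ?mul1r ?mul0r.
Qed.

Let Lam_bound f e : bmreal f -> (forall y, `|f y| <= e) ->
  `|Lam f| <= e * (rmeas mu [set: E] + \int[nu]_y beta y).
Proof.
move=> bf fe.
have e0 : 0 <= e by exact: le_trans (normr_ge0 _) (fe point).
rewrite /Lam (le_trans (ler_normB _ _))// mulrDr lerD//.
  rewrite (le_trans (le_normr_Rintegral _ _))//; first exact: bmreal_integrable.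
  rewrite -Rintegral_cst//; apply: bmreal_le_Rintegral => //; last exact: bmreal_cst.
  by split; [apply: measurableT_comp => //; exact: bf.1|exists e => y; rewrite normr_id].
rewrite (le_trans (le_normr_Rintegral _ _))//.
  by apply: bmreal_integrable => //; exact: bmrealM.
rewrite -bmreal_RintegralZ//; apply: bmreal_le_Rintegral => //.
- have bfb := bmrealM bf bb; split; first by apply: measurableT_comp => //; exact: bfb.1.
  by have [M hM] := bfb.2; exists M => y; rewrite normr_id.
- exact: bmrealZ.
- by move=> y; rewrite normrM (ger0_norm (b0 y)) ler_wpM2r.
Qed.

(** A layer-cake sum: when 0 <= n f <= N it equals the integer part of n f, so dividing by n
    approximates f uniformly within 1 / n, and [Lam] vanishes on each indicator. *)
Let Lam_layers (f : E -> R) (n N : nat) : measurable_fun [set: E] f ->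
  bmreal (fun y => \sum_(i < N) (\1_[set y | i.+1%:R <= n%:R * f y] y : R)) /\
  Lam (fun y => \sum_(i < N) (\1_[set y | i.+1%:R <= n%:R * f y] y : R)) = 0.
Proof.
move=> mf.
have mD (c : R) : measurable [set y | c <= n%:R * f y].
  have mg : measurable_fun [set: E] (fun y => n%:R * f y).
    by apply: measurable_funM => //; exact: measurable_cst.
  have := mg measurableT _ (measurable_itv `[c, +oo[); rewrite setTI.
  by congr measurable; apply/seteqP; split=> y /=; rewrite in_itv/= andbT.
elim: N => [|N [bN ih]].
  rewrite (_ : (fun y => _) = fun=> 0); last by apply/funext => y; rewrite big_ord0.
  split; first exact: bmreal_cst.
  rewrite -[RHS](mul0r (Lam (fun=> 0))) -(LamZ 0 (@bmreal_cst _ E R 0)).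
  by congr Lam; apply/funext => y; rewrite mul0r.
rewrite (_ : (fun y => _) = fun y => \sum_(i < N) (\1_[set y | i.+1%:R <= n%:R * f y] y : R)
    + \1_[set y | N.+1%:R <= n%:R * f y] y); last first.
  by apply/funext => y; rewrite big_ord_recr.
have bI := @bmreal_indic d E R _ (mD N.+1%:R).
by split; [exact: bmrealD|rewrite LamD// ih Lam_indic// addr0].
Qed.

Let layers_close (f : E -> R) (n N : nat) (y : E) : (0 < n)%N -> 0 <= f y ->
  n%:R * f y <= N%:R ->
  `|n%:R^-1 * (\sum_(i < N) (\1_[set y | i.+1%:R <= n%:R * f y] y : R)) - f y| <= n%:R^-1.
Proof.
move=> n0 f0 fN; set x := n%:R * f y.
have x0 : 0 <= x by rewrite mulr_ge0.
have xE : f y = n%:R^-1 * x by rewrite /x mulKf// pnatr_eq0 -lt0n.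
pose k := Num.truncn x.
have kN : (k <= N)%N.
  by rewrite -(ler_nat R); apply: le_trans fN; have /andP[] := truncn_itv x0.
have -> : \sum_(i < N) (\1_[set y | i.+1%:R <= n%:R * f y] y : R) = k%:R.
  have -> : k%:R = \sum_(i < N) (if (i < k)%N then 1 else 0) :> R.
    by rewrite -big_mkcond/= -(big_ord_widen N (fun=> 1))// sumr_const card_ord.
  apply: eq_bigr => i _; rewrite indicE; case: ifP => ik.
    by rewrite mem_set//= -truncn_ge_nat.
  by rewrite memNset//= -truncn_ge_nat// -/x -/k ik.
rewrite xE -mulrBr normrM gtr0_norm ?invr_gt0 ?ltr0n// ler_piMr ?invr_ge0//.
have := truncn_itv x0; rewrite -/k -natr1 => /andP[h1 h2].
by rewrite ler_norml; apply/andP; split; lra.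
Qed.

Let Lam_ge0_fun (f : E -> R) : bmreal f -> (forall y, 0 <= f y) -> Lam f = 0.
Proof.
move=> bf f0; have [mf [M fM]] := bf.
pose C := rmeas mu [set: E] + \int[nu]_y beta y.
have C0 : 0 <= C by rewrite addr_ge0 ?rmeas_ge0// Rintegral_ge0.
apply/eqP; rewrite -normr_le0; apply/ler_addgt0Pr => e e0; rewrite add0r.
pose n := (Num.truncn (C / e)).+1.
have nC : C <= e * n%:R by rewrite mulrC -ler_pdivrMr// ltW// truncnS_gt.
pose N := (Num.truncn (n%:R * M)).+1.
have [bs Ls] := @Lam_layers f n N mf.
set s := (fun y => \sum_(i < N) _) in bs Ls.
have bs' := bmrealZ n%:R^-1 bs.
have -> : f = fun y => n%:R^-1 * s y - (n%:R^-1 * s y - f y) by apply/funext => y; rewrite subKr.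
have bg := bmrealB bs' bf.
have -> : Lam (fun y => n%:R^-1 * s y - (n%:R^-1 * s y - f y)) = - Lam (fun y => n%:R^-1 * s y - f y).
  have := LamD bs' (bmrealZ (-1) bg); rewrite !LamZ// Ls mulr0 add0r mulN1r => <-.
  by congr Lam; apply/funext => y; rewrite mulN1r.
rewrite normrN (le_trans (Lam_bound (e := n%:R^-1) bg _))//.
  move=> y; apply: layers_close => //.
  rewrite (@le_trans _ _ (n%:R * M))//; last by rewrite ltW// truncnS_gt.
  by rewrite ler_wpM2l// (le_trans (ler_norm _)).
by rewrite ler_pdivrMl ?ltr0n// mulrC.
Qed.

(** [Lam] vanishes on step functions and is continuous for uniform convergence, hence vanishes on
    bounded nonnegative functions; shifting by a constant handles signs. *)
Lemma Rintegral_density (f : E -> R) : bmreal f ->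
  \int[mu]_y f y = \int[nu]_y (f y * beta y).
Proof.
move=> bf; apply/eqP; rewrite -subr_eq0; apply/eqP; rewrite -/(Lam f).
have [mf [M fM]] := bf; have bM := @bmreal_cst _ E R M.
have M0 : 0 <= M by exact: le_trans (normr_ge0 _) (fM point).
have := LamD bf bM; rewrite (Lam_ge0_fun (bmrealD bf bM)); last first.
  by move=> y; have := fM y; rewrite ler_norml => /andP[+ _]; lra.
by rewrite (Lam_ge0_fun bM)// addr0 => <-.
Qed.

End integral_density.

Lemma finrank_sum {R : realType} {V : normedModType R[i]} (J : Type) (s : seq J)
    (phi : J -> V -> R[i]) (e : J -> V) : (forall j, bdd_form (phi j)) ->
  finrank (fun v => \sum_(j <- s) phi j v *: e j).
Proof.
move=> hphi; elim: s => [|j s ih].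
  rewrite (_ : (fun v => _) = fun=> 0); first exact: finrank0.
  by apply/funext => v; rewrite big_nil.
rewrite (_ : (fun v => _) = fun v => phi j v *: e j + \sum_(j <- s) phi j v *: e j).
  apply: finrankD => //; exists 1%N, (fun=> phi j), (fun=> e j); split => //.
  by move=> v; rewrite big_ord1.
by apply/funext => v; rewrite big_cons.
Qed.

Section weighted_integral.
Context {d : measure_display} {E : measurableType d} {R : realType}.
Variables (mu : {measure set E -> \bar R}) (g : E -> R).
Hypotheses (mufin : (mu [set: E] < +oo)%E) (bg : bmreal g).

Definition cintegral (f : bmfun E R) : R[i] :=
  (\int[mu]_y (complex.Re (f y) * g y)) +i* (\int[mu]_y (complex.Im (f y) * g y)).

Let Rintegral_norm_le (h : E -> R) (M : R) : bmreal h -> (forall y, `|h y| <= M) ->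
  `|\int[mu]_y (h y * g y)| <= (\int[mu]_y `|g y|) * M.
Proof.
move=> bh hM; have b := bmrealM bh bg; rewrite mulrC -bmreal_RintegralZ//; last exact: bmreal_norm.
apply: le_trans (le_normr_Rintegral _ _) _ => //; first exact: bmreal_integrable.
apply: bmreal_le_Rintegral => //; [exact: bmreal_norm|exact/bmrealZ/bmreal_norm|].
by move=> y; rewrite normrM ler_wpM2r.
Qed.

Lemma bdd_form_cintegral : bdd_form cintegral.
Proof.
split=> [a f h|]; last first.
  exists (2 * \int[mu]_y `|g y|) => f; apply: le_trans (cmod_le_ReIm _) _ => /=.
  rewrite -mulrA mulr_natl mulr2n; apply: lerD; apply: Rintegral_norm_le.
  - exact: bmreal_Re.
  - by move=> y; apply: le_trans (cmod_Re _) (rnorm_ub f y).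
  - exact: bmreal_Im.
  - by move=> y; apply: le_trans (cmod_Im _) (rnorm_ub f y).
have b1 := bmrealM (bmreal_Re f) bg; have b2 := bmrealM (bmreal_Im f) bg.
have b3 := bmrealM (bmreal_Re h) bg; have b4 := bmrealM (bmreal_Im h) bg.
have c1 := bmrealZ (complex.Re a) b1; have c2 := bmrealZ (complex.Im a) b2.
have c3 := bmrealZ (complex.Re a) b2; have c4 := bmrealZ (complex.Im a) b1.
have e1 : (fun y => complex.Re ((a *: f + h) y) * g y) = fun y =>
    complex.Re a * (complex.Re (f y) * g y) - complex.Im a * (complex.Im (f y) * g y) +
    complex.Re (h y) * g y.
  apply/funext => y; change ((a *: f + h) y) with (a * f y + h y).
  by case: a {c1 c2 c3 c4} (f y) (h y) => [? ?] [? ?] [? ?] /=; ring.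
have e2 : (fun y => complex.Im ((a *: f + h) y) * g y) = fun y =>
    complex.Re a * (complex.Im (f y) * g y) + complex.Im a * (complex.Re (f y) * g y) +
    complex.Im (h y) * g y.
  apply/funext => y; change ((a *: f + h) y) with (a * f y + h y).
  by case: a {c1 c2 c3 c4 e1} (f y) (h y) => [? ?] [? ?] [? ?] /=; ring.
rewrite /cintegral e1 e2 (bmreal_RintegralD mufin (bmrealB c1 c2) b3).
rewrite (bmreal_RintegralD mufin (bmrealD c3 c4) b4) (bmreal_RintegralB mufin c1 c2).
rewrite (bmreal_RintegralD mufin c3 c4) !bmreal_RintegralZ//.
by case: a {c1 c2 c3 c4 e1 e2}.
Qed.

End weighted_integral.

(** * Finite-rank approximation by conditioning on cells *)

Section cell_approximation.
Context {d : measure_display} {E : measurableType d} {R : realType}.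
Variables (A : nat -> set E) (mA : forall n, measurable (A n)).
Hypothesis genA : d.-measurable = <<s range A >>.
Variables (T L : R.-fker E ~> E) (nu : probability E R) (m : R).
Hypothesis m0 : 0 <= m.
Hypothesis dom : forall x n y, rmeas (T x) (cell A n y) <= m * rmeas nu (cell A n y).

Let nufin : (nu [set: E] < +oo)%E.
Proof. by rewrite probability_setT ltry. Qed.

Let Tfin x := kernel_setT_fin T x.
(** The conditional expectation of the density [beta x] on the level-n partition; [delta] below is
    the L1(nu) distance between the two. *)
Let rho n x y : R := cell_ratio A (T x) nu n y.
Let beta x y : R := ratio_limit A (T x) nu y.

Let rho_bm n x : bmreal (rho n x).
Proof. exact: (ratio_bmreal mA m0 (dom x) n). Qed.
Let beta_bm x : bmreal (beta x).
Proof. exact: (ratio_limit_bmreal mA m0 (dom x)). Qed.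
Let rho_b n x y : 0 <= rho n x y <= m.
Proof. exact: (ratio_bounds m0 (dom x) n y). Qed.
Let beta_b x y : 0 <= beta x y <= m.
Proof. exact: (ratio_limit_bounds m0 (dom x) y). Qed.

Let kint_beta g x : bmreal g -> kint T g x = \int[nu]_y (g y * beta x y).
Proof.
move=> bg; apply: Rintegral_density => //.
  by move=> y; have /andP[] := beta_b x y.
by move=> D mD; exact: (ratio_limit_integral mA genA (Tfin x) nufin m0 (dom x)).
Qed.

Let kint_nu h x : bmreal h -> (forall y, 0 <= h y) -> kint T h x <= m * \int[nu]_y h y.
Proof.
move=> bh h0; rewrite kint_beta// -bmreal_RintegralZ//.
apply: bmreal_le_Rintegral => //; [exact: bmrealM|exact: bmrealZ|].
by move=> y; rewrite mulrC ler_wpM2r//; have /andP[] := beta_b x y.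
Qed.

Let diff n x y := `|rho n x y - beta x y|.

Let diff_bm n x : bmreal (diff n x).
Proof.
exact: bmreal_norm (bmrealB (rho_bm n x) (beta_bm x)).
Qed.

Let diff_le n x y : diff n x y <= m.
Proof.
have /andP[? ?] := rho_b n x y; have /andP[? ?] := beta_b x y.
by rewrite /diff ler_norml; apply/andP; split; lra.
Qed.

Let delta n x : R := \int[nu]_y diff n x y.

Let delta_ge0 n x : 0 <= delta n x.
Proof. by apply: Rintegral_ge0 => y _; exact: normr_ge0. Qed.

Let delta_le n x : delta n x <= m.
Proof.
have -> : m = \int[nu]_(y in [set: E]) m by rewrite Rintegral_cst// [fine _](congr1 fine (probability_setT nu)) mulr1.
apply: bmreal_le_Rintegral => //; exact: bmreal_cst.
Qed.

Let rho_joint n : measurable_fun [set: E * E] (fun z => rho n z.1 z.2).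
Proof. exact: (measurable_cell_ratio mA T nu n). Qed.

Let delta_bm n : bmreal (delta n).
Proof.
split; last by exists m => x; rewrite ger0_norm.
apply: measurableT_comp => //.
apply: (@measurable_fun_fubini_tonelli_F _ _ _ _ _ nu (fun z : E * E => (diff n z.1 z.2)%:E)).
  apply/measurable_EFinP; apply: measurableT_comp => //.
  apply: measurable_funB; first exact: rho_joint.
  exact: (measurable_kernel_density mA m0 dom).
by move=> z; rewrite lee_fin normr_ge0.
Qed.

Let delta_cvg0 x : delta n x @[n --> \oo] --> 0.
Proof.
apply: (bounded_cvg0 nufin (M := m)) => // [n y|].
  by rewrite normr_id; exact: diff_le.
apply: filterS (ratio_cvg_ae mA genA (Tfin x) nufin m0 (dom x)) => y hy.
rewrite -(normr0 R); apply: cvg_norm.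
by rewrite -(subrr (beta x y)); apply: cvgB; [exact: hy|exact: cvg_cst].
Qed.

(** [delta n] tends to 0 pointwise but not uniformly; two bounded convergences, under L and then
    under [nu], produce a single number tending to 0. *)
Let Ldelta_cvg0 : \int[nu]_x kint L (delta n) x @[n --> \oo] --> 0.
Proof.
have bL n : bmreal (kint L (delta n)) by exact: kint_bmreal.
have [r Lr] := measure_uub L.
apply: (bounded_cvg0 nufin (M := m * r)) => // [n x|].
  rewrite ger0_norm ?kint_ge0//.
  rewrite (@le_trans _ _ (kint L (fun=> m) x))//.
    by apply: kint_le => //; exact: bmreal_cst.
  rewrite kint_cst ler_wpM2l// -lee_fin fineK ?kernel_fin//; exact: ltW.
apply: aeW => x; apply: (bounded_cvg0 (kernel_setT_fin L x) (M := m)) => //.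
  by move=> n y; rewrite ger0_norm.
by apply: aeW => y; exact: delta_cvg0.
Qed.

Let phi n (b : {ffun 'I_n -> bool}) := cintegral nu (\1_(bits_set A b) : E -> R).

Let coef n (b : {ffun 'I_n -> bool}) x : R :=
  fine (T x (bits_set A b)) / rmeas nu (bits_set A b).

Let coef_bm n b : bmreal (@coef n b).
Proof.
have mb := measurable_bits_set mA b.
have [r Tr] := measure_uub T.
split; first by apply: measurable_funM; [exact: measurable_fine_kernel|exact: measurable_cst].
exists (r / rmeas nu (bits_set A b)) => x.
rewrite ger0_norm /coef ?divr_ge0 ?fine_ge0// ler_wpM2r ?invr_ge0 ?rmeas_ge0//.
rewrite -lee_fin fineK ?kernel_fin//; apply: le_trans (ltW (Tr x)).
by apply: le_measure; rewrite ?inE.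
Qed.

Let evec n (b : {ffun 'I_n -> bool}) : bmfun E R :=
  Bmfun (bmcomplex_subproof (coef_bm b) (@bmreal_cst _ E R 0)).

Let phi_form n b : bdd_form (@phi n b).
Proof. by apply: bdd_form_cintegral => //; exact/bmreal_indic/measurable_bits_set. Qed.

(** The integral operator with density [rho n] with respect to [nu]; its rank is finite because
    [rho n] separates variables over the finitely many cells. *)
Let Vn n (f : bmfun E R) : bmfun E R :=
  \sum_(b <- index_enum {ffun 'I_n -> bool}) phi b f *: evec b.

Let Vn_E n f x : Vn n f x = cintegral nu (rho n x) f.
Proof.
have ind (b : {ffun 'I_n -> bool}) : bmreal (\1_(bits_set A b) : E -> R) by exact/bmreal_indic/measurable_bits_set.
have key g : bmreal g -> \int[nu]_y (g y * rho n x y) =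
    \sum_(b : {ffun 'I_n -> bool}) coef b x * \int[nu]_y (g y * \1_(bits_set A b) y).
  move=> bg; have bb (b : {ffun 'I_n -> bool}) : bmreal (fun y => coef b x * (g y * \1_(bits_set A b) y)).
    by apply: bmrealZ; exact: bmrealM.
  have -> : (fun y => g y * rho n x y) = fun y => \sum_(b : {ffun 'I_n -> bool})
      coef b x * (g y * \1_(bits_set A b) y).
    apply/funext => y; rewrite /rho cell_ratio_sum mulr_sumr.
    by apply: eq_bigr => b _; rewrite mulrCA.
  rewrite (bmreal_Rintegral_sum nufin _ _ bb).2; apply: eq_bigr => b _.
  by rewrite bmreal_RintegralZ//; exact: bmrealM.
rewrite /cintegral !key; [|exact: bmreal_Im|exact: bmreal_Re].
rewrite /Vn; elim: (index_enum _) => [|b s ih]; first by rewrite !big_nil.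
rewrite !big_cons [LHS](_ : _ = phi b f * evec b x +
  (\sum_(b <- s) phi b f *: evec b) x)// ih /evec/= /phi/cintegral/=.
by apply/eqP; rewrite eq_complex/=; apply/andP; split; apply/eqP; ring.
Qed.

(** The factor 2 comes from estimating real and imaginary parts separately. *)
Let close n f x : cmod (kop T f x - Vn n f x) <= 2 * rnorm f * delta n x.
Proof.
rewrite kop_E Vn_E !kint_beta; [|exact: bmreal_Im|exact: bmreal_Re].
apply: le_trans (cmod_le_ReIm _) _; rewrite !raddfB/= -mulrA mulr_natl mulr2n.
have key g : bmreal g -> (forall y, `|g y| <= rnorm f) ->
    `|\int[nu]_y (g y * beta x y) - \int[nu]_y (g y * rho n x y)| <= rnorm f * delta n x.
  move=> bg hg.
  have b1 := bmrealM bg (beta_bm x); have b2 := bmrealM bg (rho_bm n x).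
  have b3 := bmrealB b1 b2.
  rewrite -bmreal_RintegralB// -bmreal_RintegralZ//.
  apply: le_trans (le_normr_Rintegral _ _) _ => //; first exact: bmreal_integrable.
  apply: bmreal_le_Rintegral => //; last 2 first.
  - exact: bmrealZ.
  - move=> y; rewrite -mulrBr normrM ler_pM// /diff distrC//.
  exact: bmreal_norm.
apply: lerD; apply: key.
- exact: bmreal_Re.
- by move=> y; apply: le_trans (cmod_Re _) (rnorm_ub f y).
- exact: bmreal_Im.
- by move=> y; apply: le_trans (cmod_Im _) (rnorm_ub f y).
Qed.

(** The outer T is at most m nu for every x, so the error is bounded independently of x by m times
    the nu-integral of [kint L (delta n)]. *)
Lemma cell_approximation (e : R) : 0 < e -> exists2 U, finrank U &
  forall (f : bmfun E R) x,
    kint T (kint L (fun y => cmod ((kop T f - U f) y))) x <= e * rnorm f.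
Proof.
(* The + 1 keeps the divisor positive when [m] = 0. *)
move=> e0; have m2 : 0 < 2 * m + 1 by rewrite ltr_wpDl// mulr_ge0.
have /cvgrPdist_lt/(_ _ (divr_gt0 e0 m2))[n _ /(_ n (leqnn n))] := Ldelta_cvg0.
rewrite /= sub0r normrN => hn.
exists (Vn n); first exact: finrank_sum (@phi_form n).
move=> f x.
have bL : bmreal (kint L (delta n)) by exact: kint_bmreal.
have bc := bmreal_cmod (kop T f - Vn n f).
have h1 y : kint L (fun y => cmod ((kop T f - Vn n f) y)) y <= (2 * rnorm f) * kint L (delta n) y.
  rewrite -kintZ//; apply: kint_le => //; [exact: bmrealZ|].
  by move=> z; exact: close.
apply: (@le_trans _ _ (kint T (fun y => (2 * rnorm f) * kint L (delta n) y) x)).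
  by apply: kint_le => //; [exact: kint_bmreal|exact: bmrealZ].
rewrite kintZ// (le_trans (ler_wpM2l _ (kint_nu x bL _)))//.
- by rewrite mulr_ge0// rnorm_ge0.
- by move=> y; exact: kint_ge0.
have h2 : (2 * m) * \int[nu]_x0 kint L (delta n) x0 <= e.
  move: hn => /(le_lt_trans (ler_norm _)); rewrite ltr_pdivlMr// => hn.
  rewrite mulrC; apply: le_trans (ltW hn).
  by rewrite ler_wpM2l ?lerDl// Rintegral_ge0// => y _; exact: kint_ge0.
have := ler_wpM2r (rnorm_ge0 f) h2.
by rewrite (_ : 2 * rnorm f * _ = 2 * m * \int[nu]_x0 kint L (delta n) x0 * rnorm f)//; ring.
Qed.

End cell_approximation.

Lemma finrank_limit_closed {R : realType} {V : normedModType R[i]} (X : V -> V) :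
  (forall e : R, 0 < e -> exists2 Y, finrank_limit Y &
    forall v, rnorm (X v - Y v) <= e * rnorm v) -> finrank_limit X.
Proof.
move=> h e e0; have e2 : 0 < e / 2 by rewrite divr_gt0.
have [Y fY hY] := h _ e2; have [U fU hU] := fY _ e2.
exists U => // v; apply: le_trans (rnorm_triangle _ (Y v) _) _.
by rewrite [e in e * _](splitr e) mulrDl lerD.
Qed.

(** * Words with two factors in [Kstar] *)

Section kstar_compactness.
Context {d : measure_display} {E : measurableType d} {R : realType}.
Implicit Types (B T L : R.-fker E ~> E) (f : bmfun E R).

Lemma rnorm_kop_le T f (r : R) : (forall x, fine (T x [set: E]) <= r) ->
  rnorm (kop T f) <= r * rnorm f.
Proof.
move=> Tr; apply: rnorm_le => x; apply: le_trans (kint_abs T f x) _.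
rewrite (@le_trans _ _ (kint T (fun=> rnorm f) x))//.
  by apply: kint_le; [exact: bmreal_cmod|exact: bmreal_cst|exact: rnorm_ub].
by rewrite kint_cst mulrC ler_wpM2r ?rnorm_ge0.
Qed.

(** B - T is positive and dominated by B, so its iterates are dominated by the powers of B, which
    are genuine kernels and can serve as the [L] of [cell_approximation]. *)
Lemma iter_kop_diff_abs B T a f x : kle T B ->
  cmod (iter a (kop B \- kop T) f x) <= kint (kpow B a) (fun y => cmod (f y)) x.
Proof.
move=> TB; have bf := bmreal_cmod f.
elim: a x => [|a ih] x; first by rewrite /= kint_kid.
rewrite iterS; set g := iter a _ f in ih *.
apply: (le_trans (kint_abs_diff g x TB)).
rewrite (@le_trans _ _ (kint B (fun y => cmod (g y)) x))//.
  by rewrite lerBlDr lerDl kint_ge0// => y; exact: cmod_ge0.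
rewrite [kpow _ _](_ : _ = kmul B (kpow B a))// kint_kmul//.
by apply: kint_le => //; [exact: bmreal_cmod|exact: kint_bmreal].
Qed.

(** Cutting the density at a high level [M] removes, uniformly in x, the tail mass controlled by
    [Hclass], and what remains is at most M nu. *)
Lemma Kstar_truncation T (e : R) : Kstar T -> 0 < e ->
  exists (nu : probability E R) T1 (M : R), [/\ 0 <= M, kle T1 T,
    opnorm (kop T \- kop T1) <= e &
    forall x D, measurable D -> rmeas (T1 x) D <= M * rmeas nu D].
Proof.
move=> [nu [alpha [[malpha alpha0 hlim] hT]]] e0.
have /hlim : nbhs 0%E [set z : \bar R | (z < e%:E)%E].
  by apply: open_nbhs_nbhs; split; [exact: open_ereal_lt_ereal|rewrite /= lte_fin].
move=> [M0 [_ hM0]]; pose M := Num.max (M0 + 1) 1.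
have {hM0} hM : (ereal_sup [set r : \bar R | exists x : E,
    r = (\int[nu]_(y in [set y | (M <= alpha (x, y))%R]) (alpha (x, y))%:E)%E] < e%:E)%E.
  by apply: hM0; rewrite /M lt_max ltrDl ltr01.
have Mge0 : 0 <= M by rewrite /M le_max ler01 orbT.
have nufin : (nu [set: E] < +oo)%E by rewrite probability_setT ltry.
pose S : set (E * E) := [set z | alpha z < M].
have mS : measurable S.
  have := malpha measurableT _ (measurable_itv `]-oo, M[); rewrite setTI.
  by congr measurable; apply/seteqP; split=> z /=; rewrite in_itv.
have secE x : xsection S x = [set y | alpha (x, y) < M].
  by apply/seteqP; split=> y; [move/set_mem|move=> ?; apply/mem_set].
have msec x : measurable (xsection S x) by exact: measurable_xsection.
have secC x : ~` xsection S x = [set y | M <= alpha (x, y)].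
  by rewrite secE; apply/seteqP; split=> y /=; [move/negP; rewrite -leNgt|move=> ?; apply/negP; rewrite -leNgt].
pose T1 : R.-fker E ~> E := krestr T mS.
have T1E x U : T1 x U = T x (U `&` xsection S x) by [].
have T1T : kle T1 T.
  by move=> x A mA; rewrite T1E; apply: le_measure; rewrite ?inE//; exact: measurableI.
exists nu, T1, M; split => //.
  apply: opnorm_kop_diff_le => // x; rewrite T1E setTI.
  have Tf := kernel_setT_fin T x; have mc := measurableC (msec x).
  rewrite -/(rmeas (T x) _) -/(rmeas (T x) (xsection S x)).
  have -> : [set: E] = xsection S x `|` ~` xsection S x by rewrite setUv.
  rewrite rmeas_disjU ?setICr// addrC addKr -lee_fin rmeasE// hT// secC.
  by apply: le_trans (ltW hM); apply: ereal_sup_ubound; exists x.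
move=> x D mD; have mDS : measurable (D `&` xsection S x) by exact: measurableI.
rewrite -lee_fin EFinM !rmeasE//; last exact: kernel_setT_fin.
rewrite T1E hT// /Tfun.
have ma : measurable_fun [set: E] (fun y => alpha (x, y)) by exact: measurableT_comp.
apply: (@le_trans _ _ (\int[nu]_(y in D `&` xsection S x) (M%:E))%E).
  apply: ge0_le_integral => //.
  - by move=> y _; rewrite lee_fin.
  - by apply/measurable_EFinP; exact: measurable_funS ma.
  - by move=> y [_]; rewrite secE /= lee_fin => /ltW.
rewrite integral_cst// lee_wpmul2l ?lee_fin//; apply: le_measure; rewrite ?inE//.
Qed.

Theorem Kstar_words_limit B T a : countably_generated E -> kle T B -> Kstar T ->
  finrank_limit (fun f => kop T (iter a (kop B \- kop T) (kop T f))).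
Proof.
move=> /countably_generated_seq[A [mA genA]] TB KT.
set S := kop B \- kop T.
have bT := kop_bdd_lin T.
have bS : bdd_lin S by apply: bdd_linB => //; exact: kop_bdd_lin.
have [r Tr] := measure_uub T.
have r0 : 0 < r by rewrite -lte_fin; apply: le_lt_trans (Tr point).
have [N N0 hN] := bounded_onP (bdd_lin_iter a bS).2.
have normT T1 f : kle T1 T -> rnorm (kop T1 f) <= r * rnorm f.
  move=> T1T; apply: rnorm_kop_le => x.
  by rewrite -lee_fin fineK ?kernel_fin// (le_trans (T1T _ _ measurableT))// ltW.
have linS f g : iter a S (f - g) = iter a S f - iter a S g.
  by rewrite (linB linear_subspaceT (bdd_lin_iter a bS).1).
have linK K f g : kop K (f - g) = kop K f - kop K g.
  by rewrite (linB linear_subspaceT (kop_bdd_lin K).1).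
apply: finrank_limit_closed => e e0.
(* Each of the two outer factors is replaced by its truncation at cost e / 2: [N] bounds the middle
   iterate, and [r] the factor T or T1 left in place. *)
have e1 : 0 < e / (2 * N * r) by rewrite divr_gt0// !mulr_gt0.
have [nu [T1 [M [M0 T1T TT1 T1M]]]] := Kstar_truncation KT e1.
have hTT1 f : rnorm (kop T f - kop T1 f) <= e / (2 * N * r) * rnorm f.
  have b : bdd_lin (kop T \- kop T1) by apply: bdd_linB; exact: kop_bdd_lin.
  by apply: le_trans (opnorm_ub f b) _; rewrite ler_wpM2r ?rnorm_ge0.
exists (fun f => kop T1 (iter a S (kop T1 f))); last first.
  move=> f; apply: le_trans (rnorm_triangle _ (kop T1 (iter a S (kop T f))) _) _.
  have n1 : rnorm (iter a S (kop T f)) <= N * (r * rnorm f).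
    apply: le_trans (hN _ Logic.I) _; rewrite ler_wpM2l ?(ltW N0)//.
    by apply: normT => x U mU.
  have h1 := le_trans (hTT1 _) (ler_wpM2l (ltW e1) n1).
  have h2 : rnorm (kop T1 (iter a S (kop T f)) - kop T1 (iter a S (kop T1 f))) <=
      r * (N * (e / (2 * N * r) * rnorm f)).
    rewrite -linK -linS; apply: le_trans (normT _ _ T1T) _; rewrite ler_wpM2l ?(ltW r0)//.
    by apply: le_trans (hN _ Logic.I) _; rewrite ler_wpM2l ?(ltW N0).
  apply: le_trans (lerD h1 h2) _.
  rewrite le_eqVlt; apply/orP; left; apply/eqP; field.
  by rewrite !gt_eqF.
move=> c c0.
have dom x n y : rmeas (T1 x) (cell A n y) <= M * rmeas nu (cell A n y).
  by apply: T1M; exact: measurable_cell.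
have [U fU hU] := cell_approximation mA genA (kpow B a) M0 dom c0.
exists (fun f => kop T1 (iter a S (U f))).
  apply: finrank_compl; first exact: kop_bdd_lin.
  by apply: finrank_compl => //; exact: bdd_lin_iter.
move=> f; rewrite -linK -linS; apply: rnorm_le => x.
apply: le_trans (kint_abs _ _ _) _; apply: le_trans (hU f x).
apply: kint_le; [exact: bmreal_cmod|exact/kint_bmreal/bmreal_cmod|].
by move=> y; exact: iter_kop_diff_abs.
Qed.

End kstar_compactness.

Lemma powR_rootK {R : realType} (a : R) l : (0 < l)%N -> 0 <= a -> (a `^ l%:R^-1) ^+ l = a.
Proof.
by move=> l0 a0; rewrite -powR_mulrn ?powR_ge0// -powRrM mulVf ?powRr1// pnatr_eq0 -lt0n.
Qed.

Lemma powR_root_le {R : realType} (a x : R) l : (0 < l)%N -> 0 <= a -> 0 <= x ->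
  (a `^ l%:R^-1 <= x) = (a <= x ^+ l).
Proof.
by move=> l0 a0 x0; rewrite -[in RHS](powR_rootK l0 a0) ler_pXn2r// nnegrE powR_ge0.
Qed.

Lemma powR_root_ge {R : realType} (a x : R) l : (0 < l)%N -> 0 <= a -> 0 <= x ->
  (x <= a `^ l%:R^-1) = (x ^+ l <= a).
Proof.
by move=> l0 a0 x0; rewrite -[in RHS](powR_rootK l0 a0) ler_pXn2r// nnegrE powR_ge0.
Qed.

(** * The essential spectral radius of a kernel *)

Section essential_spectral_radius.
Context {R : realType} {V : normedModType R[i]}.
Implicit Types T : V -> V.

Lemma ess_le_splitting T (rho : R) F H : 0 <= rho ->
  quasicompact_splitting T rho F H -> ess_spectral_radius T <= rho.
Proof.
move=> rho0 sFH; apply: ge_inf; last by right; split => //; exists F, H.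
exists 0 => _ [->|[]//]; exact: spectral_radius_on_ge0.
Qed.

Lemma ess_spectral_radius_ge0 T : 0 <= ess_spectral_radius T.
Proof.
apply: lb_le_inf; first by exists (spectral_radius T); left.
move=> _ [->|[]//]; exact: spectral_radius_on_ge0.
Qed.

Lemma spectral_radius_le_opnorm T : seq_complete V -> bdd_lin T ->
  spectral_radius T <= opnorm T.
Proof.
move=> cV bT; have o0 := opnorm_ge0 bT.
apply: (spectral_radius_on_le linear_subspaceT closedT cV (C := 1)) => //; first exact: bT.1.
move=> n v _; rewrite mul1r.
by apply: (iter_bound (H := setT)) => // w _; exact: opnorm_ub.
Qed.

End essential_spectral_radius.

Section comparison.
Context {d : measure_display} {E : measurableType d} {R : realType}.
Hypothesis hE : countably_generated E.
Variable Q : R.-fker E ~> E.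

Lemma bdd_lin_kop_diff (K T : R.-fker E ~> E) : bdd_lin (kop K \- kop T).
Proof. by apply: bdd_linB; exact: kop_bdd_lin. Qed.

(** The splitting theorem requires a positive radius and a strict inequality; both are provided by
    adding [e] to the root. *)
Lemma ess_le_spectral_radius l (T : R.-fker E ~> E) : (0 < l)%N -> Kstar T ->
  kle T (kpow Q l) ->
  ess_spectral_radius (kop Q) <= spectral_radius (kop (kpow Q l) \- kop T) `^ l%:R^-1.
Proof.
move=> l0 KT TQ; have r0 := spectral_radius_on_ge0 setT (kop (kpow Q l) \- kop T).
apply/ler_addgt0Pr => e e0; set s := _ `^ _.
have s0 : 0 <= s by exact: powR_ge0.
have se0 : 0 < s + e by rewrite ltr_wpDl.
have rs : spectral_radius (kop (kpow Q l) \- kop T) < (s + e) ^+ l.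
  apply: (@le_lt_trans _ _ (s ^+ l)); first by rewrite -powR_root_le.
  by rewrite ltrXn2r ?nnegrE ?(ltW se0)// ?ltrDl// -lt0n.
have [F [H sFH]] := perturbation_splitting bmfun_complete (kop_bdd_lin Q) l0 se0
  (bdd_lin_kop_diff (kpow Q l) T) (kop_bdd_lin T)
  (fun f => esym (eq_trans (subrK _ _) (kop_kpow Q l f)))
  (fun a => Kstar_words_limit a hE TQ KT) rs.
exact: ess_le_splitting (ltW se0) sFH.
Qed.

Lemma root_spectral_radius_le l (T : R.-fker E ~> E) : (0 < l)%N ->
  spectral_radius (kop (kpow Q l) \- kop T) `^ l%:R^-1 <=
    opnorm (kop (kpow Q l) \- kop T) `^ l%:R^-1.
Proof.
move=> l0; have r0 := spectral_radius_on_ge0 setT (kop (kpow Q l) \- kop T).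
have o0 := opnorm_ge0 (bdd_lin_kop_diff (kpow Q l) T).
apply: ge0_ler_powR => //.
exact: spectral_radius_le_opnorm bmfun_complete (bdd_lin_kop_diff (kpow Q l) T).
Qed.

Lemma ess_le_Delta l (nu : probability E R) : (0 < l)%N ->
  ((ess_spectral_radius (kop Q))%:E <= Delta nu (kpow Q l) `^ (l%:R^-1))%E.
Proof.
move=> l0; have D0 := Delta_ge0 nu (kpow Q l).
have l1 : l%:R^-1 != 0 :> R by rewrite invr_eq0 pnatr_eq0 -lt0n.
case De : (Delta nu (kpow Q l)) D0 => [c||]// D0; last by rewrite poweRyr// leey.
rewrite lee_fin in D0; have r0 := ess_spectral_radius_ge0 (kop Q).
rewrite poweR_EFin lee_fin powR_root_ge//; apply/ler_addgt0Pr => e e0.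
(* The truncation requires a level strictly above Delta, hence [c + e]. *)
have [|T [KT TQ hT]] := @Delta_Kstar _ _ _ (kpow Q l) nu (c + e) hE.
  by rewrite De lte_fin ltrDl.
apply: le_trans hT; rewrite -powR_root_ge//; last exact: opnorm_ge0 (bdd_lin_kop_diff (kpow Q l) T).
exact: le_trans (ess_le_spectral_radius l0 KT TQ) (root_spectral_radius_le T l0).
Qed.

Lemma Delta_approx (e : R) : 0 < e -> exists l (nu : probability E R),
  (0 < l)%N /\ (Delta nu (kpow Q l) <= ((ess_spectral_radius (kop Q) + e) ^+ l)%:E)%E.
Proof.
move=> e0; set rho := _ + e.
have hs : has_inf (spectral_radius (kop Q) |` [set r | 0 <= r /\
    exists F H, quasicompact_splitting (kop Q) r F H]).
  split; first by exists (spectral_radius (kop Q)); left.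
  by exists 0 => _ [->|[]//]; exact: spectral_radius_on_ge0.
have [x [->|[r0 [F [H [[sF sH FH] [QF QH] [cH rH] fF _]]]]] hx] := inf_adherent e0 hs.
  (* When the near-minimiser is the spectral radius itself, the trivial splitting 0 + V serves: the
     whole space decays at a rate below [rho]. *)
  apply: (splitting_Delta (F := [set 0]) (H := setT)) => //.
  - by split=> // a u v -> ->; rewrite scaler0 addr0.
  - split; last by rewrite setIT.
    by move=> v; exists 0, v; rewrite add0r.
  - by move=> v ->; rewrite /= (lin0 linear_subspaceT (kop_bdd_lin Q).1).
  - by exists 0%N, (fun=> 0) => v ->; exists (fun=> 0) => //; rewrite big_ord0.
exact: splitting_Delta sF sH FH QF QH cH (lt_trans rH hx) fF.
Qed.

End comparison.

Theorem mainTheorem4 (R : realType) (d : measure_display)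
    (E : measurableType d) (hE : countably_generated E)
    (Q : R.-fker E ~> E) :
  ((ess_spectral_radius (kop Q))%:E =
     ereal_inf [set r : \bar R | exists (l : nat) (nu : probability E R),
       (1 <= l)%N /\ r = (Delta nu (kpow Q l) `^ (l%:R^-1))%E])
  /\
  (ess_spectral_radius (kop Q) =
     inf [set r : R | exists (l : nat) (T : R.-fker E ~> E),
       [/\ (1 <= l)%N, Kstar T, kle T (kpow Q l)
         & r = opnorm (kop (kpow Q l) \- kop T) `^ (l%:R^-1)]] /\
   ess_spectral_radius (kop Q) =
     inf [set r : R | exists (l : nat) (T : R.-fker E ~> E),
       [/\ (1 <= l)%N, Kstar T, kle T (kpow Q l)
         & r = spectral_radius (kop (kpow Q l) \- kop T) `^ (l%:R^-1)]]).
Proof.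
have r0 := ess_spectral_radius_ge0 (kop Q).
set r := ess_spectral_radius _ in r0 *.
have nonneg (e : R) : 0 < e -> 0 <= r + e by move=> /ltW e0; rewrite addr_ge0.
split.
  apply/le_anti/andP; split.
    by apply: le_ereal_inf_tmp => _ [l [nu [l0 ->]]]; exact: (ess_le_Delta hE Q nu l0).
  apply/lee_addgt0Pr => e e0; rewrite -EFinD.
  have [l [nu [l0 hD]]] := Delta_approx Q e0.
  apply: (@le_trans _ _ (Delta nu (kpow Q l) `^ l%:R^-1)%E).
    by apply: ereal_inf_lbound; exists l, nu.
  have D0 := Delta_ge0 nu (kpow Q l).
  case De : (Delta nu (kpow Q l)) D0 hD => [c||]// D0 hD.
  by rewrite poweR_EFin lee_fin powR_root_le// nonneg.
have approx (e : R) : 0 < e -> exists l T, [/\ (0 < l)%N, Kstar T, kle T (kpow Q l) &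
    opnorm (kop (kpow Q l) \- kop T) `^ l%:R^-1 <= r + e].
  move=> e0; have e2 : 0 < e / 2 by rewrite divr_gt0.
  have [l [nu [l0 hD]]] := Delta_approx Q e2.
  have [|T [KT TQ hT]] := @Delta_Kstar _ _ _ (kpow Q l) nu ((r + e) ^+ l) hE.
    apply: le_lt_trans hD _; rewrite lte_fin ltrXn2r ?nnegrE ?nonneg -?lt0n//.
    by rewrite ltrD2l ltr_pdivrMr// ltr_pMr// ltr1n.
  exists l, T; split => //; rewrite powR_root_le ?nonneg//.
  exact: opnorm_ge0 (bdd_lin_kop_diff (kpow Q l) T).
(* A witness that both real sets are nonempty, without which their infimum would be a default
   value. *)
have [l1 [T1 [l10 KT1 TQ1 _]]] := approx 1 ltr01.
split; apply/le_anti/andP; split.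
- apply: lb_le_inf; first by eexists; exists l1, T1; split.
  move=> _ [l [T [l0 KT TQ ->]]].
  exact: le_trans (ess_le_spectral_radius hE l0 KT TQ) (root_spectral_radius_le Q T l0).
- apply/ler_addgt0Pr => e /approx[l [T [l0 KT TQ h]]]; apply: le_trans h.
  apply: ge_inf; last by exists l, T.
  by exists 0 => _ [? [? [_ _ _ ->]]]; exact: powR_ge0.
- apply: lb_le_inf; first by eexists; exists l1, T1; split.
  by move=> _ [l [T [l0 KT TQ ->]]]; exact: (@ess_le_spectral_radius _ _ _ hE Q l T l0 KT TQ).
- apply/ler_addgt0Pr => e /approx[l [T [l0 KT TQ h]]]; apply: le_trans h.
  apply: le_trans (root_spectral_radius_le Q T l0).
  apply: ge_inf; last by exists l, T.
  by exists 0 => _ [? [? [_ _ _ ->]]]; exact: powR_ge0.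
Qed.
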